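(* Let $\ell_0>4\pi$, let $\Phi_0\in H^m_\sharp$ with $m$ sufficiently large, and let $\Phi$ be the $\ell_0$-periodic solution of $$\Phi_\tau+4\Phi_{\eta\eta\eta\eta}+\Phi_{\eta\eta}+\tfrac12(\Phi_\eta)^2=0,\qquad\Phi(0)=\Phi_0 .$$ Set $\Psi=\Phi_\eta$. For every $T>0$ there exists $\varepsilon_0(T)>0$ such that, for every $0<\varepsilon\le\varepsilon_0(T)$, the equation $$\partial_\tau\big(B_\varepsilon\zeta\big)+H_\varepsilon(\Psi_\tau)=S\zeta+M_\varepsilon\big((\Psi^2)_\eta\big)+\varepsilon F_\varepsilon\big((\zeta^2)_\eta\big)+2F_\varepsilon\big((\Psi\zeta)_\eta\big)$$ has a unique classical ($\ell_0$-periodic in $\eta$) solution $\zeta$ on $[0,T]$ with $\zeta(0,\cdot)=0$.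
   Context: Functions are $\ell_0$-periodic on $[-\ell_0/2,\ell_0/2]$, and $D=D_\eta$. $\{w_k\}$ is the orthonormal eigenbasis of $D_{\eta\eta}$ with periodic boundary conditions, $D_{\eta\eta}w_k=-\lambda_kw_k$, $\lambda_0=0$, $\lambda_{2j-1}=\lambda_{2j}=4\pi^2j^2/\ell_0^2$. $H^s_\sharp$ is the periodic Sobolev space. An operator with symbol $(c_k)$ acts by $\widehat{(\mathscr Cf)}(k)=c_k\widehat f(k)$. With $X_{\varepsilon,k}=\sqrt{1+4\varepsilon\lambda_k}$, the operators $B_\varepsilon,F_\varepsilon,H_\varepsilon,M_\varepsilon$ have the symbols $$b_{\varepsilon,k}=X_{\varepsilon,k}^2+(1+\varepsilon)X_{\varepsilon,k}-1-\varepsilon,\qquad f_{\varepsilon,k}=\tfrac14(X_{\varepsilon,k}^3-3X_{\varepsilon,k}^2-4(1+\varepsilon)X_{\varepsilon,k}+4+4\varepsilon),$$ $$h_{\varepsilon,k}=\tfrac1\varepsilon(X_{\varepsilon,k}^2+(1+\varepsilon)X_{\varepsilon,k}-2-\varepsilon),\qquad m_{\varepsilon,k}=\tfrac1{4\varepsilon}(X_{\varepsilon,k}^3-3X_{\varepsilon,k}^2-4(1+\varepsilon)X_{\varepsilon,k}+6+4\varepsilon),$$ and $S=-4D^4-D^2$. A classical solution is one for which $\zeta$, $\zeta_\tau$ and all $\eta$-derivatives appearing in the equation are continuous on $[0,T]\times[-\ell_0/2,\ell_0/2]$. *)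

(* Defs.v *)
From Stdlib Require Import Reals Lra ClassicalEpsilon.
Open Scope R_scope.

Definition periodic (l : R) (f : R -> R) : Prop := forall x, f (x + l) = f x.

(* Riemann integral, total via epsilon (agrees with RiemannInt whenever
   f is Riemann integrable on [a,b], e.g. continuous). *)
Definition integral (f : R -> R) (a b : R) : R :=
  epsilon (inhabits 0) (fun I => exists pr : Riemann_integrable f a b, RiemannInt pr = I).

Definition jidx (k : nat) : nat := Nat.div2 (S k).

(* eigenvalues of -D_{eta eta} with periodic b.c. *)
Definition lam (l : R) (k : nat) : R := (2 * PI * INR (jidx k) / l) ^ 2.

(* orthonormal eigenbasis w_k of D_{eta eta} on [-l/2,l/2] *)
Definition wb (l : R) (k : nat) (x : R) : R :=
  match k with
  | O => / sqrt l
  | _ => if Nat.odd k then sqrt (2 / l) * cos (2 * PI * INR (jidx k) * x / l)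
         else sqrt (2 / l) * sin (2 * PI * INR (jidx k) * x / l)
  end.

Definition coef (l : R) (f : R -> R) (k : nat) : R :=
  integral (fun x => f x * wb l k x) (- (l / 2)) (l / 2).

(* periodic Sobolev space H^m_sharp (continuous representatives) *)
Definition Hm_sharp (l : R) (m : nat) (f : R -> R) : Prop :=
  continuity f /\ periodic l f /\
  exists S, infinite_sum (fun k => (1 + lam l k) ^ m * (coef l f k) ^ 2) S.

Definition Xs (eps l : R) (k : nat) : R := sqrt (1 + 4 * eps * lam l k).
Definition bsym (eps l : R) (k : nat) : R :=
  let X := Xs eps l k in X ^ 2 + (1 + eps) * X - 1 - eps.
Definition fsym (eps l : R) (k : nat) : R :=
  let X := Xs eps l k in / 4 * (X ^ 3 - 3 * X ^ 2 - 4 * (1 + eps) * X + 4 + 4 * eps).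
Definition hsym (eps l : R) (k : nat) : R :=
  let X := Xs eps l k in / eps * (X ^ 2 + (1 + eps) * X - 2 - eps).
Definition msym (eps l : R) (k : nat) : R :=
  let X := Xs eps l k in / (4 * eps) * (X ^ 3 - 3 * X ^ 2 - 4 * (1 + eps) * X + 6 + 4 * eps).

Definition cont_on (D : R -> Prop) (u : R -> R -> R) : Prop :=
  forall t x, D t -> forall e, e > 0 -> exists d, d > 0 /\
    forall s y, D s -> Rabs (s - t) < d -> Rabs (y - x) < d ->
      Rabs (u s y - u t x) < e.

Definition deriv_within (D : R -> Prop) (f : R -> R) (t l : R) : Prop :=
  limit1_in (fun s => (f s - f t) / (s - t)) (fun s => D s /\ s <> t) l t.

Definition deta (D : R -> Prop) (u u' : R -> R -> R) : Prop :=
  forall t x, D t -> derivable_pt_lim (fun y => u t y) x (u' t x).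

Definition dtau (D : R -> Prop) (u u' : R -> R -> R) : Prop :=
  forall t x, D t -> deriv_within D (fun s => u s x) t (u' t x).

(* v(t) = C u(t) for the Fourier multiplier with symbol c, for times in D *)
Definition realizes (l : R) (D : R -> Prop) (c : nat -> R) (u v : R -> R -> R) : Prop :=
  forall t, D t -> periodic l (v t) /\ forall k, coef l (v t) k = c k * coef l (u t) k.

Definition ks_sol (l : R) (Phi0 : R -> R) (Phi : R -> R -> R) : Prop :=
  let D := fun t => 0 <= t in
  (forall t, D t -> periodic l (Phi t)) /\ (forall x, Phi 0 x = Phi0 x) /\
  cont_on D Phi /\
  exists Pt P1 P2 P3 P4,
    dtau D Phi Pt /\ cont_on D Pt /\
    deta D Phi P1 /\ deta D P1 P2 /\ deta D P2 P3 /\ deta D P3 P4 /\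
    cont_on D P1 /\ cont_on D P2 /\ cont_on D P3 /\ cont_on D P4 /\
    forall t x, D t -> Pt t x + 4 * P4 t x + P2 t x + / 2 * (P1 t x) ^ 2 = 0.

Definition zeta_sol (l eps T : R) (Psi zeta : R -> R -> R) : Prop :=
  let D := fun t => 0 <= t <= T in
  (forall t, D t -> periodic l (zeta t)) /\ (forall x, zeta 0 x = 0) /\
  cont_on D zeta /\
  exists zt z1 z2 z3 z4 Bz Bzt Psit HPt P2d MP2 Z2d FZ2 PZd FPZ,
    dtau D zeta zt /\ cont_on D zt /\
    deta D zeta z1 /\ deta D z1 z2 /\ deta D z2 z3 /\ deta D z3 z4 /\
    cont_on D z1 /\ cont_on D z2 /\ cont_on D z3 /\ cont_on D z4 /\
    realizes l D (bsym eps l) zeta Bz /\ cont_on D Bz /\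
    dtau D Bz Bzt /\ cont_on D Bzt /\
    dtau D Psi Psit /\ cont_on D Psit /\
    realizes l D (hsym eps l) Psit HPt /\ cont_on D HPt /\
    deta D (fun t y => (Psi t y) ^ 2) P2d /\ cont_on D P2d /\
    realizes l D (msym eps l) P2d MP2 /\ cont_on D MP2 /\
    deta D (fun t y => (zeta t y) ^ 2) Z2d /\ cont_on D Z2d /\
    realizes l D (fsym eps l) Z2d FZ2 /\ cont_on D FZ2 /\
    deta D (fun t y => Psi t y * zeta t y) PZd /\ cont_on D PZd /\
    realizes l D (fsym eps l) PZd FPZ /\ cont_on D FPZ /\
    forall t x, D t ->
      Bzt t x + HPt t x =
        - 4 * z4 t x - z2 t x + MP2 t x + eps * FZ2 t x + 2 * FPZ t x.

(* Main.v *)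
(** Everything is done on the Fourier side, in the weighted sup norms
    [sup_j |z_j| (1 + j)^p], [p >= 2], which are Banach algebras up to a constant.

    The Kuramoto-Sivashinsky solution is regularised by its Duhamel formula: if the coefficients
    of Phi decay like [j^-p], those of [(Phi_eta)^2] decay like [j^-(p-1)], and the dissipation
    [4 D^4] improves this to [j^-(p+3)].  Starting from [p = 4] (Phi is C^4), three steps
    give [p = 13].

    For zeta, the [j]-th coefficient, of frequency [y], solves
    [b z' = -(4 y^4 - y^2) z + f (i y) (2 Psi zeta + eps zeta^2)^ + g].
    In the norm with time weight [exp (-gam t)] the Duhamel operator of the nonlinear part has
    norm at most a constant times [sup y |f| / (4 y^4 - y^2 + gam b)].  As
    [y |f| <= 12 y + 96 eps y^4], this is as small as desired for gam large and then eps small,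
    so the map is a contraction on [0, T] and no a priori estimate is needed.  The same
    contraction with [p = 2], together with continuity in time of the coefficients of a
    classical solution, gives uniqueness. *)
Require Import Defs.
From Stdlib Require Import Reals Lra Lia Bool ClassicalEpsilon.
From Coquelicot Require Import Coquelicot.
Open Scope R_scope.

(** * Fourier moments *)

(** The obstacle: for fixed [eps] the nonlinear terms have the full order of the dissipation, since
    f grows like y^3 and the derivative adds one power. No smoothing is left to pay for them, so
    smallness has to come from constants, mode by mode. The constants are chosen in the order: bound
    [A] of Psi, ratio [kap], weight [gam] and [eps1], radius of the ball, final [eps0]. This order
    is possible because the factors 1/eps in H and M cancel, which makes the forcing bound uniform
    in [eps]. The exponents are counted backwards. Continuity of a series uses exponent 2, and zeta
    needs four derivatives, hence 6; F, of order 3, then acts on derivatives with exponent 5. The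
    forcing must have exponent 6 as well: M has order 4 and acts on a derivative, which asks for 11
    on Psi^2; H has order 2, which asks for 8 on Psi_tau. Exponent 13 for Phi yields 12 for Psi and
    8 for Psi_tau. *)

Definition RI (f : R -> R) (a b : R) : R := RInt f a b.

Definition cts (f : R -> R) : Prop := forall x, continuous f x.

Lemma cts_plus f g : cts f -> cts g -> cts (fun x => f x + g x).
Proof. intros Hf Hg x. exact (continuous_plus f g x (Hf x) (Hg x)). Qed.

Lemma cts_minus f g : cts f -> cts g -> cts (fun x => f x - g x).
Proof. intros Hf Hg x. exact (continuous_minus f g x (Hf x) (Hg x)). Qed.

Lemma cts_mult f g : cts f -> cts g -> cts (fun x => f x * g x).
Proof. intros Hf Hg x. exact (continuous_mult f g x (Hf x) (Hg x)). Qed.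

Lemma cts_const c : cts (fun _ => c).
Proof. intros x. apply continuous_const. Qed.

Lemma cts_id : cts (fun x => x).
Proof. intros x. apply continuous_id. Qed.

Lemma cts_derivable f f' : (forall x, is_derive f x (f' x)) -> cts f.
Proof. intros H x. apply (ex_derive_continuous f x). exists (f' x). apply H. Qed.

Lemma cts_pow f n : cts f -> cts (fun x => f x ^ n).
Proof.
  intros Hf; induction n as [|n IH]; simpl.
  - apply cts_const.
  - apply cts_mult; assumption.
Qed.

Create HintDb cts.
#[global] Hint Resolve cts_plus cts_minus cts_mult cts_const cts_id cts_pow : cts.

Lemma cts_ex_RInt f a b : cts f -> ex_RInt f a b.
Proof. intros H. apply (ex_RInt_continuous (V := R_CompleteNormedModule)). intros z _. apply H. Qed.

Lemma RI_plus f g a b : cts f -> cts g ->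
  RI (fun x => f x + g x) a b = RI f a b + RI g a b.
Proof. intros Hf Hg. exact (RInt_plus f g a b (cts_ex_RInt f a b Hf) (cts_ex_RInt g a b Hg)). Qed.

Lemma RI_scal c f a b : cts f -> RI (fun x => c * f x) a b = c * RI f a b.
Proof. intros Hf. exact (RInt_scal f a b c (cts_ex_RInt f a b Hf)). Qed.

Lemma RI_ext f g a b : (forall x, f x = g x) -> RI f a b = RI g a b.
Proof. intros H. apply (RInt_ext (V := R_CompleteNormedModule)). intros x _. apply H. Qed.

Lemma RI_const c a b : RI (fun _ => c) a b = (b - a) * c.
Proof. exact (RInt_const a b c). Qed.

Lemma RI_derive F f a b : (forall x, is_derive F x (f x)) -> cts f -> RI f a b = F b - F a.
Proof.
  intros HF Hf. apply (is_RInt_unique (V := R_CompleteNormedModule)).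
  apply (is_RInt_derive (V := R_CompleteNormedModule)); intros x _; [apply HF | apply Hf].
Qed.

(** The epsilon operator returns a value for some unknown integrability proof; [RInt_Reals] shows
    that the value does not depend on that proof. *)
Lemma integral_RInt f a b : ex_RInt f a b -> integral f a b = RI f a b.
Proof.
  intros H. pose proof (ex_RInt_Reals_0 f a b H) as pr. unfold integral.
  assert (E : exists I, exists pr : Riemann_integrable f a b, RiemannInt pr = I)
    by (exists (RiemannInt pr); exists pr; reflexivity).
  pose proof (ClassicalEpsilon.epsilon_spec (inhabits 0) _ E) as [pr' <-].
  symmetry. apply RInt_Reals.
Qed.

Definition om (l : R) (j : nat) : R := 2 * PI * INR j / l.

(** [true] is the cosine and [false] the sine. Differentiation flips the flag and multiplies by
    [sg b * om l j], so both families share their lemmas. *)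
Definition trig (l : R) (b : bool) (j : nat) (x : R) : R :=
  if b then cos (om l j * x) else sin (om l j * x).

Definition sg (b : bool) : R := if b then -1 else 1.

Lemma om_pos l j : 0 < l -> 0 <= om l j.
Proof.
  intros. unfold om, Rdiv. pose proof PI_RGT_0. pose proof (pos_INR j).
  apply Rmult_le_pos; [nra|]. left. now apply Rinv_0_lt_compat.
Qed.

Lemma om_0 l : om l 0 = 0.
Proof. unfold om, Rdiv. simpl. ring. Qed.

Lemma om_S l j : 0 < l -> 0 < om l (S j).
Proof.
  intros. unfold om. pose proof PI_RGT_0. rewrite S_INR. pose proof (pos_INR j).
  apply Rdiv_lt_0_compat; nra.
Qed.

Lemma om_lin l j : om l j = om l 1 * INR j.
Proof. unfold om, Rdiv. simpl. ring. Qed.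

Lemma om_le l j : 0 < l -> om l j <= om l 1 * (1 + INR j).
Proof. intros H. rewrite om_lin. pose proof (om_pos l 1 H). nra. Qed.

Lemma trig_bound l b j x : Rabs (trig l b j x) <= 1.
Proof.
  unfold trig. destruct b; apply Rabs_le; [apply COS_bound | apply SIN_bound].
Qed.

Lemma trig_derive l b j x :
  is_derive (trig l b j) x (sg b * om l j * trig l (negb b) j x).
Proof. unfold trig, sg; destruct b; simpl; auto_derive; auto; ring. Qed.

Lemma cts_trig l b j : cts (trig l b j).
Proof. eapply cts_derivable. intros x. apply trig_derive. Qed.
#[global] Hint Resolve cts_trig : cts.

Lemma cts_trig' l b j : cts (fun x => trig l b j x).
Proof. exact (cts_trig l b j). Qed.
#[global] Hint Resolve cts_trig' : cts.

Lemma trig_per l b j x : 0 < l -> trig l b j (x + l) = trig l b j x.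
Proof.
  intros Hl. unfold trig.
  replace (om l j * (x + l)) with (om l j * x + 2 * INR j * PI) by (unfold om; field; lra).
  destruct b; [apply cos_period | apply sin_period].
Qed.

(** The absolute difference: with truncated subtraction one of the two summands vanishes. *)
Definition dist (i j : nat) : nat := (i - j) + (j - i).

Lemma om_plus l i j : om l (i + j) = om l i + om l j.
Proof. unfold om. rewrite plus_INR. unfold Rdiv. ring. Qed.

Lemma om_dist l i j :
  (om l (dist i j) = om l i - om l j) \/ (om l (dist i j) = om l j - om l i).
Proof.
  unfold dist. destruct (Compare_dec.le_lt_dec i j) as [H|H]; [right|left].
  - replace (i - j + (j - i))%nat with (j - i)%nat by lia.
    unfold om. rewrite minus_INR by lia. unfold Rdiv. ring.
  - replace (i - j + (j - i))%nat with (i - j)%nat by lia.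
    unfold om. rewrite minus_INR by lia. unfold Rdiv. ring.
Qed.

(** Product-to-sum formulas: equal types give cosines and different types give sines, whence
    [eqb b b']. The signs vary with the types and, for sines, with the order of [i] and [j]; only
    the sizes of the coefficients matter later. *)
Lemma trig_prod l b b' i j : exists c1 c2, Rabs c1 = / 2 /\ Rabs c2 = / 2 /\
  forall x, trig l b i x * trig l b' j x =
    c1 * trig l (eqb b b') (i + j) x + c2 * trig l (eqb b b') (dist i j) x.
Proof.
  assert (Hp : Rabs (/ 2) = / 2) by (apply Rabs_right; lra).
  assert (Hn : Rabs (- / 2) = / 2) by (rewrite Rabs_Ropp; exact Hp).
  destruct (om_dist l i j) as [E|E].
  - destruct b, b'; simpl.
    + exists (/2), (/2). repeat split; auto. intros x. rewrite om_plus, E.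
      replace ((om l i + om l j) * x) with (om l i * x + om l j * x) by ring.
      replace ((om l i - om l j) * x) with (om l i * x - om l j * x) by ring.
      rewrite cos_plus, cos_minus. field.
    + exists (/2), (-/2). repeat split; auto. intros x. rewrite om_plus, E.
      replace ((om l i + om l j) * x) with (om l i * x + om l j * x) by ring.
      replace ((om l i - om l j) * x) with (om l i * x - om l j * x) by ring.
      rewrite sin_plus, sin_minus. field.
    + exists (/2), (/2). repeat split; auto. intros x. rewrite om_plus, E.
      replace ((om l i + om l j) * x) with (om l i * x + om l j * x) by ring.
      replace ((om l i - om l j) * x) with (om l i * x - om l j * x) by ring.
      rewrite sin_plus, sin_minus. field.
    + exists (-/2), (/2). repeat split; auto. intros x. rewrite om_plus, E.
      replace ((om l i + om l j) * x) with (om l i * x + om l j * x) by ring.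
      replace ((om l i - om l j) * x) with (om l i * x - om l j * x) by ring.
      rewrite cos_plus, cos_minus. field.
  - destruct b, b'; simpl.
    + exists (/2), (/2). repeat split; auto. intros x. rewrite om_plus, E.
      replace ((om l i + om l j) * x) with (om l i * x + om l j * x) by ring.
      replace ((om l j - om l i) * x) with (om l j * x - om l i * x) by ring.
      rewrite cos_plus, cos_minus. field.
    + exists (/2), (/2). repeat split; auto. intros x. rewrite om_plus, E.
      replace ((om l i + om l j) * x) with (om l i * x + om l j * x) by ring.
      replace ((om l j - om l i) * x) with (om l j * x - om l i * x) by ring.
      rewrite sin_plus, sin_minus. field.
    + exists (/2), (-/2). repeat split; auto. intros x. rewrite om_plus, E.
      replace ((om l i + om l j) * x) with (om l i * x + om l j * x) by ring.
      replace ((om l j - om l i) * x) with (om l j * x - om l i * x) by ring.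
      rewrite sin_plus, sin_minus. field.
    + exists (-/2), (/2). repeat split; auto. intros x. rewrite om_plus, E.
      replace ((om l i + om l j) * x) with (om l i * x + om l j * x) by ring.
      replace ((om l j - om l i) * x) with (om l j * x - om l i * x) by ring.
      rewrite cos_plus, cos_minus. field.
Qed.

Lemma RInt_trig_0 l b m : 0 < l -> (b = true -> (0 < m)%nat) ->
  RI (trig l b m) (- (l / 2)) (l / 2) = 0.
Proof.
  intros Hl H. destruct m as [|m].
  - destruct b; [specialize (H eq_refl); lia|].
    rewrite (RI_ext _ (fun _ => 0)).
    + rewrite RI_const. ring.
    + intros x. unfold trig. rewrite om_0, Rmult_0_l. apply sin_0.
  - pose proof (om_S l m Hl) as Ho.
    (* The primitive is periodic, so its increment over one period vanishes. *)
    rewrite (RI_derive (fun x => - sg b / om l (S m) * trig l (negb b) (S m) x) (trig l b (S m))).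
    + replace (l / 2) with (- (l / 2) + l) at 1 by field.
      rewrite trig_per by assumption. ring.
    + intros x. evar_last.
      * apply (is_derive_scal (trig l (negb b) (S m)) x (- sg b / om l (S m))). apply trig_derive.
      * unfold sg; destruct b; simpl; field; lra.
    + apply cts_trig.
Qed.

(** Left unnormalised, so that products and derivatives act without square roots. Normalisation
    enters only through [nu] in the series and [cnorm] in [coef_mom]. *)
Definition mom (l : R) (v : R -> R) (b : bool) (j : nat) : R :=
  RI (fun x => v x * trig l b j x) (- (l / 2)) (l / 2).

Lemma mom_ext l u v b j : (forall x, u x = v x) -> mom l u b j = mom l v b j.
Proof. intros H. apply RI_ext. intros x. now rewrite H. Qed.

Lemma mom_plus l u v b j : cts u -> cts v ->
  mom l (fun x => u x + v x) b j = mom l u b j + mom l v b j.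
Proof.
  intros Hu Hv. unfold mom. rewrite <- RI_plus by auto with cts.
  apply RI_ext. intros x. ring.
Qed.

Lemma mom_scal l c u b j : cts u -> mom l (fun x => c * u x) b j = c * mom l u b j.
Proof.
  intros Hu. unfold mom. rewrite <- RI_scal by auto with cts.
  apply RI_ext. intros x. ring.
Qed.

Lemma mom_minus l u v b j : cts u -> cts v ->
  mom l (fun x => u x - v x) b j = mom l u b j - mom l v b j.
Proof.
  intros Hu Hv. rewrite (mom_ext l _ (fun x => u x + (-1) * v x)) by (intros; ring).
  rewrite mom_plus, mom_scal by auto with cts. ring.
Qed.

Lemma mom_bound l u M b j : 0 < l -> cts u ->
  (forall x, - (l / 2) <= x <= l / 2 -> Rabs (u x) <= M) -> Rabs (mom l u b j) <= l * M.
Proof.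
  intros Hl Hu HM. unfold mom.
  replace l with (l / 2 - - (l / 2)) at 3 by field.
  apply abs_RInt_le_const; [lra | apply cts_ex_RInt; auto with cts |].
  intros x Hx. rewrite Rabs_mult. pose proof (trig_bound l b j x). pose proof (HM x Hx).
  pose proof (Rabs_pos (u x)). pose proof (Rabs_pos (trig l b j x)). nra.
Qed.

Lemma mom_false_0 l v : mom l v false 0 = 0.
Proof.
  unfold mom. rewrite (RI_ext _ (fun _ => 0)).
  - rewrite RI_const. ring.
  - intros x. unfold trig. rewrite om_0, Rmult_0_l, sin_0. ring.
Qed.

(* With these factors the Fourier series of [v] is the sum of [nu l j * mom l v b j * trig l b j];
   the spurious index [(false, 0)] carries the zero function [sin 0]. *)
Definition nu (l : R) (j : nat) : R := match j with O => / l | _ => 2 / l end.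

Lemma nu_pos l j : 0 < l -> 0 < nu l j <= 2 / l.
Proof.
  intros H. pose proof (Rinv_0_lt_compat l H). unfold nu, Rdiv. destruct j; lra.
Qed.

Lemma mom_trig_ne l b b' i j : 0 < l -> (b <> b' \/ i <> j) -> mom l (trig l b i) b' j = 0.
Proof.
  intros Hl H. unfold mom. destruct (trig_prod l b b' i j) as (c1 & c2 & _ & _ & E).
  rewrite (RI_ext _ _ _ _ E), RI_plus, !RI_scal by auto with cts.
  rewrite !RInt_trig_0; try assumption; [ring| |]; intros Hb; unfold dist;
    apply eqb_prop in Hb; destruct H as [H|H]; try congruence; lia.
Qed.

Lemma mom_trig_eq l b j : 0 < l -> (b = false -> (0 < j)%nat) ->
  nu l j * mom l (trig l b j) b j = 1.
Proof.
  intros Hl H. unfold mom. destruct j as [|j].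
  - destruct b; [|specialize (H eq_refl); lia].
    rewrite (RI_ext _ (fun _ => 1)).
    + rewrite RI_const. unfold nu.
      field; lra.
    + intros x. unfold trig. rewrite om_0, Rmult_0_l, cos_0. ring.
  - rewrite (RI_ext _ (fun x => / 2 + (- sg b / 2) * trig l true (S j + S j) x)).
    + rewrite RI_plus, RI_scal by auto with cts.
      rewrite RInt_trig_0 by (auto; lia).
      rewrite RI_const. unfold nu.
      field; lra.
    + intros x. unfold trig. rewrite om_plus, Rmult_plus_distr_r, cos_plus.
      pose proof (sin2_cos2 (om l (S j) * x)) as E. unfold Rsqr in E.
      destruct b; unfold sg; nra.
Qed.

(** Integration by parts; the boundary terms cancel by periodicity. *)
Lemma mom_derive l v v' b j : 0 < l -> periodic l v ->
  (forall x, is_derive v x (v' x)) -> cts v' ->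
  mom l v' b j = - sg b * om l j * mom l v (negb b) j.
Proof.
  intros Hl Hp Hd Hc. assert (Hv : cts v) by (eapply cts_derivable; eassumption).
  assert (E : RI (fun x => v' x * trig l b j x + (sg b * om l j) * (v x * trig l (negb b) j x))
                (- (l / 2)) (l / 2) = 0).
  { rewrite (RI_derive (fun x => v x * trig l b j x)).
    - replace (l / 2) with (- (l / 2) + l) at 1 2 by field. rewrite trig_per, Hp by assumption. ring.
    - intros x. evar_last.
      + apply (is_derive_mult v (trig l b j)); [apply Hd | apply trig_derive | apply Rmult_comm].
      + unfold plus, mult; simpl. ring.
    - auto with cts. }
  rewrite RI_plus, RI_scal in E by auto with cts. unfold mom. lra.
Qed.

(** * Series with quadratic decay and continuity in time *)

Lemma inv_tele_series A N :
  is_series (fun k => A * (/ (INR N + 1 + INR k) - / (INR N + 2 + INR k))) (A / (1 + INR N)).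
Proof.
  assert (E : forall n, sum_n (fun k => A * (/ (INR N + 1 + INR k) - / (INR N + 2 + INR k))) n
    = A / (1 + INR N) - A * / (INR N + 2 + INR n)).
  { intros n. pose proof (pos_INR N). induction n as [|n IH].
    - rewrite sum_O. simpl. field. lra.
    - rewrite sum_Sn, IH, S_INR. unfold plus; simpl. pose proof (pos_INR n).
      field. lra. }
  change (is_lim_seq (sum_n (fun k => A * (/ (INR N + 1 + INR k) - / (INR N + 2 + INR k)))) (A / (1 + INR N))).
  apply is_lim_seq_ext with (1 := fun n => eq_sym (E n)).
  replace (Finite (A / (1 + INR N))) with (Finite (A / (1 + INR N) - A * 0)) by (f_equal; ring).
  apply is_lim_seq_minus'; [apply is_lim_seq_const|].
  apply (is_lim_seq_scal_l (fun n => / (INR N + 2 + INR n)) A 0).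
  change (Finite 0) with (Rbar_inv p_infty).
  apply is_lim_seq_inv; [|discriminate].
  apply (is_lim_seq_plus (fun _ => INR N + 2) INR (INR N + 2) p_infty p_infty).
  - apply is_lim_seq_const.
  - apply is_lim_seq_INR.
  - reflexivity.
Qed.

(** Since (x + 1)^-2 is at most 1/x - 1/(x + 1), a telescoping series dominates the tail. The bound
    depends on [A] alone, hence it is uniform in any parameter on which [a] depends. *)
Lemma quad_tail a A : (forall j, Rabs (a j) * (1 + INR j) ^ 2 <= A) ->
  ex_series a /\ forall N, Rabs (Series a - sum_f_R0 a N) <= A / (1 + INR N).
Proof.
  intros H.
  assert (HA : 0 <= A).
  { pose proof (H 0%nat) as h. simpl in h. pose proof (Rabs_pos (a 0%nat)). lra. }
  assert (B : forall N k, Rabs (a (S N + k)%nat)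
      <= A * (/ (INR N + 1 + INR k) - / (INR N + 2 + INR k))).
  { intros N k. pose proof (H (S N + k)%nat) as h. rewrite plus_INR, S_INR in h.
    pose proof (pos_INR N). pose proof (pos_INR k).
    set (x := INR N + 1 + INR k) in *.
    replace (INR N + 2 + INR k) with (x + 1) by (unfold x; ring).
    assert (1 <= x) by (unfold x; lra).
    replace (1 + (INR N + 1 + INR k)) with (x + 1) in h by (unfold x; ring).
    replace (/ x - / (x + 1)) with (/ (x * (x + 1))) by (field; lra).
    apply Rle_trans with (A / (x + 1) ^ 2).
    - apply Rle_div_r; [nra|now rewrite (Rplus_comm x)].
    - apply Rmult_le_compat_l; [exact HA|]. apply Rinv_le_contravar; nra. }
  assert (Hex : ex_series a).
  { apply (ex_series_incr_n a 1).
    apply (ex_series_le (V := R_CompleteNormedModule) _ _ (B 0%nat)).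
    eexists; apply inv_tele_series. }
  split; [exact Hex|]. intros N.
  rewrite (Series_incr_n a (S N)) by (auto; lia). simpl Init.Nat.pred.
  replace (sum_f_R0 a N + _ - sum_f_R0 a N) with (Series (fun k => a (S N + k)%nat)) by ring.
  eapply Rle_trans.
  - apply Series_Rabs.
    apply (ex_series_le (V := R_CompleteNormedModule) _ (fun k => A * (/ (INR N + 1 + INR k) - / (INR N + 2 + INR k)))).
    + intros k. unfold norm; simpl. unfold abs; simpl. rewrite Rabs_Rabsolu. apply B.
    + eexists; apply inv_tele_series.
  - rewrite <- (is_series_unique _ _ (inv_tele_series A N)).
    apply Series_le.
    + intros k. split; [apply Rabs_pos | apply B].
    + eexists; apply inv_tele_series.
Qed.

Lemma small_tail A e : 0 < e -> exists N : nat, A / (1 + INR N) < e.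
Proof.
  intros He. destruct (nfloor_ex (Rabs A / e)) as [N [_ HN]].
  { apply Rdiv_le_0_compat; [apply Rabs_pos | assumption]. }
  exists N. pose proof (pos_INR N). apply Rlt_div_l; [lra|].
  apply Rlt_div_l in HN; [|assumption]. pose proof (Rle_abs A). lra.
Qed.

(** Recasts continuity on D as a limit along a [within] filter, so that sums and products come from
    the filter library. *)
Lemma cont_on_filter D u : cont_on D u <->
  forall t x, D t -> filterlim (fun p => u (fst p) (snd p))
    (within (fun p => D (fst p)) (locally (t, x))) (locally (u t x)).
Proof.
  split.
  - intros H t x Ht. apply filterlim_locally. intros e.
    destruct (H t x Ht e (cond_pos e)) as (d & Hd & K).
    exists (mkposreal d Hd). intros [s y] [B1 B2] Ds. simpl in *.
    apply (K s y Ds B1 B2).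
  - intros H t x Ht e He.
    pose proof (proj1 (filterlim_locally _ _) (H t x Ht) (mkposreal e He)) as [d K].
    exists d. split; [apply cond_pos|]. intros s y Ds B1 B2.
    apply (K (s, y)); [split; assumption | exact Ds].
Qed.

Lemma cont_on_plus D u v : cont_on D u -> cont_on D v -> cont_on D (fun t x => u t x + v t x).
Proof.
  rewrite !cont_on_filter. intros Hu Hv t x Ht.
  refine (filterlim_comp_2 _ _ Rplus (Hu t x Ht) (Hv t x Ht) _). exact (filterlim_plus (u t x) (v t x)).
Qed.

Lemma cont_on_mult D u v : cont_on D u -> cont_on D v -> cont_on D (fun t x => u t x * v t x).
Proof.
  rewrite !cont_on_filter. intros Hu Hv t x Ht.
  refine (filterlim_comp_2 _ _ Rmult (Hu t x Ht) (Hv t x Ht) _). exact (filterlim_mult (u t x) (v t x)).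
Qed.

Lemma cont_on_const D c : cont_on D (fun _ _ => c).
Proof.
  intros t x _ e He. exists 1. split; [lra|]. intros. rewrite Rminus_diag, Rabs_R0. exact He.
Qed.

Lemma cont_on_x D f : cts f -> cont_on D (fun _ x => f x).
Proof.
  intros Hf t x _ e He.
  pose proof (proj1 (filterlim_locally _ _) (Hf x) (mkposreal e He)) as [d K].
  exists d. split; [apply cond_pos|]. intros s y _ _ B. apply (K y B).
Qed.

Lemma cont_on_minus D u v : cont_on D u -> cont_on D v -> cont_on D (fun t x => u t x - v t x).
Proof.
  intros Hu Hv. pose proof (cont_on_plus D u (fun t x => (-1) * v t x) Hu
    (cont_on_mult D _ _ (cont_on_const D (-1)) Hv)) as H.
  intros t x Ht e He. destruct (H t x Ht e He) as (d & Hd & K). exists d. split; [exact Hd|].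
  intros s y Ds B1 B2. specialize (K s y Ds B1 B2).
  replace (u s y - v s y - _) with (u s y + -1 * v s y - (u t x + -1 * v t x)) by ring. exact K.
Qed.

Lemma cont_on_pow D u n : cont_on D u -> cont_on D (fun t x => u t x ^ n).
Proof.
  intros H. induction n as [|n IH]; simpl; [apply cont_on_const | now apply cont_on_mult].
Qed.

Lemma cont_on_ext (D : R -> Prop) u v :
  (forall t x, D t -> u t x = v t x) -> cont_on D u -> cont_on D v.
Proof.
  intros E H t x Ht e He. destruct (H t x Ht e He) as (d & Hd & K). exists d. split; [exact Hd|].
  intros s y Ds B1 B2. rewrite <- !E by assumption. now apply K.
Qed.

Lemma cont_on_mono (D D' : R -> Prop) u : (forall t, D' t -> D t) -> cont_on D u -> cont_on D' u.
Proof.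
  intros I H t x Ht e He. destruct (H t x (I t Ht) e He) as (d & Hd & K).
  exists d. split; [exact Hd|]. intros s y Ds. apply K. now apply I.
Qed.

Lemma cont_on_cts D u t : cont_on D u -> D t -> cts (u t).
Proof.
  intros H Ht x. apply filterlim_locally. intros e.
  destruct (H t x Ht e (cond_pos e)) as (d & Hd & K).
  exists (mkposreal d Hd). intros y B. apply (K t y Ht); [|exact B].
  rewrite Rminus_diag, Rabs_R0. exact Hd.
Qed.

#[global] Hint Resolve cont_on_plus cont_on_minus cont_on_mult cont_on_const cont_on_pow : cts.

Lemma cont_on_series D (f : nat -> R -> R -> R) A :
  (forall t x j, D t -> Rabs (f j t x) * (1 + INR j) ^ 2 <= A) ->
  (forall j, cont_on D (f j)) -> cont_on D (fun t x => Series (fun j => f j t x)).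
Proof.
  intros HA Hc.
  assert (Hs : forall N, cont_on D (fun t x => sum_f_R0 (fun j => f j t x) N)).
  { induction N as [|N IH]; simpl; auto with cts. }
  intros t x Ht e He.
  destruct (small_tail A (e / 3)) as [N HN]; [lra|].
  destruct (Hs N t x Ht (e / 3)) as (d & Hd & K); [lra|].
  exists d. split; [exact Hd|]. intros s y Ds B1 B2. specialize (K s y Ds B1 B2).
  pose proof (proj2 (quad_tail (fun j => f j t x) A (fun j => HA t x j Ht)) N) as T1.
  pose proof (proj2 (quad_tail (fun j => f j s y) A (fun j => HA s y j Ds)) N) as T2.
  apply Rabs_def2 in K. apply Rabs_le_between in T1. apply Rabs_le_between in T2.
  apply Rabs_def1; lra.
Qed.

Lemma deriv_within_plus D f g t a b :
  deriv_within D f t a -> deriv_within D g t b -> deriv_within D (fun s => f s + g s) t (a + b).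
Proof.
  unfold deriv_within. intros Hf Hg. pose proof (limit_plus _ _ _ _ _ _ Hf Hg) as H.
  intros e He. destruct (H e He) as (d & Hd & K). exists d. split; [exact Hd|].
  intros s Hs. specialize (K s Hs).
  replace ((f s + g s - (f t + g t)) / (s - t)) with ((f s - f t) / (s - t) + (g s - g t) / (s - t))
    by (unfold Rdiv; ring). exact K.
Qed.

Lemma deriv_within_scal D f t a c :
  deriv_within D f t a -> deriv_within D (fun s => c * f s) t (c * a).
Proof.
  unfold deriv_within. intros Hf.
  pose proof (limit_mul (fun _ => c) _ _ _ _ _ (limit_free (fun _ => c) _ 0 t) Hf) as H.
  intros e He. destruct (H e He) as (d & Hd & K). exists d. split; [exact Hd|].
  intros s Hs. specialize (K s Hs).
  replace ((c * f s - c * f t) / (s - t)) with (c * ((f s - f t) / (s - t)))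
    by (unfold Rdiv; ring). exact K.
Qed.

Lemma deriv_within_ext (D : R -> Prop) f g t a : D t -> (forall s, D s -> f s = g s) ->
  deriv_within D f t a -> deriv_within D g t a.
Proof.
  intros Ht E H e He. destruct (H e He) as (d & Hd & K). exists d. split; [exact Hd|].
  intros s Hs. rewrite <- !E by tauto. now apply K.
Qed.

Lemma deriv_within_mono (D D' : R -> Prop) f t a :
  (forall s, D' s -> D s) -> deriv_within D f t a -> deriv_within D' f t a.
Proof.
  intros I H e He. destruct (H e He) as (d & Hd & K). exists d. split; [exact Hd|].
  intros s Hs. apply K. repeat split; try apply I; tauto.
Qed.

Lemma deriv_within_derive f t a : deriv_within (fun _ => True) f t a <-> is_derive f t a.
Proof.
  rewrite is_derive_Reals. split.
  - intros H e He. destruct (H e He) as (d & Hd & K). exists (mkposreal d Hd).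
    intros h Hh Hd'. simpl in K. unfold Rdist in K.
    specialize (K (t + h)). replace (t + h - t) with h in K by ring.
    apply K. repeat split; [|exact Hd']. intros E. apply Hh. lra.
  - intros H e He. destruct (H e He) as [d K]. exists d. split; [apply cond_pos|].
    intros s [[_ Hs] Hd]. simpl in *. unfold Rdist in *.
    specialize (K (s - t)). replace (t + (s - t)) with s in K by ring.
    apply K; [lra | exact Hd].
Qed.

(** The Lipschitz hypothesis bounds the j-th difference quotient by [A / (1 + INR j) ^ 2] for every
    [s]. The quotients of the partial sums thus converge uniformly in [s], and an e/3 argument
    concludes. *)
Lemma deriv_within_series D (f : nat -> R -> R) (g : nat -> R) t A : D t ->
  (forall s j, D s -> Rabs (f j s) * (1 + INR j) ^ 2 <= A) ->
  (forall j, Rabs (g j) * (1 + INR j) ^ 2 <= A) ->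
  (forall s j, D s -> Rabs (f j s - f j t) * (1 + INR j) ^ 2 <= A * Rabs (s - t)) ->
  (forall j, deriv_within D (f j) t (g j)) ->
  deriv_within D (fun s => Series (fun j => f j s)) t (Series g).
Proof.
  intros Ht Hf Hg HL Hd.
  assert (Hs : forall N, deriv_within D (fun s => sum_f_R0 (fun j => f j s) N) t (sum_f_R0 g N)).
  { induction N as [|N IH]; simpl; [apply Hd | now apply deriv_within_plus]. }
  intros e He.
  destruct (small_tail A (e / 3)) as [N HN]; [lra|].
  destruct (Hs N (e / 3)) as (d & Hd0 & K); [lra|].
  exists d. split; [exact Hd0|]. intros s Hs'. specialize (K s Hs').
  destruct Hs' as [[Ds Hne] _]. simpl in *. unfold Rdist in *.
  assert (Hp : 0 < Rabs (s - t)) by (apply Rabs_pos_lt; lra).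
  pose proof (proj2 (quad_tail g A Hg) N) as T1.
  pose proof (proj1 (quad_tail _ A (fun j => Hf s j Ds))) as X1.
  pose proof (proj1 (quad_tail _ A (fun j => Hf t j Ht))) as X2.
  pose proof (proj2 (quad_tail (fun j => f j s - f j t) (A * Rabs (s - t)) (fun j => HL s j Ds)) N) as T2.
  rewrite Series_minus in T2 by assumption.
  rewrite minus_sum in T2.
  assert (T3 : Rabs ((Series (fun j => f j s) - Series (fun j => f j t)) / (s - t)
     - (sum_f_R0 (fun j => f j s) N - sum_f_R0 (fun j => f j t) N) / (s - t)) <= A / (1 + INR N)).
  { unfold Rdiv. rewrite <- Rmult_minus_distr_r. fold ((Series (fun j => f j s) - Series (fun j => f j t)
       - (sum_f_R0 (fun j => f j s) N - sum_f_R0 (fun j => f j t) N)) / (s - t)).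
    rewrite Rabs_div by lra. apply Rle_div_l; [exact Hp|].
    eapply Rle_trans; [exact T2|]. right. unfold Rdiv. ring. }
  apply Rabs_def2 in K. apply Rabs_le_between in T1. apply Rabs_le_between in T3.
  apply Rabs_def1; lra.
Qed.

(** * Fourier series and products *)

Definition dec (p : nat) (A : R) (z : bool -> nat -> R) : Prop :=
  forall b j, Rabs (z b j) * (1 + INR j) ^ p <= A.

Lemma one_le_w j : 1 <= 1 + INR j.
Proof. pose proof (pos_INR j). lra. Qed.

Lemma w_pow_pos j p : 1 <= (1 + INR j) ^ p.
Proof. apply pow_R1_Rle, one_le_w. Qed.

Lemma dec_nonneg p A z : dec p A z -> 0 <= A.
Proof.
  intros H. eapply Rle_trans; [|apply (H true 0%nat)].
  apply Rmult_le_pos; [apply Rabs_pos|]. pose proof (w_pow_pos 0 p). lra.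
Qed.

Lemma dec_mono p q A z : (q <= p)%nat -> dec p A z -> dec q A z.
Proof.
  intros L H b j. eapply Rle_trans; [|apply (H b j)].
  apply Rmult_le_compat_l; [apply Rabs_pos|]. apply Rle_pow; [apply one_le_w | exact L].
Qed.

Lemma dec_le p A B z : A <= B -> dec p A z -> dec p B z.
Proof. intros L H b j. eapply Rle_trans; [apply H | exact L]. Qed.

Lemma dec_plus p A B y z : dec p A y -> dec p B z -> dec p (A + B) (fun b j => y b j + z b j).
Proof.
  intros Hy Hz b j. pose proof (Hy b j). pose proof (Hz b j).
  pose proof (Rabs_triang (y b j) (z b j)). pose proof (w_pow_pos j p). nra.
Qed.

Lemma dec_scal p A c z : dec p A z -> dec p (Rabs c * A) (fun b j => c * z b j).
Proof.
  intros Hz b j. rewrite Rabs_mult, Rmult_assoc.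
  apply Rmult_le_compat_l; [apply Rabs_pos | apply Hz].
Qed.

Lemma dec_ext p A y z : (forall b j, y b j = z b j) -> dec p A y -> dec p A z.
Proof. intros E H b j. rewrite <- E. apply H. Qed.

(* The coefficients of the derivative of a function with coefficients [z]. *)
Definition dz (l : R) (z : bool -> nat -> R) (b : bool) (j : nat) : R :=
  - sg b * om l j * z (negb b) j.

Lemma abs_sg b : Rabs (- sg b) = 1.
Proof. destruct b; simpl; unfold Rabs; destruct Rcase_abs; lra. Qed.

Lemma dec_dz l p A z : 0 < l -> dec (S p) A z -> dec p (om l 1 * A) (dz l z).
Proof.
  intros Hl H b j. unfold dz. rewrite !Rabs_mult, abs_sg, Rmult_1_l.
  pose proof (H (negb b) j) as h. simpl in h.
  rewrite (Rabs_right (om l j)) by (apply Rle_ge, om_pos, Hl).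
  pose proof (om_le l j Hl). pose proof (om_pos l 1 Hl).
  pose proof (Rabs_pos (z (negb b) j)) as Hz. pose proof (w_pow_pos j p) as Hw.
  apply Rle_trans with (om l 1 * (Rabs (z (negb b) j) * ((1 + INR j) * (1 + INR j) ^ p))).
  - apply Rle_trans with (om l 1 * (1 + INR j) * Rabs (z (negb b) j) * (1 + INR j) ^ p); [|right; ring].
    apply Rmult_le_compat_r; [lra|]. apply Rmult_le_compat_r; assumption.
  - apply Rmult_le_compat_l; assumption.
Qed.

Definition fsT (l : R) (z : bool -> nat -> R) (j : nat) (x : R) : R :=
  nu l j * (z true j * trig l true j x + z false j * trig l false j x).

Definition FS (l : R) (z : bool -> nat -> R) (x : R) : R := Series (fun j => fsT l z j x).

Lemma fsT_le l z j x B : 0 < l -> (forall b, Rabs (z b j) <= B) -> Rabs (fsT l z j x) <= 4 / l * B.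
Proof.
  intros Hl HB. unfold fsT. rewrite Rabs_mult.
  pose proof (nu_pos l j Hl) as [n1 n2]. rewrite (Rabs_right (nu l j)) by lra.
  pose proof (Rinv_0_lt_compat l Hl).
  assert (Rabs (z true j * trig l true j x + z false j * trig l false j x) <= 2 * B).
  { eapply Rle_trans; [apply Rabs_triang|]. rewrite !Rabs_mult.
    pose proof (HB true). pose proof (HB false).
    pose proof (trig_bound l true j x). pose proof (trig_bound l false j x).
    pose proof (Rabs_pos (z true j)). pose proof (Rabs_pos (z false j)).
    pose proof (Rabs_pos (trig l true j x)). pose proof (Rabs_pos (trig l false j x)). nra. }
  pose proof (Rabs_pos (z true j * trig l true j x + z false j * trig l false j x)).
  unfold Rdiv in *. nra.
Qed.

Lemma fsT_dec l z p A j x : 0 < l -> dec p A z -> Rabs (fsT l z j x) * (1 + INR j) ^ p <= 4 / l * A.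
Proof.
  intros Hl H. pose proof (w_pow_pos j p) as Hw.
  apply Rle_div_r; [lra|]. replace (4 / l * A / (1 + INR j) ^ p) with (4 / l * (A / (1 + INR j) ^ p)) by (unfold Rdiv; ring).
  apply fsT_le; [exact Hl|]. intros b. apply Rle_div_r; [lra|]. apply H.
Qed.

Lemma FS_tail l z A x : 0 < l -> dec 2 A z ->
  ex_series (fun j => fsT l z j x) /\
  forall N, Rabs (FS l z x - sum_f_R0 (fun j => fsT l z j x) N) <= 4 / l * A / (1 + INR N).
Proof. intros Hl H. apply quad_tail. intros j. now apply fsT_dec. Qed.

Lemma FS_ext l y z x : (forall b j, y b j = z b j) -> FS l y x = FS l z x.
Proof. intros E. apply Series_ext. intros j. unfold fsT. now rewrite !E. Qed.

Lemma FS_plus l y z A B x : 0 < l -> dec 2 A y -> dec 2 B z ->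
  FS l (fun b j => y b j + z b j) x = FS l y x + FS l z x.
Proof.
  intros Hl Hy Hz. unfold FS. rewrite <- Series_plus.
  - apply Series_ext. intros j. unfold fsT. ring.
  - exact (proj1 (FS_tail l y A x Hl Hy)).
  - exact (proj1 (FS_tail l z B x Hl Hz)).
Qed.

Lemma FS_scal l c z x : FS l (fun b j => c * z b j) x = c * FS l z x.
Proof.
  unfold FS. rewrite <- Series_scal_l. apply Series_ext. intros j. unfold fsT. ring.
Qed.

Lemma FS_per l z : 0 < l -> periodic l (FS l z).
Proof.
  intros Hl x. apply Series_ext. intros j. unfold fsT. now rewrite !trig_per.
Qed.

Lemma cts_fsT l z j : cts (fsT l z j).
Proof. unfold fsT. auto 10 with cts. Qed.

(** Continuity in time with a dummy space variable, so that the lemmas on [cont_on] apply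
    unchanged. *)
Definition cont_t (D : R -> Prop) (f : R -> R) : Prop := cont_on D (fun t _ => f t).

Lemma FS_cont_on l D (z : R -> bool -> nat -> R) A : 0 < l ->
  (forall t, D t -> dec 2 A (z t)) -> (forall b j, cont_t D (fun t => z t b j)) ->
  cont_on D (fun t x => FS l (z t) x).
Proof.
  intros Hl Hz Hc. apply cont_on_series with (4 / l * A).
  - intros t x j Ht. apply fsT_dec; auto.
  - intros j. unfold fsT. apply cont_on_mult; [apply cont_on_const|].
    apply cont_on_plus; (apply cont_on_mult; [apply Hc | apply cont_on_x, cts_trig]).
Qed.

Lemma FS_cts l z A : 0 < l -> dec 2 A z -> cts (FS l z).
Proof.
  intros Hl Hz. apply (cont_on_cts (fun _ => True) (fun _ => FS l z) 0); [|exact I].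
  apply (FS_cont_on l (fun _ => True) (fun _ => z) A); auto. intros b j. exact (cont_on_const _ (z b j)).
Qed.

Lemma FS_deriv_t l D (z z' : R -> bool -> nat -> R) A t x : 0 < l -> D t ->
  (forall s, D s -> dec 2 A (z s)) -> dec 2 A (z' t) ->
  (forall s, D s -> dec 2 (A * Rabs (s - t)) (fun b j => z s b j - z t b j)) ->
  (forall b j, deriv_within D (fun s => z s b j) t (z' t b j)) ->
  deriv_within D (fun s => FS l (z s) x) t (FS l (z' t) x).
Proof.
  intros Hl Ht Hz Hz' HL Hd.
  apply (deriv_within_series D (fun j s => fsT l (z s) j x) (fun j => fsT l (z' t) j x) t (4 / l * A)).
  - exact Ht.
  - intros s j Ds. apply fsT_dec; auto.
  - intros j. apply fsT_dec; auto.
  - intros s j Ds.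
    replace (fsT l (z s) j x - fsT l (z t) j x) with (fsT l (fun b j => z s b j - z t b j) j x)
      by (unfold fsT; ring).
    rewrite Rmult_assoc. apply fsT_dec; auto.
  - intros j. unfold fsT.
    apply deriv_within_ext with (fun s => (nu l j * trig l true j x) * z s true j
                                        + (nu l j * trig l false j x) * z s false j);
      [exact Ht | intros; ring |].
    replace (nu l j * (z' t true j * trig l true j x + z' t false j * trig l false j x))
      with ((nu l j * trig l true j x) * z' t true j + (nu l j * trig l false j x) * z' t false j) by ring.
    apply deriv_within_plus; apply deriv_within_scal; apply Hd.
Qed.

Lemma lipschitz_of_derive f f' M x y : (forall u, is_derive f u (f' u)) ->
  (forall u, Rabs (f' u) <= M) -> Rabs (f y - f x) <= M * Rabs (y - x).
Proof.
  intros Hd HM. destruct (MVT_gen f x y f') as (c & _ & E).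
  - intros; apply Hd.
  - intros u _. apply continuity_pt_filterlim. apply (ex_derive_continuous f u). eexists; apply Hd.
  - rewrite E, Rabs_mult. apply Rmult_le_compat_r; [apply Rabs_pos | apply HM].
Qed.

(** A derivative on the line is [deriv_within] the full set, so the termwise theorem made for time
    also serves for space. One exponent pays for the derivative and two remain for convergence. *)
Lemma FS_derive l z A x : 0 < l -> dec 3 A z -> is_derive (FS l z) x (FS l (dz l z) x).
Proof.
  intros Hl H. apply deriv_within_derive.
  pose proof (dec_dz l 2 A z Hl H) as Hdz. pose proof (dec_mono 3 2 A z ltac:(lia) H) as H2.
  set (B := 4 / l * A + 4 / l * (om l 1 * A)).
  pose proof (dec_nonneg _ _ _ H). pose proof (dec_nonneg _ _ _ Hdz).
  assert (0 < 4 / l) by (apply Rdiv_lt_0_compat; lra).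
  assert (Hd : forall j u, is_derive (fsT l z j) u (fsT l (dz l z) j u)).
  { intros j u. unfold fsT. evar_last.
    - apply (is_derive_scal (fun x => z true j * trig l true j x + z false j * trig l false j x)).
      apply (is_derive_plus (fun x => z true j * trig l true j x) (fun x => z false j * trig l false j x));
        apply is_derive_scal; apply trig_derive.
    - unfold dz, plus, sg; simpl. ring. }
  assert (4 / l * A <= B) by (unfold B; nra). assert (4 / l * (om l 1 * A) <= B) by (unfold B; nra).
  apply (deriv_within_series (fun _ => True) (fsT l z) (fun j => fsT l (dz l z) j x) x B); auto.
  - intros s j _. eapply Rle_trans; [apply fsT_dec; eassumption | lra].
  - intros j. eapply Rle_trans; [apply fsT_dec; eassumption | lra].
  - intros s j _. pose proof (w_pow_pos j 2).
    apply Rle_trans with (4 / l * (om l 1 * A) / (1 + INR j) ^ 2 * Rabs (s - x) * (1 + INR j) ^ 2).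
    + apply Rmult_le_compat_r; [lra|]. apply (lipschitz_of_derive _ (fsT l (dz l z) j)); [apply Hd|].
      intros u. apply Rle_div_r; [lra|]. now apply fsT_dec.
    + replace (4 / l * (om l 1 * A) / (1 + INR j) ^ 2 * Rabs (s - x) * (1 + INR j) ^ 2)
        with (4 / l * (om l 1 * A) * Rabs (s - x)) by (pose proof (one_le_w j); field; lra).
      apply Rmult_le_compat_r; [apply Rabs_pos | assumption].
  - intros j. apply deriv_within_derive. apply Hd.
Qed.

(** Closes the limiting arguments: an error of size 1/N for all large N forces equality. *)
Lemma eq_of_tail x y B n : (forall N, (n <= N)%nat -> Rabs (x - y) <= B / (1 + INR N)) -> x = y.
Proof.
  intros H. destruct (Req_dec x y) as [E|E]; [exact E|].
  assert (Hp : 0 < Rabs (x - y)) by (apply Rabs_pos_lt; lra).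
  destruct (small_tail (Rabs B) (Rabs (x - y)) Hp) as [N HN].
  specialize (H (n + N)%nat ltac:(lia)).
  assert (B / (1 + INR (n + N)) <= Rabs B / (1 + INR N)); [|lra].
  rewrite plus_INR. pose proof (pos_INR n). pose proof (pos_INR N).
  apply Rle_trans with (Rabs B / (1 + (INR n + INR N))).
  - apply Rmult_le_compat_r; [|apply Rle_abs]. left. apply Rinv_0_lt_compat. lra.
  - apply Rmult_le_compat_l; [apply Rabs_pos|]. apply Rinv_le_contravar; lra.
Qed.

Lemma le_of_tail x y B : (forall N, x <= y + B / (1 + INR N)) -> x <= y.
Proof.
  intros H. apply Rnot_lt_le. intros L.
  destruct (small_tail B (x - y)) as [N HN]; [lra|]. specialize (H N). lra.
Qed.

Lemma cts_bounded f a b : a <= b -> cts f -> exists M, forall x, a <= x <= b -> Rabs (f x) <= M.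
Proof.
  intros Hab Hf. destruct (continuity_ab_maj (fun x => Rabs (f x)) a b Hab) as (c & Hc & _).
  - intros x _. apply continuity_pt_filterlim. apply (continuous_comp f Rabs); [apply Hf|].
    apply (continuous_Rabs (f x)).
  - exists (Rabs (f c)). exact Hc.
Qed.

Lemma mom_fsT l z i b j : 0 < l -> z false O = 0 ->
  mom l (fsT l z i) b j = if Nat.eqb i j then z b j else 0.
Proof.
  intros Hl H0. unfold fsT.
  rewrite (mom_ext l _ (fun x => (nu l i * z true i) * trig l true i x + (nu l i * z false i) * trig l false i x))
    by (intros; ring).
  rewrite mom_plus, !mom_scal by auto with cts.
  destruct (Nat.eqb_spec i j) as [<-|N].
  - destruct b.
    + rewrite (mom_trig_ne l false true) by (auto; left; discriminate).
      pose proof (mom_trig_eq l true i Hl ltac:(discriminate)) as E.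
      replace (_ + _) with (z true i * (nu l i * mom l (trig l true i) true i)).
      * rewrite E; ring. 
      * change (fun x => trig l true i x) with (trig l true i). ring.
    + rewrite (mom_trig_ne l true false) by (auto; left; discriminate).
      destruct i as [|i].
      * rewrite H0. ring.
      * pose proof (mom_trig_eq l false (S i) Hl ltac:(lia)) as E.
        replace (_ + _) with (z false (S i) * (nu l (S i) * mom l (trig l false (S i)) false (S i))).
        -- rewrite E; ring.
        -- change (fun x => trig l false (S i) x) with (trig l false (S i)). ring.
  - rewrite !mom_trig_ne by (auto; right; lia). ring.
Qed.

Definition FSN (l : R) (z : bool -> nat -> R) (N : nat) (x : R) : R := sum_f_R0 (fun j => fsT l z j x) N.

Lemma cts_FSN l z N : cts (FSN l z N).
Proof.
  unfold FSN. induction N as [|N IH]; simpl; [apply cts_fsT|].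
  apply cts_plus; [exact IH | apply cts_fsT].
Qed.
#[global] Hint Resolve cts_FSN cts_fsT : cts.

(** By orthogonality the moments of the partial sums are eventually [z b j], and the uniform tail
    bound passes to the limit. The slot [(false, 0)] must hold 0 because the moment against the zero
    function is 0. *)
Lemma FS_mom l z A b j : 0 < l -> z false O = 0 -> dec 2 A z -> mom l (FS l z) b j = z b j.
Proof.
  intros Hl H0 HA.
  assert (HN : forall N, mom l (FSN l z N) b j = if Nat.leb j N then z b j else 0).
  { induction N as [|N IH].
    - change (FSN l z 0) with (fsT l z 0). rewrite mom_fsT by assumption.
      destruct j; reflexivity.
    - rewrite (mom_ext l _ (fun x => FSN l z N x + fsT l z (S N) x)) by reflexivity.
      rewrite mom_plus by auto with cts. rewrite IH, mom_fsT by assumption.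
      destruct (Nat.leb_spec j N), (Nat.leb_spec j (S N)), (Nat.eqb_spec (S N) j); try lia; ring. }
  pose proof (FS_cts l z A Hl HA) as Hc.
  apply (eq_of_tail _ _ (l * (4 / l * A)) j). intros N HjN.
  replace (z b j) with (mom l (FSN l z N) b j)
    by (rewrite HN; destruct (Nat.leb_spec j N); [reflexivity | lia]).
  rewrite <- mom_minus by auto with cts.
  unfold Rdiv at 1. rewrite Rmult_assoc. apply mom_bound; [exact Hl | auto with cts |].
  intros x _. apply (proj2 (FS_tail l z A x Hl HA)).
Qed.

(** * Discrete convolution and products of Fourier series *)

Definition qw (m : nat) : R := / (1 + INR m) ^ 2.

Lemma qw_pos m : 0 < qw m <= 1.
Proof.
  unfold qw. pose proof (w_pow_pos m 2). split; [apply Rinv_0_lt_compat; lra|].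
  rewrite <- Rinv_1. apply Rinv_le_contravar; lra.
Qed.

Lemma sum_qw N : sum_f_R0 qw N <= 2.
Proof.
  (* The telescoped bound is sharper and carries the induction. *)
  enough (H : sum_f_R0 qw N <= 2 - / (1 + INR N)).
  { pose proof (one_le_w N). assert (0 < / (1 + INR N)) by (apply Rinv_0_lt_compat; lra). lra. }
  induction N as [|N IH].
  - unfold qw; simpl. lra.
  - rewrite tech5. unfold qw at 2. rewrite S_INR. pose proof (one_le_w N).
    set (x := 1 + INR N) in *. replace (1 + (INR N + 1)) with (x + 1) by (unfold x; ring).
    assert (/ (x + 1) ^ 2 <= / x - / (x + 1)); [|lra].
    replace (/ x - / (x + 1)) with (/ (x * (x + 1))) by (field; lra).
    apply Rinv_le_contravar; nra.
Qed.

(** Two one-sided sums, each at most 2. Moving the centre from [j] to [S j] shifts the sum and adds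
    the single term [qw (S j)]. *)
Lemma sum_qw_dist j N : sum_f_R0 (fun i => qw (dist i j)) N <= 4.
Proof.
  enough (H : forall N, sum_f_R0 (fun i => qw (dist i j)) N <= 2 + sum_f_R0 qw j).
  { specialize (H N). pose proof (sum_qw j). lra. }
  clear N. induction j as [|j IH]; intros N.
  - rewrite (sum_eq _ qw) by (intros i _; f_equal; unfold dist; lia).
    pose proof (sum_qw N). simpl sum_f_R0 at 2. pose proof (qw_pos 0). lra.
  - rewrite tech5. assert (E : qw (dist 0 (S j)) = qw (S j)) by (f_equal; unfold dist; lia).
    destruct N as [|N].
    + simpl sum_f_R0 at 1. rewrite E. pose proof (cond_pos_sum qw j (fun n => Rlt_le _ _ (proj1 (qw_pos n)))). lra.
    + rewrite decomp_sum by lia. simpl Init.Nat.pred. rewrite E.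
      rewrite (sum_eq _ (fun i => qw (dist i j))) by (intros i _; f_equal; unfold dist; lia).
      specialize (IH N). lra.
Qed.

(** The algebra property at the level of weights. As 1 + j is at most the sum of 1 + i and 1 + |i -
    j|, the quotient of weights is at most 1/(1 + i) + 1/(1 + |i - j|). Its p-th power is at most
    2^p times the p-th power of the larger term, which is at most its square because that term is at
    most 1 and [p] is at least 2. *)
Lemma conv_weight p i j : (2 <= p)%nat ->
  (1 + INR j) ^ p * / (1 + INR i) ^ p * / (1 + INR (dist i j)) ^ p <= 2 ^ p * (qw i + qw (dist i j)).
Proof.
  intros Hp. pose proof (one_le_w i) as Hi. pose proof (one_le_w (dist i j)) as Hd.
  assert (Hj : 1 + INR j <= (1 + INR i) + (1 + INR (dist i j))).
  { assert (INR j <= INR (i + dist i j)) by (apply le_INR; unfold dist; lia).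
    rewrite plus_INR in H. lra. }
  pose proof (one_le_w j) as Hj1. unfold qw.
  set (a := 1 + INR i) in *. set (d := 1 + INR (dist i j)) in *. set (w := 1 + INR j) in *.
  rewrite <- !pow_inv, <- !Rpow_mult_distr.
  assert (P : forall x y, 0 <= x <= y -> y <= 1 -> (x + y) ^ p <= 2 ^ p * y ^ 2).
  { intros x y Hx Hy. apply Rle_trans with ((2 * y) ^ p).
    - apply pow_incr. lra.
    - rewrite Rpow_mult_distr. apply Rmult_le_compat_l; [apply pow_le; lra|].
      replace p with (2 + (p - 2))%nat by lia. rewrite pow_add.
      rewrite <- (Rmult_1_r (y ^ 2)) at 2. apply Rmult_le_compat_l; [apply pow_le; lra|].
      rewrite <- (pow1 (p - 2)). apply pow_incr. lra. }
  assert (Ia : 0 < / a <= 1) by (split; [apply Rinv_0_lt_compat; lra | rewrite <- Rinv_1; apply Rinv_le_contravar; lra]).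
  assert (Id : 0 < / d <= 1) by (split; [apply Rinv_0_lt_compat; lra | rewrite <- Rinv_1; apply Rinv_le_contravar; lra]).
  apply Rle_trans with ((/ a + / d) ^ p).
  - apply pow_incr. split.
    + apply Rmult_le_pos; [apply Rmult_le_pos|]; lra.
    + replace (/ a + / d) with ((a + d) * / a * / d) by (field; lra).
      apply Rmult_le_compat_r; [lra|]. apply Rmult_le_compat_r; lra.
  - assert (0 < 2 ^ p) by (apply pow_lt; lra).
    assert (0 <= (/ a) ^ 2) by (apply pow_le; lra). assert (0 <= (/ d) ^ 2) by (apply pow_le; lra).
    destruct (Rle_dec (/ a) (/ d)).
    + eapply Rle_trans; [apply P; lra|]. nra.
    + rewrite Rplus_comm. eapply Rle_trans; [apply P; lra|]. nra.
Qed.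

(** 24 is 4 times 6: the factor 4/l comes from the sine and the cosine with [nu] at most 2/l, and 6
    bounds the sum of the weights, 2 from [sum_qw] and 4 from [sum_qw_dist]. *)
Definition Cmul (l : R) (p : nat) : R := 24 / l * 2 ^ p.

Lemma Cmul_pos l p : 0 < l -> 0 < Cmul l p.
Proof.
  intros. unfold Cmul. apply Rmult_lt_0_compat; [apply Rdiv_lt_0_compat; lra | apply pow_lt; lra].
Qed.

(** Both frequencies of the product formula, [i + j] and [dist i j], are at least [dist i j]; the
    two halves add up to one weight. *)
Lemma mom_trig_mul l v p B b i b' j : cts v -> dec p B (mom l v) ->
  Rabs (mom l (fun x => trig l b i x * v x) b' j) <= B * / (1 + INR (dist i j)) ^ p.
Proof.
  intros Hv HB. destruct (trig_prod l b b' i j) as (c1 & c2 & H1 & H2 & E).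
  set (s := eqb b b') in *.
  assert (Em : mom l (fun x => trig l b i x * v x) b' j
             = c1 * mom l v s (i + j) + c2 * mom l v s (dist i j)).
  { unfold mom. rewrite <- !RI_scal, <- RI_plus by auto with cts. apply RI_ext. intros x.
    transitivity (v x * (trig l b i x * trig l b' j x)); [ring|]. rewrite E. ring. }
  rewrite Em. eapply Rle_trans; [apply Rabs_triang|]. rewrite !Rabs_mult, H1, H2.
  assert (L : forall m, (dist i j <= m)%nat -> Rabs (mom l v s m) <= B * / (1 + INR (dist i j)) ^ p).
  { intros m Hm. pose proof (w_pow_pos (dist i j) p). apply Rle_div_r; [lra|].
    eapply Rle_trans; [|apply (HB s m)]. apply Rmult_le_compat_l; [apply Rabs_pos|].
    apply pow_incr. pose proof (one_le_w (dist i j)). apply le_INR in Hm. lra. }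
  pose proof (L (i + j)%nat ltac:(unfold dist; lia)). pose proof (L (dist i j) ltac:(lia)). lra.
Qed.

(** Only one factor is expanded in a series; of [v] continuity and the decay of its moments are
    used. The bound is proved for partial sums, uniformly in N, and survives the limit because the
    remainder is uniformly small and [v] is bounded on a period. *)
Lemma mom_FS_mul l z v p A B : 0 < l -> (2 <= p)%nat -> cts v ->
  dec p A z -> dec p B (mom l v) ->
  dec p (Cmul l p * A * B) (mom l (fun x => FS l z x * v x)).
Proof.
  intros Hl Hp Hv HA HB b j.
  pose proof (dec_mono p 2 A z Hp HA) as H2. pose proof (FS_cts l z A Hl H2) as Hc.
  pose proof (dec_nonneg _ _ _ HA) as A0. pose proof (dec_nonneg _ _ _ HB) as B0.
  set (w := (1 + INR j) ^ p). pose proof (w_pow_pos j p) as Hw. fold w in Hw.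
  assert (HT : forall i, Rabs (mom l (fun x => fsT l z i x * v x) b j) * w
              <= 4 / l * A * B * 2 ^ p * (qw i + qw (dist i j))).
  { intros i. unfold fsT.
    rewrite (mom_ext l _ (fun x => (nu l i * z true i) * (trig l true i x * v x)
        + (nu l i * z false i) * (trig l false i x * v x))) by (intros; ring).
    rewrite mom_plus, !mom_scal by auto with cts.
    pose proof (mom_trig_mul l v p B true i b j Hv HB) as M1.
    pose proof (mom_trig_mul l v p B false i b j Hv HB) as M2.
    set (m1 := mom l _ b j) in *. set (m2 := mom l (fun x => trig l false i x * v x) b j) in *.
    pose proof (w_pow_pos i p) as Hi.
    assert (Z : forall b, Rabs (z b i) <= A * / (1 + INR i) ^ p).
    { intros b0. apply Rle_div_r; [lra | apply HA]. }
    pose proof (nu_pos l i Hl) as [n1 n2].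
    set (K := B * / (1 + INR (dist i j)) ^ p) in *. set (L := A * / (1 + INR i) ^ p) in *.
    assert (K0 : 0 <= K) by (eapply Rle_trans; [apply Rabs_pos | exact M1]).
    assert (L0 : 0 <= L) by (eapply Rle_trans; [apply Rabs_pos | apply (Z true)]).
    assert (S : Rabs (nu l i * z true i * m1 + nu l i * z false i * m2) <= 4 / l * (L * K)).
    { eapply Rle_trans; [apply Rabs_triang|]. rewrite !Rabs_mult, (Rabs_right (nu l i)) by lra.
      assert (Q : forall u m, Rabs u <= L -> Rabs m <= K -> nu l i * Rabs u * Rabs m <= 2 / l * (L * K)).
      { intros u m Hu Hm. rewrite Rmult_assoc. pose proof (Rabs_pos u). pose proof (Rabs_pos m).
        apply Rmult_le_compat; [lra | nra | lra |]. apply Rmult_le_compat; assumption. }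
      pose proof (Q _ _ (Z true) M1). pose proof (Q _ _ (Z false) M2).
      replace (4 / l) with (2 / l + 2 / l) by (field; lra). lra. }
    apply Rle_trans with (4 / l * (L * K) * w); [apply Rmult_le_compat_r; lra|].
    replace (4 / l * (L * K) * w)
      with (4 / l * A * B * (w * / (1 + INR i) ^ p * / (1 + INR (dist i j)) ^ p))
      by (unfold L, K; ring).
    rewrite (Rmult_assoc _ (2 ^ p)). apply Rmult_le_compat_l; [|apply conv_weight, Hp].
    apply Rmult_le_pos; [apply Rmult_le_pos|]; try assumption.
    left; apply Rdiv_lt_0_compat; lra. }
  assert (HS : forall N, Rabs (mom l (fun x => FSN l z N x * v x) b j) * w
     <= 4 / l * A * B * 2 ^ p * (sum_f_R0 qw N + sum_f_R0 (fun i => qw (dist i j)) N)).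
  { induction N as [|N IH]; [apply HT|].
    rewrite (mom_ext l _ (fun x => FSN l z N x * v x + fsT l z (S N) x * v x))
      by (intros x; unfold FSN; rewrite tech5; ring).
    rewrite mom_plus by auto with cts. rewrite !tech5.
    pose proof (Rabs_triang (mom l (fun x => FSN l z N x * v x) b j)
      (mom l (fun x => fsT l z (S N) x * v x) b j)). specialize (HT (S N)). nra. }
  assert (HS' : forall N, Rabs (mom l (fun x => FSN l z N x * v x) b j) * w <= Cmul l p * A * B).
  { intros N. eapply Rle_trans; [apply HS|]. unfold Cmul.
    replace (24 / l * 2 ^ p * A * B) with (4 / l * A * B * 2 ^ p * 6) by (field; lra).
    apply Rmult_le_compat_l.
    - apply Rmult_le_pos; [|apply pow_le; lra]. apply Rmult_le_pos; [apply Rmult_le_pos|]; try assumption.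
      left; apply Rdiv_lt_0_compat; lra.
    - pose proof (sum_qw N). pose proof (sum_qw_dist j N). lra. }
  destruct (cts_bounded v (- (l / 2)) (l / 2) ltac:(lra) Hv) as [M HM].
  apply (le_of_tail _ _ (l * (4 / l * A * M) * w)). intros N.
  specialize (HS' N). pose proof (one_le_w N) as HN.
  assert (D : Rabs (mom l (fun x => FS l z x * v x) b j - mom l (fun x => FSN l z N x * v x) b j)
     <= l * (4 / l * A / (1 + INR N) * M)).
  { rewrite <- mom_minus by auto with cts.
    rewrite (mom_ext l _ (fun x => (FS l z x - FSN l z N x) * v x)) by (intros; ring).
    apply mom_bound; [exact Hl | auto with cts |]. intros x Hx. rewrite Rabs_mult.
    apply Rmult_le_compat; try apply Rabs_pos; [|now apply HM].
    apply (proj2 (FS_tail l z A x Hl H2)). }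
  replace (l * (4 / l * A * M) * w / (1 + INR N)) with (l * (4 / l * A / (1 + INR N) * M) * w)
    by (field; lra).
  set (m := mom l (fun x => FSN l z N x * v x) b j) in *.
  set (m' := mom l (fun x => FS l z x * v x) b j) in *.
  pose proof (Rabs_triang_inv m' m). nra.
Qed.

(** * Uniqueness of Fourier coefficients *)

Lemma RI_Chasles f a b c : cts f -> RI f a b + RI f b c = RI f a c.
Proof. intros Hf. exact (RInt_Chasles f a b c (cts_ex_RInt f a b Hf) (cts_ex_RInt f b c Hf)). Qed.

Lemma RI_ge_const f a b M : a <= b -> cts f -> (forall x, a <= x <= b -> M <= f x) ->
  (b - a) * M <= RI f a b.
Proof.
  intros Hab Hf H. rewrite <- RI_const. apply RInt_le; try assumption.
  - apply cts_ex_RInt, cts_const.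
  - now apply cts_ex_RInt.
  - intros x Hx. apply H. lra.
Qed.

(** The integral over a window of length [l], as a function of the position of the window, has zero
    derivative. *)
Lemma RI_periodic l f a : cts f -> periodic l f -> RI f a (a + l) = RI f 0 l.
Proof.
  intros Hf Hp. set (P := fun y => RI f 0 y).
  assert (HP : forall y, is_derive P y (f y)).
  { intros y. apply (is_derive_RInt f P 0 y); [|apply Hf].
    apply filter_forall. intros z. apply (RInt_correct (V := R_CompleteNormedModule)).
    now apply cts_ex_RInt. }
  assert (HG : forall y, is_derive (fun y => P (y + l) - P y) y (f (y + l) - f y)).
  { intros y. evar_last.
    - apply (is_derive_minus (fun y => P (y + l)) P); [|apply HP].
      apply (is_derive_comp P (fun y => y + l)); [apply HP|].
      apply (is_derive_plus (fun y => y) (fun _ => l)); [apply is_derive_id | apply is_derive_const].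
    - unfold minus, plus, opp, scal, zero, one; simpl. unfold mult; simpl. ring. }
  assert (E : P (a + l) - P a = P (0 + l) - P 0).
  { pose proof (lipschitz_of_derive _ _ 0 0 a HG) as L. cbv beta in L.
    rewrite Rmult_0_l in L.
    assert (L0 : forall u, Rabs (f (u + l) - f u) <= 0) by (intros u; rewrite Hp, Rminus_diag, Rabs_R0; apply Rle_refl).
    specialize (L L0). pose proof (Rabs_pos (P (a + l) - P a - (P (0 + l) - P 0))).
    apply Rminus_diag_uniq. apply Rabs_eq_0. lra. }
  unfold P in E. rewrite <- (RI_Chasles f 0 a (a + l)) in E by exact Hf.
  rewrite Rplus_0_l in E. pose proof (RI_Chasles f 0 0 0 Hf). unfold P. lra.
Qed.

(* If [f x0 > 0], test [f] against the powers of [1 - cos (w d) + cos (w (x - x0))]: they blow up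
   near [x0] and stay bounded by 1 at distance at least [d]. *)
Lemma fourier_nonpos l f x0 : 0 < l -> cts f -> periodic l f ->
  (forall b j, mom l f b j = 0) -> f x0 <= 0.
Proof.
  intros Hl Hc Hp H0. apply Rnot_lt_le. intros Hx0.
  set (w := om l 1). assert (Hw : w * (l / 2) = PI) by (unfold w, om; simpl; field; lra).
  pose proof PI_RGT_0 as HPI. assert (Hw0 : 0 < w) by apply om_S, Hl.
  set (Tk := fun K x => K + cos (w * x0) * trig l true 1 x + sin (w * x0) * trig l false 1 x).
  assert (cT : forall K, cts (Tk K)) by (intros K; unfold Tk; auto with cts).
  (* By the product formula, multiplication by [Tk K] only mixes moments, so vanishing moments
     remain zero. *)
  assert (HT : forall K n b j, mom l (fun x => f x * Tk K x ^ n) b j = 0).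
  { intros K n. induction n as [|n IH]; intros b j.
    - rewrite (mom_ext l _ f) by (intros; simpl; ring). apply H0.
    - set (g := fun x => f x * Tk K x ^ n) in *.
      assert (cg : cts g) by (unfold g; auto with cts).
      rewrite (mom_ext l _ (fun x => K * g x + (cos (w * x0) * (trig l true 1 x * g x)
         + sin (w * x0) * (trig l false 1 x * g x)))) by (intros x; unfold g, Tk; simpl; ring).
      rewrite !mom_plus, !mom_scal, IH by auto 10 with cts.
      assert (Z : forall b', mom l (fun x => trig l b' 1 x * g x) b j = 0).
      { intros b'. destruct (trig_prod l b' b 1 j) as (c1 & c2 & _ & _ & E).
        transitivity (c1 * mom l g (eqb b' b) (1 + j) + c2 * mom l g (eqb b' b) (dist 1 j)).
        - unfold mom. rewrite <- !RI_scal, <- RI_plus by auto with cts. apply RI_ext. intros x.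
          transitivity (g x * (trig l b' 1 x * trig l b j x)); [ring|]. rewrite E. ring.
        - rewrite !IH. ring. }
      rewrite !Z. ring. }
  destruct (proj1 (filterlim_locally _ _) (Hc x0) (mkposreal (f x0 / 2) ltac:(lra))) as [d0 Hd0].
  set (d := Rmin (d0 / 2) (l / 4)).
  assert (Hd : 0 < d /\ d < d0 /\ d <= l / 4).
  { pose proof (cond_pos d0). unfold d. split; [apply Rmin_glb_lt; lra|].
    split; [eapply Rle_lt_trans; [apply Rmin_l | lra] | apply Rmin_r]. }
  assert (Hm : forall x, Rabs (x - x0) <= d -> f x0 / 2 <= f x).
  { intros x Hx. assert (B : ball x0 d0 x) by (eapply Rle_lt_trans; [exact Hx | lra]).
    apply Hd0 in B. change (Rabs (f x - f x0) < f x0 / 2) in B. apply Rabs_def2 in B. lra. }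
  set (T := Tk (1 - cos (w * d))).
  assert (ET : forall x, T x = 1 - cos (w * d) + cos (w * Rabs (x - x0))).
  { intros x. assert (E : cos (w * Rabs (x - x0)) = cos (w * x - w * x0)).
    { unfold Rabs. destruct Rcase_abs; [rewrite <- cos_neg|]; f_equal; ring. }
    rewrite E, cos_minus. unfold T, Tk, trig. fold w. ring. }
  set (q := cos (w * (d / 2)) - cos (w * d)).
  assert (Hq : 0 < q).
  { assert (cos (w * d) < cos (w * (d / 2))); [|unfold q; lra]. apply cos_decreasing_1; nra. }
  destruct (cts_bounded f (x0 - l / 2) (x0 + l / 2) ltac:(lra) Hc) as [M HM].
  assert (M0 : 0 <= M) by (eapply Rle_trans; [apply Rabs_pos | apply (HM x0); lra]).
  assert (Tn : forall x, Rabs (x - x0) <= d -> 1 <= T x).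
  { intros x Hx. rewrite ET. pose proof (Rabs_pos (x - x0)).
    assert (cos (w * d) <= cos (w * Rabs (x - x0))); [|lra]. apply cos_decr_1; nra. }
  assert (Tq : forall x, Rabs (x - x0) <= d / 2 -> 1 + q <= T x).
  { intros x Hx. rewrite ET. pose proof (Rabs_pos (x - x0)).
    assert (cos (w * (d / 2)) <= cos (w * Rabs (x - x0))); [|unfold q; lra]. apply cos_decr_1; nra. }
  assert (Tf : forall x, d <= Rabs (x - x0) <= l / 2 -> Rabs (T x) <= 1).
  { intros x Hx. rewrite ET. pose proof (COS_bound (w * d)). pose proof (COS_bound (w * Rabs (x - x0))).
    assert (cos (w * Rabs (x - x0)) <= cos (w * d)) by (apply cos_decr_1; nra).
    assert (0 <= cos (w * d) -> cos (w * d) <= 1) by lra.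
    apply Rabs_le. lra. }
  set (g := fun n x => f x * T x ^ n).
  assert (cg : forall n, cts (g n)) by (intros n; unfold g; apply cts_mult; [exact Hc | apply cts_pow, cT]).
  assert (G1 : forall n x, x0 - l / 2 <= x <= x0 + l / 2 -> - M <= g n x).
  { intros n x Hx. unfold g. pose proof (HM x Hx) as HMx. apply Rabs_le_between in HMx.
    destruct (Rle_dec (Rabs (x - x0)) d) as [h|h].
    - pose proof (Hm x h). pose proof (pow_R1_Rle _ n (Tn x h)). nra.
    - assert (Hx' : Rabs (x - x0) <= l / 2) by (apply Rabs_le; lra).
      assert (h' : d <= Rabs (x - x0) <= l / 2) by lra. pose proof (Tf x h') as t.
      assert (P : Rabs (T x ^ n) <= 1).
      { rewrite <- RPow_abs. rewrite <- (pow1 n). apply pow_incr. split; [apply Rabs_pos | exact t]. }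
      assert (Q : Rabs (f x * T x ^ n) <= M * 1).
      { rewrite Rabs_mult. apply Rmult_le_compat; try apply Rabs_pos; [now apply HM | exact P]. }
      apply Rabs_le_between in Q. lra. }
  assert (G2 : forall n x, x0 - d / 2 <= x <= x0 + d / 2 -> f x0 / 2 * (1 + q) ^ n <= g n x).
  { intros n x Hx. unfold g. assert (h : Rabs (x - x0) <= d / 2) by (apply Rabs_le; lra).
    apply Rmult_le_compat; [lra | apply pow_le; lra | apply Hm; lra |].
    apply pow_incr. pose proof (Tq x h). lra. }
  assert (I0 : forall n, RI (g n) (x0 - l / 2) (x0 + l / 2) = 0).
  { intros n. replace (x0 + l / 2) with (x0 - l / 2 + l) by field.
    assert (pg : periodic l (g n)).
    { intros x. unfold g, T, Tk. now rewrite Hp, !trig_per. }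
    rewrite (RI_periodic l) by auto.
    transitivity (mom l (fun x => f x * Tk (1 - cos (w * d)) x ^ n) true 0); [|apply HT]. unfold mom.
    replace (l / 2) with (- (l / 2) + l) at 2 by field.
    rewrite <- (RI_periodic l (g n) (- (l / 2))) by auto.
    apply RI_ext. intros x. unfold trig. rewrite om_0, Rmult_0_l, cos_0. unfold g, T. ring. }
  (* By Bernoulli's inequality this exponent makes the contribution of the bump of width [d] larger
     than [M * l], whereas the rest of the period takes away at most [M * l]. *)
  destruct (nfloor_ex (M * l / (d * (f x0 / 2) * q))) as [n [_ Hn]].
  { apply Rdiv_le_0_compat; [nra|]. repeat apply Rmult_lt_0_compat; lra. }
  set (N := S n). specialize (I0 N).
  rewrite <- (RI_Chasles _ _ (x0 - d / 2)), <- (RI_Chasles _ (x0 - d / 2) (x0 + d / 2)) in I0 by apply cg.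
  pose proof (RI_ge_const (g N) (x0 - l / 2) (x0 - d / 2) (- M) ltac:(lra) (cg N)
    ltac:(intros; apply G1; lra)) as A1.
  pose proof (RI_ge_const (g N) (x0 + d / 2) (x0 + l / 2) (- M) ltac:(lra) (cg N)
    ltac:(intros; apply G1; lra)) as A2.
  pose proof (RI_ge_const (g N) (x0 - d / 2) (x0 + d / 2) _ ltac:(lra) (cg N) (G2 N)) as A3.
  pose proof (poly N q Hq) as A4. unfold N in A4 at 1. rewrite S_INR in A4.
  apply Rlt_div_l in Hn; [|repeat apply Rmult_lt_0_compat; lra].
  assert (A5 : d * (f x0 / 2) * (1 + (INR n + 1) * q) <= d * (f x0 / 2) * (1 + q) ^ N)
    by (apply Rmult_le_compat_l; [nra | exact A4]).
  assert (0 < d * (f x0 / 2)) by nra. nra.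
Qed.

Lemma fourier_unique l f : 0 < l -> cts f -> periodic l f ->
  (forall b j, mom l f b j = 0) -> forall x, f x = 0.
Proof.
  intros Hl Hc Hp H0 x. apply Rle_antisym; [now apply fourier_nonpos with l|].
  assert (-1 * f x <= 0); [|lra].
  apply (fourier_nonpos l (fun x => -1 * f x)); auto with cts.
  - intros y. now rewrite Hp.
  - intros b j. rewrite mom_scal, H0 by assumption. ring.
Qed.

Lemma fourier_series l v A : 0 < l -> cts v -> periodic l v -> dec 2 A (mom l v) ->
  forall x, v x = FS l (mom l v) x.
Proof.
  intros Hl Hc Hp HA x. pose proof (FS_cts l _ A Hl HA) as Hs.
  apply Rminus_diag_uniq. revert x.
  apply (fourier_unique l (fun x => v x - FS l (mom l v) x)); auto with cts.
  - intros x. now rewrite Hp, (FS_per l (mom l v) Hl x).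
  - intros b j. rewrite mom_minus by assumption.
    rewrite (FS_mom l _ A) by (auto; apply mom_false_0). ring.
Qed.

(** * Moments of time-dependent functions and scalar linear equations *)

(** Compactness for a gauge. The double negation is inherited from [compactness_value_1d]; it is
    harmless because the uses aim at inequalities between reals, which are decidable. Outside the
    interval the gauge is set to 1. *)
Lemma uniform_radius (a b : R) (P : R -> R -> Prop) :
  (forall x, a <= x <= b -> exists d, 0 < d /\ P x d) ->
  exists d, 0 < d /\ forall y, a <= y <= b ->
    ~ ~ exists x e, a <= x <= b /\ P x e /\ Rabs (y - x) < e /\ d <= e.
Proof.
  intros H.
  assert (H' : forall x, exists d : posreal, a <= x <= b -> P x d).
  { intros x. destruct (excluded_middle_informative (a <= x <= b)) as [h|h].
    - destruct (H x h) as (d & Hd & Hp). exists (mkposreal d Hd). auto.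
    - exists (mkposreal 1 Rlt_0_1). tauto. }
  pose (dl := fun x => proj1_sig (constructive_indefinite_description _ (H' x))).
  assert (Hdl : forall x, a <= x <= b -> P x (dl x))
    by (intros x; exact (proj2_sig (constructive_indefinite_description _ (H' x)))).
  destruct (compactness_value_1d a b dl) as [d Hd].
  exists d. split; [apply cond_pos|]. intros y Hy C. apply (Hd y Hy).
  intros (x & Hx & B & L). apply C. exists x, (dl x). auto.
Qed.

(** Each [x] lies in a cell of uniform size around some x', and both [u s x] and [u t x] are close
    to the value of [u t] at x'. *)
Lemma cont_on_unif (D : R -> Prop) u t a b e : cont_on D u -> D t -> 0 < e ->
  exists d, 0 < d /\ forall s x, D s -> Rabs (s - t) < d -> a <= x <= b -> Rabs (u s x - u t x) < e.
Proof.
  intros Hu Ht He.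
  destruct (uniform_radius a b (fun x d => forall s y, D s -> Rabs (s - t) < d -> Rabs (y - x) < d ->
      Rabs (u s y - u t x) < e / 2)) as (d & Hd & K).
  { intros x _. destruct (Hu t x Ht (e / 2)) as (d & Hd & K); [lra|]. exists d; auto. }
  exists d. split; [exact Hd|]. intros s x Ds Hs Hx.
  destruct (Rlt_dec (Rabs (u s x - u t x)) e) as [h|h]; [exact h|exfalso].
  apply (K x Hx). intros (x' & e' & _ & P & B & L). apply h.
  assert (A1 : Rabs (u s x - u t x') < e / 2) by (apply P; auto; lra).
  assert (A2 : Rabs (u t x - u t x') < e / 2).
  { apply P; auto. rewrite Rminus_diag, Rabs_R0. lra. }
  apply Rabs_def2 in A1. apply Rabs_def2 in A2. apply Rabs_def1; lra.
Qed.

(* A local bound [M] is recorded as a radius at most [/ (M + 1)], so that a uniform radius yields a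
   uniform bound. *)
Lemma cont_on_bounded T u a b : a <= b -> cont_on (fun t => 0 <= t <= T) u ->
  exists M, forall t x, 0 <= t <= T -> a <= x <= b -> Rabs (u t x) <= M.
Proof.
  intros Hab Hu.
  destruct (uniform_radius 0 T (fun t d => forall s x, 0 <= s <= T -> Rabs (s - t) < d -> a <= x <= b ->
      Rabs (u s x) <= / d)) as (d & Hd & K).
  { intros t Ht. destruct (cts_bounded (u t) a b Hab (cont_on_cts _ u t Hu Ht)) as [M HM].
    destruct (cont_on_unif _ u t a b 1 Hu Ht Rlt_0_1) as (d & Hd & K).
    assert (M0 : 0 <= M) by (eapply Rle_trans; [apply Rabs_pos | apply (HM a); lra]).
    assert (HM1 : 0 < / (M + 1)) by (apply Rinv_0_lt_compat; lra).
    exists (Rmin d (/ (M + 1))). split; [apply Rmin_glb_lt; lra|].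
    intros s x Ds Hs Hx. apply Rle_trans with (M + 1).
    - assert (A : Rabs (u s x - u t x) < 1) by (apply K; auto; pose proof (Rmin_l d (/ (M + 1))); lra).
      pose proof (HM x Hx). pose proof (Rabs_triang_inv (u s x) (u t x)). lra.
    - apply Rle_trans with (/ / (M + 1)); [rewrite Rinv_inv; lra|]. apply Rinv_le_contravar; [apply Rmin_glb_lt; lra | apply Rmin_r]. }
  exists (/ d). intros t x Ht Hx.
  destruct (Rle_dec (Rabs (u t x)) (/ d)) as [h|h]; [exact h|exfalso].
  apply (K t Ht). intros (t' & e & _ & P & B & L). apply h.
  apply Rle_trans with (/ e); [now apply P|]. apply Rinv_le_contravar; assumption.
Qed.

Lemma mom_cont l D u b j : 0 < l -> cont_on D u -> cont_t D (fun t => mom l (u t) b j).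
Proof.
  intros Hl Hu t z Ht e He. cbv beta.
  destruct (cont_on_unif D u t (- (l / 2)) (l / 2) (e / (2 * l)) Hu Ht) as (d & Hd & K).
  { apply Rdiv_lt_0_compat; lra. }
  exists d. split; [exact Hd|]. intros s y Ds B _.
  pose proof (cont_on_cts D u t Hu Ht). pose proof (cont_on_cts D u s Hu Ds).
  rewrite <- mom_minus by assumption.
  apply Rle_lt_trans with (l * (e / (2 * l))).
  - apply mom_bound; [exact Hl | auto with cts |]. intros x Hx. left. now apply K.
  - replace (l * (e / (2 * l))) with (e / 2) by (field; lra). lra.
Qed.

(** * Derivatives within a set and linear equations on a segment *)

Lemma deriv_within_cont D f t a : deriv_within D f t a ->
  limit1_in f D (f t) t.
Proof.
  intros H e He. destruct (H 1 Rlt_0_1) as (d & Hd & K).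
  assert (Hp : 0 < Rabs a + 1) by (pose proof (Rabs_pos a); lra).
  exists (Rmin d (e / (Rabs a + 1))). split.
  { apply Rmin_glb_lt; [exact Hd | now apply Rdiv_lt_0_compat]. }
  intros s [Ds Hs]. simpl in *. unfold Rdist in *.
  destruct (Req_dec s t) as [->|N]; [rewrite Rminus_diag, Rabs_R0; exact He|].
  pose proof (Rmin_l d (e / (Rabs a + 1))). pose proof (Rmin_r d (e / (Rabs a + 1))).
  assert (B : Rabs (s - t) < d) by lra. specialize (K s (conj (conj Ds N) B)).
  assert (Q : Rabs ((f s - f t) / (s - t)) < Rabs a + 1).
  { pose proof (Rabs_triang_inv ((f s - f t) / (s - t)) a). lra. }
  rewrite Rabs_div in Q by lra. assert (Hst : 0 < Rabs (s - t)) by (apply Rabs_pos_lt; lra).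
  apply Rlt_div_l in Q; [|exact Hst].
  assert (Q2 : Rabs (s - t) < e / (Rabs a + 1)) by lra.
  apply Rlt_div_r in Q2; lra.
Qed.

Lemma deriv_within_mult D f g t a b : deriv_within D f t a -> deriv_within D g t b ->
  deriv_within D (fun s => f s * g s) t (a * g t + f t * b).
Proof.
  intros Hf Hg. pose proof (deriv_within_cont _ _ _ _ Hf) as Cf.
  assert (Cf' : limit1_in f (fun s => D s /\ s <> t) (f t) t).
  { intros e He. destruct (Cf e He) as (d & Hd & K). exists d. split; [exact Hd|].
    intros s Hs. apply K. tauto. }
  pose proof (limit_mul _ _ _ _ _ _ Cf' Hg) as L1.
  pose proof (limit_mul _ _ _ _ _ _ Hf (limit_free (fun _ => g t) _ 0 t)) as L2.
  pose proof (limit_plus _ _ _ _ _ _ L2 L1) as L.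
  intros e He. destruct (L e He) as (d & Hd & K). exists d. split; [exact Hd|].
  intros s Hs. specialize (K s Hs).
  replace ((f s * g s - f t * g t) / (s - t))
    with ((f s - f t) / (s - t) * g t + f s * ((g s - g t) / (s - t))) by (unfold Rdiv; ring).
  exact K.
Qed.

(** Extends a function on a segment by constants, so that two-sided theorems on integrals and mean
    values become available. *)
Definition clamp (a b r : R) : R := Rmax a (Rmin b r).

Lemma clamp_in a b r : a <= b -> a <= clamp a b r <= b.
Proof. intros H. unfold clamp, Rmax, Rmin. repeat destruct Rle_dec; lra. Qed.

Lemma clamp_id a b r : a <= r <= b -> clamp a b r = r.
Proof. intros H. unfold clamp, Rmax, Rmin. repeat destruct Rle_dec; lra. Qed.

Lemma clamp_lip a b r s : Rabs (clamp a b s - clamp a b r) <= Rabs (s - r).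
Proof.
  unfold clamp, Rmax, Rmin, Rabs. repeat destruct Rle_dec; repeat destruct Rcase_abs; lra.
Qed.

Lemma clamp_cts a b f : a <= b ->
  (forall t, a <= t <= b -> limit1_in f (fun s => a <= s <= b) (f t) t) ->
  cts (fun r => f (clamp a b r)).
Proof.
  intros Hab H r. apply filterlim_locally. intros e.
  destruct (H (clamp a b r) (clamp_in a b r Hab) e (cond_pos e)) as (d & Hd & K).
  exists (mkposreal d Hd). intros s B. apply K. split; [now apply clamp_in|].
  eapply Rle_lt_trans; [apply clamp_lip | exact B].
Qed.

Lemma within_mvt a b f f' : a <= b ->
  (forall t, a <= t <= b -> deriv_within (fun s => a <= s <= b) f t (f' t)) ->
  exists c, a <= c <= b /\ f b - f a = f' c * (b - a).
Proof.
  intros Hab H.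
  destruct (MVT_gen (fun r => f (clamp a b r)) a b f') as (c & Hc & E).
  - rewrite Rmin_left, Rmax_right by lra. intros r Hr. apply deriv_within_derive.
    intros e He. destruct (H r ltac:(lra) e He) as (d & Hd & K).
    exists (Rmin d (Rmin (r - a) (b - r))). split; [repeat apply Rmin_glb_lt; lra|].
    intros s [[_ N] B]. simpl in B. unfold Rdist in B.
    pose proof (Rmin_l d (Rmin (r - a) (b - r))). pose proof (Rmin_r d (Rmin (r - a) (b - r))).
    pose proof (Rmin_l (r - a) (b - r)). pose proof (Rmin_r (r - a) (b - r)).
    assert (Hs : a <= s <= b) by (apply Rabs_def2 in B; lra).
    rewrite !clamp_id by lra. apply K. repeat split; try lra. simpl. unfold Rdist. lra.
  - intros r _. apply continuity_pt_filterlim. apply clamp_cts; [exact Hab|].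
    intros t Ht. eapply deriv_within_cont. now apply H.
  - rewrite Rmin_left, Rmax_right in Hc by lra. rewrite !clamp_id in E by lra. eauto.
Qed.

Definition seg (T t : R) : Prop := 0 <= t <= T.

Lemma within_mvt_seg T f f' s t : seg T s -> seg T t ->
  (forall r, seg T r -> deriv_within (seg T) f r (f' r)) ->
  exists c, Rmin s t <= c <= Rmax s t /\ f s - f t = f' c * (s - t).
Proof.
  unfold seg. intros Hs Ht H.
  destruct (Rle_dec s t) as [L|L].
  - destruct (within_mvt s t f f') as (c & Hc & E); [assumption| |].
    + intros r Hr. apply deriv_within_mono with (D := seg T); [unfold seg; intros; lra | apply H; lra].
    + exists c. rewrite Rmin_left, Rmax_right by lra. split; [assumption | lra].
  - destruct (within_mvt t s f f') as (c & Hc & E); [lra| |].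
    + intros r Hr. apply deriv_within_mono with (D := seg T); [unfold seg; intros; lra | apply H; lra].
    + exists c. rewrite Rmin_right, Rmax_left by lra. split; assumption.
Qed.

(** Differentiation under the integral: the mean value theorem in time replaces the difference
    quotient by [ut] at an intermediate time, and that is uniformly close to [ut t] on the
    period. *)
Lemma mom_deriv T l u ut b j t : 0 < l -> seg T t -> cont_on (seg T) u -> cont_on (seg T) ut ->
  dtau (seg T) u ut -> deriv_within (seg T) (fun s => mom l (u s) b j) t (mom l (ut t) b j).
Proof.
  intros Hl Ht Hu Hut Hd e He.
  destruct (cont_on_unif (seg T) ut t (- (l / 2)) (l / 2) (e / (2 * l)) Hut Ht) as (d & Hd0 & K).
  { apply Rdiv_lt_0_compat; lra. }
  exists d. split; [exact Hd0|]. intros s [[Ds N] B]. simpl in *. unfold Rdist in *.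
  pose proof (cont_on_cts _ u t Hu Ht). pose proof (cont_on_cts _ u s Hu Ds).
  pose proof (cont_on_cts _ ut t Hut Ht).
  replace ((mom l (u s) b j - mom l (u t) b j) / (s - t) - mom l (ut t) b j)
    with (mom l (fun x => / (s - t) * (u s x - u t x) - ut t x) b j).
  2:{ rewrite mom_minus, mom_scal, mom_minus by auto with cts. unfold Rdiv. ring. }
  apply Rle_lt_trans with (l * (e / (2 * l))).
  2:{ replace (l * (e / (2 * l))) with (e / 2) by (field; lra). lra. }
  apply mom_bound; [exact Hl | auto with cts |]. intros x Hx.
  destruct (within_mvt_seg T (fun r => u r x) (fun r => ut r x) s t Ds Ht) as (c & Hc & E).
  { intros r Hr. now apply Hd. }
  cbv beta in E. rewrite E. replace (/ (s - t) * (ut c x * (s - t))) with (ut c x) by (field; lra).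
  left. unfold seg in *. apply Rabs_def2 in B.
  apply K; [| |exact Hx]; unfold Rmin, Rmax in Hc; destruct Rle_dec; try lra; apply Rabs_def1; lra.
Qed.

(** Integrating factor: [phi] has derivative [exp (a * s) * (N s - K * exp (g * s))], which is
    nonpositive, so [phi] decreases. The rate [a] may be negative, as it is for the unstable modes
    with 0 < y < 1/2. *)
Lemma ode_upper T a g K y N t : seg T t -> 0 < a + g -> 
  (forall s, seg T s -> deriv_within (seg T) y s (- a * y s + N s)) ->
  (forall s, seg T s -> N s <= K * exp (g * s)) -> 0 <= K ->
  y t <= exp (- a * t) * y 0 + K / (a + g) * exp (g * t).
Proof.
  intros Ht Hag Hy HN HK.
  assert (H0 : seg T 0) by (unfold seg in *; lra).
  assert (De : forall c s, deriv_within (seg T) (fun s => exp (c * s)) s (c * exp (c * s))).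
  { intros c s. apply deriv_within_mono with (D := fun _ => True); [auto|].
    apply deriv_within_derive. auto_derive; auto. ring. }
  set (phi := fun s => exp (a * s) * y s + - (K / (a + g)) * exp ((a + g) * s)).
  assert (Dphi : forall s, seg T s -> deriv_within (seg T) phi s (exp (a * s) * (N s - K * exp (g * s)))).
  { intros s Hs. unfold phi.
    replace (exp (a * s) * (N s - K * exp (g * s)))
      with ((a * exp (a * s) * y s + exp (a * s) * (- a * y s + N s))
            + - (K / (a + g)) * ((a + g) * exp ((a + g) * s))).
    - exact (deriv_within_plus _ _ _ _ _ _ (deriv_within_mult _ _ _ _ _ _ (De a s) (Hy s Hs))
        (deriv_within_scal _ _ _ _ (- (K / (a + g))) (De (a + g) s))).
    - replace ((a + g) * s) with (a * s + g * s) by ring. rewrite exp_plus. field. lra. }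
  destruct (within_mvt_seg T phi _ t 0 Ht H0 Dphi) as (c & Hc & E).
  assert (Hc' : seg T c).
  { unfold seg in *. rewrite Rmin_right, Rmax_left in Hc by lra. lra. }
  pose proof (exp_pos (a * c)). pose proof (HN c Hc').
  assert (L : phi t <= phi 0).
  { assert (exp (a * c) * (N c - K * exp (g * c)) <= 0) by nra. unfold seg in Ht. nra. }
  unfold phi in L. rewrite !Rmult_0_r, exp_0 in L.
  assert (Kp : 0 <= K / (a + g)) by (apply Rdiv_le_0_compat; assumption).
  replace ((a + g) * t) with (a * t + g * t) in L by ring. rewrite exp_plus in L.
  assert (Ee : exp (- a * t) * exp (a * t) = 1).
  { rewrite <- exp_plus. replace (- a * t + a * t) with 0 by ring. apply exp_0. }
  pose proof (exp_pos (- a * t)).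
  replace (y t) with (exp (- a * t) * (exp (a * t) * y t)) by (rewrite <- Rmult_assoc, Ee; ring).
  apply Rle_trans with (exp (- a * t) * (y 0 + K / (a + g) * (exp (a * t) * exp (g * t)))).
  - apply Rmult_le_compat_l; lra.
  - right. rewrite Rmult_plus_distr_l. f_equal.
    transitivity (K / (a + g) * (exp (- a * t) * exp (a * t)) * exp (g * t)); [ring|]. rewrite Ee. ring.
Qed.

Lemma ode_bound T a g K y N t : seg T t -> 0 < a + g ->
  (forall s, seg T s -> deriv_within (seg T) y s (- a * y s + N s)) ->
  (forall s, seg T s -> Rabs (N s) <= K * exp (g * s)) ->
  Rabs (y t) <= (Rabs (y 0) + K / (a + g)) * exp (g * t).
Proof.
  intros Ht Hag Hy HN.
  assert (H0 : seg T 0) by (unfold seg in *; lra).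
  assert (HK : 0 <= K).
  { pose proof (HN 0 H0) as h. rewrite Rmult_0_r, exp_0, Rmult_1_r in h. pose proof (Rabs_pos (N 0)). lra. }
  assert (U1 : y t <= exp (- a * t) * y 0 + K / (a + g) * exp (g * t)).
  { apply (ode_upper T a g K y N); auto. intros s Hs. pose proof (HN s Hs). pose proof (Rle_abs (N s)). lra. }
  assert (U2 : -1 * y t <= exp (- a * t) * (-1 * y 0) + K / (a + g) * exp (g * t)).
  { apply (ode_upper T a g K (fun s => -1 * y s) (fun s => -1 * N s)); auto.
    - intros s Hs. replace (- a * (-1 * y s) + -1 * N s) with (-1 * (- a * y s + N s)) by ring.
      apply deriv_within_scal. auto.
    - intros s Hs. pose proof (HN s Hs). pose proof (Rle_abs (- N s)). rewrite Rabs_Ropp in *. lra. }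
  assert (Le : exp (- a * t) <= exp (g * t)).
  { destruct (Req_dec t 0) as [->|Nt]; [rewrite !Rmult_0_r; lra|].
    left. apply exp_increasing. unfold seg in Ht. nra. }
  pose proof (exp_pos (- a * t)). pose proof (Rle_abs (y 0)). pose proof (Rle_abs (- y 0)) as h.
  rewrite Rabs_Ropp in h. pose proof (Rabs_pos (y 0)).
  apply Rabs_le. split; nra.
Qed.

(** Solution with zero initial value of the scalar equation with rate [a] and source [N]. The clamp
    makes the integrand continuous on the whole line, although [N] is controlled only on the
    segment. *)
Definition duhamel (T a : R) (N : R -> R) (t : R) : R :=
  exp (- a * t) * RI (fun s => exp (a * s) * N (clamp 0 T s)) 0 t.

Lemma cont_t_limit D f t : cont_t D f -> D t -> limit1_in f D (f t) t.
Proof.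
  intros H Ht e He. destruct (H t 0 Ht e He) as (d & Hd & K). exists d. split; [exact Hd|].
  intros s [Ds B]. apply (K s 0 Ds B). rewrite Rminus_diag, Rabs_R0. exact Hd.
Qed.

Lemma limit_cont_t (D : R -> Prop) f : (forall t, D t -> limit1_in f D (f t) t) -> cont_t D f.
Proof.
  intros H t x Ht e He. destruct (H t Ht e He) as (d & Hd & K). exists d. split; [exact Hd|].
  intros s y Ds B _. apply K. split; assumption.
Qed.

Lemma duhamel_0 T a N : duhamel T a N 0 = 0.
Proof.
  unfold duhamel, RI. rewrite RInt_point. apply Rmult_0_r.
Qed.

Lemma duhamel_deriv T a N t : cont_t (seg T) N -> seg T t ->
  deriv_within (seg T) (duhamel T a N) t (- a * duhamel T a N t + N t).
Proof.
  intros HN Ht.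
  assert (Hc : cts (fun s => exp (a * s) * N (clamp 0 T s))).
  { apply cts_mult.
    - intros s. apply (ex_derive_continuous (fun s => exp (a * s))). auto_derive. auto.
    - apply clamp_cts; [unfold seg in Ht; lra|]. intros s Hs. now apply (cont_t_limit (seg T)). }
  apply deriv_within_mono with (D := fun _ => True); [auto|].
  replace (- a * duhamel T a N t + N t)
    with (- a * exp (- a * t) * RI (fun s => exp (a * s) * N (clamp 0 T s)) 0 t
          + exp (- a * t) * (exp (a * t) * N (clamp 0 T t))).
  - apply (deriv_within_mult _ (fun t => exp (- a * t))).
    + apply deriv_within_derive. auto_derive; auto. ring.
    + apply deriv_within_derive.
      apply (is_derive_RInt (fun s => exp (a * s) * N (clamp 0 T s))
               (fun t => RI (fun s => exp (a * s) * N (clamp 0 T s)) 0 t) 0 t); [|apply Hc].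
      apply filter_forall. intros z. apply (RInt_correct (V := R_CompleteNormedModule)).
      now apply cts_ex_RInt.
  - rewrite clamp_id by exact Ht. unfold duhamel.
    transitivity (- a * exp (- a * t) * RI (fun s => exp (a * s) * N (clamp 0 T s)) 0 t
        + (exp (- a * t) * exp (a * t)) * N t); [ring|].
    rewrite <- exp_plus. replace (- a * t + a * t) with 0 by ring. rewrite exp_0. ring.
Qed.

(** * Moments and the coefficients of the statement *)

Definition kpar (k : nat) : bool := Nat.odd k || Nat.eqb k 0.

(** Translates back to the enumeration of the eigenbasis: odd k are cosines, even positive k are
    sines, k = 0 is the constant. The value at [(false, 0)] is a placeholder. *)
Definition kidx (b : bool) (j : nat) : nat :=
  match j with O => O | _ => if b then (2 * j - 1)%nat else (2 * j)%nat end.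

Lemma jidx_kidx b j : jidx (kidx b j) = j.
Proof.
  unfold jidx, kidx. destruct j as [|j]; [reflexivity|]. destruct b.
  - replace (S (2 * S j - 1)) with (2 * S j)%nat by lia. apply Nat.div2_double.
  - apply Nat.div2_succ_double.
Qed.

Lemma kpar_kidx b j : (b = false -> (0 < j)%nat) -> kpar (kidx b j) = b.
Proof.
  intros H. unfold kpar, kidx. destruct j as [|j].
  - destruct b; [reflexivity|]. specialize (H eq_refl). lia.
  - destruct b.
    + replace (2 * S j - 1)%nat with (2 * j + 1)%nat by lia. rewrite Nat.odd_odd. reflexivity.
    + rewrite Nat.odd_even. reflexivity.
Qed.

Definition cnorm (l : R) (k : nat) : R := match k with O => / sqrt l | _ => sqrt (2 / l) end.

Lemma cnorm_pos l k : 0 < l -> 0 < cnorm l k.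
Proof.
  intros Hl. unfold cnorm. destruct k.
  - apply Rinv_0_lt_compat, sqrt_lt_R0, Hl.
  - apply sqrt_lt_R0, Rdiv_lt_0_compat; lra.
Qed.

Lemma wb_trig l k x : wb l k x = cnorm l k * trig l (kpar k) (jidx k) x.
Proof.
  destruct k as [|k].
  - simpl. unfold jidx. simpl. rewrite om_0, Rmult_0_l, cos_0. ring.
  - unfold wb, cnorm, kpar, trig, om. rewrite orb_false_r.
    replace (2 * PI * INR (jidx (S k)) / l * x) with (2 * PI * INR (jidx (S k)) * x / l)
      by (unfold Rdiv; ring).
    destruct (Nat.odd (S k)); reflexivity.
Qed.

Lemma coef_mom l v k : cts v -> coef l v k = cnorm l k * mom l v (kpar k) (jidx k).
Proof.
  intros Hv. unfold coef, mom. rewrite <- RI_scal by auto with cts.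
  rewrite integral_RInt.
  - apply RI_ext. intros x. rewrite wb_trig. ring.
  - apply cts_ex_RInt. intros x.
    apply (continuous_ext (fun x => v x * (cnorm l k * trig l (kpar k) (jidx k) x))).
    + intros y. now rewrite wb_trig.
    + assert (H : cts (fun x => v x * (cnorm l k * trig l (kpar k) (jidx k) x))) by auto with cts.
      apply H.
Qed.

Lemma realizes_mom l (D : R -> Prop) c c' u v t b j : 0 < l -> realizes l D c u v ->
  (forall k, c k = c' (jidx k)) -> cont_on D u -> cont_on D v -> D t ->
  mom l (v t) b j = c' j * mom l (u t) b j.
Proof.
  intros Hl H E Hu Hv Ht. destruct (H t Ht) as [_ K].
  (* The slot [(false, 0)] matches no basis function; there both moments vanish. *)
  assert (G : b = false /\ j = O \/ (b = false -> (0 < j)%nat)) by (destruct b, j; auto; right; intros; try lia; discriminate).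
  destruct G as [[-> ->]|G]; [rewrite !mom_false_0; ring|].
  specialize (K (kidx b j)). rewrite !coef_mom, E, jidx_kidx, kpar_kidx in K
    by first [assumption | eapply cont_on_cts; eassumption].
  pose proof (cnorm_pos l (kidx b j) Hl). apply Rmult_eq_reg_l with (cnorm l (kidx b j)); [|lra].
  rewrite K. ring.
Qed.

Lemma mom_realizes l (D : R -> Prop) c c' u v : (forall k, c k = c' (jidx k)) ->
  cont_on D u -> cont_on D v -> (forall t, D t -> periodic l (v t)) ->
  (forall t b j, D t -> mom l (v t) b j = c' j * mom l (u t) b j) -> realizes l D c u v.
Proof.
  intros E Hu Hv Hp H t Ht. split; [now apply Hp|]. intros k.
  rewrite !coef_mom, H, E by first [assumption | eapply cont_on_cts; eassumption]. ring.
Qed.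

(** A single term of a convergent series with nonnegative terms is bounded by the sum; taking the
    square root gives decay of order [n]. *)
Lemma Hm_sharp_dec l m f n : 0 < l -> (n <= m)%nat -> Hm_sharp l m f -> exists A, dec n A (mom l f).
Proof.
  intros Hl Hnm (Hc & Hp & S & HS).
  assert (cf : cts f) by (intros x; apply continuity_pt_filterlim, Hc).
  assert (Hk : forall k, (1 + lam l k) ^ m * coef l f k ^ 2 <= S).
  { intros k. assert (P : forall i, 0 <= (1 + lam l i) ^ m * coef l f i ^ 2).
    { intros i. apply Rmult_le_pos; [apply pow_le; unfold lam|]; pose proof (pow2_ge_0 (2 * PI * INR (jidx i) / l));
        pose proof (pow2_ge_0 (coef l f i)); lra. }
    apply Rle_trans with (sum_f_R0 (fun k => (1 + lam l k) ^ m * coef l f k ^ 2) k).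
    - destruct k as [|k]; [simpl; lra|]. rewrite tech5.
      pose proof (cond_pos_sum (fun k => (1 + lam l k) ^ m * coef l f k ^ 2) k P). lra.
    - apply (sum_incr (fun k => (1 + lam l k) ^ m * coef l f k ^ 2) k S HS P). }
  (* The half comes from (1 + j)^2 being at most 2 (1 + j^2); the minimum compares 1 + j^2 with 1 +
     [om l j ^ 2]. *)
  set (c := Rmin 1 (om l 1 ^ 2) / 2).
  pose proof (om_S l 0 Hl) as Ho. assert (Ho2 : 0 < om l 1 ^ 2) by nra.
  pose proof (Rmin_glb_lt 1 (om l 1 ^ 2) 0 Rlt_0_1 Ho2) as Hr.
  assert (Hc0 : 0 < c) by (unfold c; lra).
  assert (Hlam : forall j, c * (1 + INR j) ^ 2 <= 1 + (om l j) ^ 2).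
  { intros j. rewrite om_lin. pose proof (pos_INR j). pose proof (Rmin_l 1 (om l 1 ^ 2)).
    pose proof (Rmin_r 1 (om l 1 ^ 2)). unfold c. set (a := om l 1 ^ 2) in *.
    replace ((om l 1 * INR j) ^ 2) with (a * INR j ^ 2) by (unfold a; ring).
    set (r := Rmin 1 a) in *.
    pose proof (pow2_ge_0 (1 - INR j)).
    apply Rle_trans with (r * (1 + INR j ^ 2)); nra. }
  set (q := Rmin (/ sqrt l) (sqrt (2 / l))).
  assert (Hq : 0 < q) by (apply Rmin_glb_lt; [apply (cnorm_pos l 0 Hl) | apply (cnorm_pos l 1 Hl)]).
  assert (Hqk : forall k, q <= cnorm l k) by (intros [|k]; [apply Rmin_l | apply Rmin_r]).
  assert (S0 : 0 <= S).
  { eapply Rle_trans; [|apply (Hk 0%nat)]. apply Rmult_le_pos; [|apply pow2_ge_0].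
    apply pow_le. unfold lam. pose proof (pow2_ge_0 (2 * PI * INR (jidx 0) / l)). lra. }
  assert (Hcn : 0 < c ^ n) by (apply pow_lt, Hc0).
  exists (sqrt (S / c ^ n / q ^ 2)). intros b j.
  assert (G : b = false /\ j = O \/ (b = false -> (0 < j)%nat)) by (destruct b, j; auto; right; intros; try lia; discriminate).
  destruct G as [[-> ->]|G].
  { rewrite mom_false_0, Rabs_R0, Rmult_0_l. apply sqrt_pos. }
  pose proof (w_pow_pos j n) as Hw.
  rewrite <- (Rabs_right ((1 + INR j) ^ n)), <- Rabs_mult by lra.
  apply Rsqr_incr_0_var; [|apply sqrt_pos]. rewrite <- Rsqr_abs.
  rewrite Rsqr_sqrt by (apply Rdiv_le_0_compat; [apply Rdiv_le_0_compat|nra]; assumption).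
  assert (Hq2 : 0 < q ^ 2) by (apply pow_lt, Hq).
  apply (proj1 (Rle_div_r _ _ (q ^ 2) Hq2)). apply (proj1 (Rle_div_r _ _ (c ^ n) Hcn)).
  eapply Rle_trans; [|apply (Hk (kidx b j))].
  rewrite coef_mom by exact cf. unfold lam. rewrite jidx_kidx. fold (om l j).
  rewrite kpar_kidx by exact G. set (u := mom l f b j).
  replace (Rsqr (u * (1 + INR j) ^ n) * q ^ 2 * c ^ n)
    with ((c * (1 + INR j) ^ 2) ^ n * (q ^ 2 * u ^ 2))
    by (unfold Rsqr; rewrite Rpow_mult_distr, <- pow_mult, Nat.mul_comm, pow_mult; ring).
  assert (1 <= 1 + om l j ^ 2) by (pose proof (pow2_ge_0 (om l j)); lra).
  apply Rmult_le_compat.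
  - apply pow_le. pose proof (pow2_ge_0 (1 + INR j)). nra.
  - pose proof (pow2_ge_0 q). pose proof (pow2_ge_0 u). nra.
  - apply Rle_trans with ((1 + om l j ^ 2) ^ n).
    + apply pow_incr. split; [pose proof (pow2_ge_0 (1 + INR j)); nra | apply Hlam].
    + now apply Rle_pow.
  - rewrite Rpow_mult_distr. apply Rmult_le_compat_r; [apply pow2_ge_0|]. apply pow_incr. split; [lra | apply Hqk].
Qed.

Lemma w4_le j : (1 + INR j) ^ 4 <= 8 * (1 + INR j ^ 4).
Proof.
  set (x := INR j).
  (* The difference of the two sides, factored. *)
  assert (H : 0 <= (x - 1) ^ 2 * (7 * x ^ 2 + 10 * x + 7)).
  { pose proof (pos_INR j) as Hx. fold x in Hx. apply Rmult_le_pos; [apply pow2_ge_0 | nra]. }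
  nra.
Qed.

Lemma dec4_of l z M M' : 0 < l -> (forall b j, Rabs (z b j) <= M) ->
  (forall b j, om l j ^ 4 * Rabs (z b j) <= M') -> dec 4 (8 * (M + M' / om l 1 ^ 4)) z.
Proof.
  intros Hl H0 H4 b j. specialize (H0 b j). specialize (H4 b j).
  pose proof (om_S l 0 Hl) as Ho. assert (Ho4 : 0 < om l 1 ^ 4) by (apply pow_lt, Ho).
  assert (H : INR j ^ 4 * Rabs (z b j) <= M' / om l 1 ^ 4).
  { apply (proj1 (Rle_div_r _ _ _ Ho4)). rewrite om_lin, Rpow_mult_distr in H4. lra. }
  pose proof (w4_le j). pose proof (Rabs_pos (z b j)). nra.
Qed.

Lemma dec2_of l z M M' : 0 < l -> (forall b j, Rabs (z b j) <= M) ->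
  (forall b j, om l j ^ 2 * Rabs (z b j) <= M') -> dec 2 (2 * (M + M' / om l 1 ^ 2)) z.
Proof.
  intros Hl H0 H4 b j. specialize (H0 b j). specialize (H4 b j).
  pose proof (om_S l 0 Hl) as Ho. assert (Ho4 : 0 < om l 1 ^ 2) by (apply pow_lt, Ho).
  assert (H : INR j ^ 2 * Rabs (z b j) <= M' / om l 1 ^ 2).
  { apply (proj1 (Rle_div_r _ _ _ Ho4)). rewrite om_lin, Rpow_mult_distr in H4. lra. }
  pose proof (pow2_ge_0 (1 - INR j)). pose proof (Rabs_pos (z b j)). nra.
Qed.

Lemma dz_dz l z b j : dz l (dz l z) b j = - om l j ^ 2 * z b j.
Proof. unfold dz. destruct b; simpl; ring. Qed.

Lemma deriv_periodic l f f' : periodic l f -> (forall x, is_derive f x (f' x)) -> periodic l f'.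
Proof.
  intros Hp Hd x. rewrite <- (is_derive_unique _ _ _ (Hd x)). symmetry. apply is_derive_unique.
  apply (is_derive_ext (fun y => f (y + l))); [intros; apply Hp|].
  evar_last.
  - apply (is_derive_comp f (fun y => y + l)); [apply Hd|].
    apply (is_derive_plus (fun y => y) (fun _ => l)); [apply is_derive_id | apply is_derive_const].
  - unfold plus, zero, one, scal; simpl. unfold mult; simpl. ring.
Qed.

Lemma deta_derive (D : R -> Prop) u u' t : deta D u u' -> D t -> forall x, is_derive (u t) x (u' t x).
Proof. intros H Ht x. apply is_derive_Reals. now apply H. Qed.

(** The Lipschitz hypothesis of [FS_deriv_t] follows from the mean value theorem in time,
    coefficient by coefficient. *)
Lemma FS_dtau T l (z z' : R -> bool -> nat -> R) A A' : 0 < l ->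
  (forall t, seg T t -> dec 2 A (z t)) -> (forall t, seg T t -> dec 2 A' (z' t)) ->
  (forall b j t, seg T t -> deriv_within (seg T) (fun s => z s b j) t (z' t b j)) ->
  dtau (seg T) (fun t x => FS l (z t) x) (fun t x => FS l (z' t) x).
Proof.
  intros Hl Hz Hz' Hd t x Ht.
  pose proof (dec_nonneg _ _ _ (Hz t Ht)). pose proof (dec_nonneg _ _ _ (Hz' t Ht)).
  apply (FS_deriv_t l (seg T) z z' (A + A') t x Hl Ht).
  - intros s Hs. apply dec_le with A; [lra | auto].
  - apply dec_le with A'; [lra | auto].
  - intros s Hs b j.
    destruct (within_mvt_seg T (fun r => z r b j) (fun r => z' r b j) s t Hs Ht) as (c & Hc & E).
    { intros r Hr. now apply Hd. }
    cbv beta in E. rewrite E, Rabs_mult.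
    assert (Hc' : seg T c).
    { unfold seg in *. unfold Rmin, Rmax in Hc. destruct Rle_dec; lra. }
    pose proof (Hz' c Hc' b j). pose proof (Rabs_pos (s - t)).
    replace (Rabs (z' c b j) * Rabs (s - t) * (1 + INR j) ^ 2)
      with (Rabs (z' c b j) * (1 + INR j) ^ 2 * Rabs (s - t)) by ring.
    apply Rmult_le_compat_r; lra.
  - intros b j. now apply Hd.
Qed.

(** * Regularity of the Kuramoto-Sivashinsky solution *)

(** Scalar equation of each mode, obtained by integrating by parts. The starting exponent 4 comes
    from the bounds on [Phi] and its fourth derivative over the compact set of times and one
    period. *)
Lemma ks_ode l Phi0 Phi T : 0 < l -> 0 < T -> ks_sol l Phi0 Phi ->
  exists P1 Pt, cont_on (seg T) P1 /\ cont_on (seg T) Pt /\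
    (forall t, seg T t -> forall x, is_derive (Phi t) x (P1 t x)) /\
    (forall b j t, seg T t ->
       deriv_within (seg T) (fun s => mom l (Phi s) b j) t (mom l (Pt t) b j)) /\
    (forall t b j, seg T t -> mom l (Pt t) b j =
        - (4 * om l j ^ 4 - om l j ^ 2) * mom l (Phi t) b j
        + - / 2 * mom l (fun x => P1 t x * P1 t x) b j) /\
    exists A, forall t, seg T t -> dec 4 A (mom l (Phi t)).
Proof.
  intros Hl HT (Hper & _ & Hc & Pt & P1 & P2 & P3 & P4 & Hdt & cPt & D1 & D2 & D3 & D4 & c1 & c2 & c3 & c4 & Heq).
  set (D := fun t => 0 <= t) in *.
  assert (I : forall t, seg T t -> D t) by (unfold seg, D; intros; lra).
  assert (M4 : forall t b j, D t -> mom l (P4 t) b j = om l j ^ 4 * mom l (Phi t) b j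
                                /\ mom l (P2 t) b j = - om l j ^ 2 * mom l (Phi t) b j).
  { intros t b j Ht.
    pose proof (deta_derive _ _ _ t D1 Ht) as d1. pose proof (deta_derive _ _ _ t D2 Ht) as d2.
    pose proof (deta_derive _ _ _ t D3 Ht) as d3. pose proof (deta_derive _ _ _ t D4 Ht) as d4.
    pose proof (Hper t Ht) as p0. pose proof (deriv_periodic _ _ _ p0 d1) as p1.
    pose proof (deriv_periodic _ _ _ p1 d2) as p2. pose proof (deriv_periodic _ _ _ p2 d3) as p3.
    assert (E2 : forall b j, mom l (P2 t) b j = - om l j ^ 2 * mom l (Phi t) b j).
    { intros b' j'. rewrite (mom_derive l (P1 t) (P2 t)) by first [assumption | eapply cont_on_cts; eassumption].
      rewrite (mom_derive l (Phi t) (P1 t)) by first [assumption | eapply cont_on_cts; eassumption].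
      apply dz_dz. }
    split; [|apply E2].
    rewrite (mom_derive l (P3 t) (P4 t)) by first [assumption | eapply cont_on_cts; eassumption].
    rewrite (mom_derive l (P2 t) (P3 t)) by first [assumption | eapply cont_on_cts; eassumption].
    rewrite E2. destruct b; simpl; ring. }
  pose proof (cont_on_mono D (seg T) _ I Hc) as Hc'.
  pose proof (cont_on_mono D (seg T) _ I cPt) as cPt'.
  pose proof (cont_on_mono D (seg T) _ I c1) as c1'.
  pose proof (cont_on_mono D (seg T) _ I c4) as c4'.
  exists P1, Pt. split; [exact c1'|]. split; [exact cPt'|].
  split; [intros t Ht; apply (deta_derive D); auto|].
  split.
  { intros b j t Ht. apply mom_deriv; auto. intros s x Hs.
    apply deriv_within_mono with (D := D); [exact I | apply Hdt; auto]. }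
  split.
  { intros t b j Ht. apply I in Ht. destruct (M4 t b j Ht) as [E4 E2].
    pose proof (cont_on_cts _ _ t c1 Ht). pose proof (cont_on_cts _ _ t c2 Ht).
    pose proof (cont_on_cts _ _ t c4 Ht).
    rewrite (mom_ext l (Pt t) (fun x => -4 * P4 t x + (-1 * P2 t x + - / 2 * (P1 t x * P1 t x)))).
    - rewrite !mom_plus, !mom_scal, E4, E2 by auto 10 with cts. ring.
    - intros x. specialize (Heq t x Ht). simpl in Heq. lra. }
  destruct (cont_on_bounded T Phi (- (l / 2)) (l / 2) ltac:(lra) Hc') as [K0 HK0].
  destruct (cont_on_bounded T P4 (- (l / 2)) (l / 2) ltac:(lra) c4') as [K4 HK4].
  exists (8 * (l * K0 + l * K4 / om l 1 ^ 4)). intros t Ht. apply dec4_of; [exact Hl | |].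
  - intros b j. apply mom_bound; [exact Hl | apply (cont_on_cts _ _ t Hc (I t Ht)) |]. auto.
  - intros b j. rewrite <- (Rabs_right (om l j ^ 4)).
    + rewrite <- Rabs_mult, <- (proj1 (M4 t b j (I t Ht))).
      apply mom_bound; [exact Hl | apply (cont_on_cts _ _ t c4 (I t Ht)) |]. auto.
    + apply Rle_ge, pow_le, om_pos, Hl.
Qed.

(** The added 1 offsets the negative rates of the unstable modes; it is the growth rate allowed in
    [ks_step]. *)
Lemma sigma_lower l : 0 < l -> exists c, 0 < c /\
  forall j, c * (1 + INR j) ^ 4 <= 4 * om l j ^ 4 - om l j ^ 2 + 1.
Proof.
  intros Hl. pose proof (om_S l 0 Hl) as Ho. assert (Ho4 : 0 < om l 1 ^ 4) by (apply pow_lt, Ho).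
  set (r := Rmin (om l 1 ^ 4) (/ 2)).
  assert (Hr : 0 < r) by (apply Rmin_glb_lt; lra).
  exists (r / 8). split; [lra|]. intros j.
  pose proof (w4_le j) as Hw.
  assert (H1 : r * INR j ^ 4 <= om l j ^ 4).
  { rewrite om_lin, Rpow_mult_distr. apply Rmult_le_compat_r; [apply pow_le, pos_INR | apply Rmin_l]. }
  pose proof (Rmin_r (om l 1 ^ 4) (/ 2)) as Hr2. fold r in Hr2.
  assert (H2 : om l j ^ 4 + / 2 <= 4 * om l j ^ 4 - om l j ^ 2 + 1).
  { set (y := om l j). assert (0 <= 3 * (y ^ 2 - / 6) ^ 2) by (pose proof (pow2_ge_0 (y ^ 2 - / 6)); lra). nra. }
  apply Rle_trans with (r * (1 + INR j ^ 4)); [|lra].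
  apply Rle_trans with (r / 8 * (8 * (1 + INR j ^ 4))); [|right; field].
  apply Rmult_le_compat_l; lra.
Qed.

(** The second bound is read off the mode equation: the factor of size j^4 turns exponent [p + 3]
    into [p - 1], which is also the exponent of the square of the derivative. *)
Lemma ks_step l T p A A0 (Phi P1 Pt : R -> R -> R) : 0 < l -> 0 < T -> (3 <= p)%nat ->
  cont_on (seg T) P1 -> (forall t, seg T t -> periodic l (Phi t)) ->
  (forall t, seg T t -> forall x, is_derive (Phi t) x (P1 t x)) ->
  (forall b j t, seg T t -> deriv_within (seg T) (fun s => mom l (Phi s) b j) t (mom l (Pt t) b j)) ->
  (forall t b j, seg T t -> mom l (Pt t) b j =
        - (4 * om l j ^ 4 - om l j ^ 2) * mom l (Phi t) b j
        + - / 2 * mom l (fun x => P1 t x * P1 t x) b j) ->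
  dec (p + 3) A0 (mom l (Phi 0)) ->
  (forall t, seg T t -> dec p A (mom l (Phi t))) ->
  exists B, (forall t, seg T t -> dec (p + 3) B (mom l (Phi t))) /\
   forall t, seg T t -> dec (p - 1) B (mom l (Pt t)).
Proof.
  intros Hl HT Hp c1 Hper D1 Hd He H0 HA.
  (* From here on [p] is the exponent of the derivative, one less than that of [Phi]. *)
  destruct p as [|p]; [lia|]. replace (S p - 1)%nat with p by lia.
  set (C := Cmul l p * (om l 1 * A) * (om l 1 * A)).
  assert (HN : forall t, seg T t -> dec p C (mom l (fun x => P1 t x * P1 t x))).
  { intros t Ht. pose proof (cont_on_cts _ _ t c1 Ht) as cc.
    assert (E : forall b j, mom l (P1 t) b j = dz l (mom l (Phi t)) b j).
    { intros b j. apply mom_derive; auto. }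
    assert (HD : dec p (om l 1 * A) (mom l (P1 t))).
    { apply dec_ext with (dz l (mom l (Phi t))); [intros; now rewrite E|]. apply dec_dz; auto. }
    apply dec_ext with (mom l (fun x => FS l (mom l (P1 t)) x * P1 t x)).
    - intros b j. apply mom_ext. intros x.
      rewrite <- (fourier_series l (P1 t) (om l 1 * A)); auto.
      + eapply deriv_periodic; [apply Hper | apply D1]; exact Ht.
      + apply dec_mono with p; [lia | exact HD].
    - apply mom_FS_mul; auto. lia. }
  destruct (sigma_lower l Hl) as (c & Hc & Hs).
  assert (S0 : seg T 0) by (unfold seg; lra).
  assert (C0 : 0 <= C) by (eapply dec_nonneg; apply (HN 0 S0)).
  set (B := (A0 + C / 2 / c) * exp T).
  assert (HB : forall t, seg T t -> dec (S p + 3) B (mom l (Phi t))).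
  { intros t Ht b j. set (K := / 2 * C / (1 + INR j) ^ p).
    pose proof (w_pow_pos j p) as Hw. pose proof (w_pow_pos j (S p + 3)) as Hw2.
    specialize (Hs j). pose proof (w_pow_pos j 4) as Hw4.
    set (sg := 4 * om l j ^ 4 - om l j ^ 2) in *.
    assert (Hsp : 0 < sg + 1) by nra.
    (* Growth rate 1 makes the divisor [sg + 1], which dominates (1 + j)^4 and yields the four
       powers; its price is the factor [exp T] in [B]. *)
    pose proof (ode_bound T sg 1 K (fun t => mom l (Phi t) b j)
      (fun t => - / 2 * mom l (fun x => P1 t x * P1 t x) b j) t Ht Hsp) as Q.
    cbv beta in Q. rewrite Rmult_1_l in Q.
    assert (HK : Rabs (mom l (Phi t) b j) <= (Rabs (mom l (Phi 0) b j) + K / (sg + 1)) * exp t).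
    { apply Q.
      - intros s Ss. pose proof (Hd b j s Ss) as X. rewrite (He s b j Ss) in X. exact X.
      - intros s Ss. rewrite Rabs_mult, Rabs_Ropp, (Rabs_right (/ 2)) by lra.
        assert (1 <= exp (1 * s)).
        { rewrite Rmult_1_l. destruct (Req_dec s 0) as [->|]; [rewrite exp_0; lra|].
          left. rewrite <- exp_0. apply exp_increasing. unfold seg in Ss. lra. }
        assert (Rabs (mom l (fun x => P1 s x * P1 s x) b j) <= C / (1 + INR j) ^ p)
          by (apply Rle_div_r; [lra | apply (HN s Ss)]).
        assert (/ 2 * Rabs (mom l (fun x => P1 s x * P1 s x) b j) <= K) by (unfold K, Rdiv in *; lra).
        assert (0 <= K) by (unfold K; apply Rdiv_le_0_compat; lra).
        nra. }
    assert (HK2 : K / (sg + 1) * (1 + INR j) ^ (S p + 3) <= C / 2 / c).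
    { replace (S p + 3)%nat with (p + 4)%nat by lia. rewrite pow_add. unfold K.
      replace (/ 2 * C / (1 + INR j) ^ p / (sg + 1) * ((1 + INR j) ^ p * (1 + INR j) ^ 4))
        with (C / 2 * ((1 + INR j) ^ 4 / (sg + 1))) by (field; lra).
      unfold Rdiv at 3. apply Rmult_le_compat_l; [lra|].
      apply Rle_div_l; [lra|]. apply Rmult_le_reg_l with c; [lra|].
      rewrite <- Rmult_assoc, Rinv_r by lra. lra. }
    pose proof (H0 b j) as H0'. pose proof (exp_pos t).
    assert (exp t <= exp T).
    { destruct Ht as [_ Ht]. destruct (Req_dec t T) as [->|]; [lra|]. left; apply exp_increasing. lra. }
    apply Rle_trans with ((Rabs (mom l (Phi 0) b j) + K / (sg + 1)) * exp t * (1 + INR j) ^ (S p + 3)).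
    { apply Rmult_le_compat_r; lra. }
    replace ((Rabs (mom l (Phi 0) b j) + K / (sg + 1)) * exp t * (1 + INR j) ^ (S p + 3))
      with ((Rabs (mom l (Phi 0) b j) * (1 + INR j) ^ (S p + 3)
          + K / (sg + 1) * (1 + INR j) ^ (S p + 3)) * exp t) by ring.
    unfold B. apply Rmult_le_compat; try lra.
    apply Rplus_le_le_0_compat; (apply Rmult_le_pos; [|lra]).
    - apply Rabs_pos.
    - apply Rdiv_le_0_compat; [|lra]. unfold K. apply Rdiv_le_0_compat; lra. }
  assert (B0 : 0 <= B) by (eapply dec_nonneg; apply (HB 0 S0)).
  set (w1 := om l 1). assert (Hw1 : 0 < w1) by apply om_S, Hl.
  assert (W4 : 0 < w1 ^ 4) by (apply pow_lt, Hw1). assert (W2 : 0 < w1 ^ 2) by (apply pow_lt, Hw1).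
  exists (B + (4 * w1 ^ 4 + w1 ^ 2) * B + C). split.
  { intros t Ht. apply dec_le with B; [|auto]. nra. }
  intros t Ht b j. rewrite (He t b j Ht).
  pose proof (HB t Ht b j) as h1. pose proof (HN t Ht b j) as h2.
  replace (S p + 3)%nat with (p + 4)%nat in h1 by lia. rewrite pow_add in h1.
  set (u := mom l (Phi t) b j) in *. set (v := mom l (fun x => P1 t x * P1 t x) b j) in *.
  pose proof (w_pow_pos j p) as Hw. set (W := (1 + INR j) ^ p) in *.
  assert (Q : Rabs (4 * om l j ^ 4 - om l j ^ 2) <= (4 * w1 ^ 4 + w1 ^ 2) * (1 + INR j) ^ 4).
  { rewrite (om_lin l j). fold w1. rewrite !Rpow_mult_distr.
    pose proof (pos_INR j) as Hj. set (x := INR j) in *.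
    assert (X4 : 0 <= x ^ 4 <= (1 + x) ^ 4) by (split; [apply pow_le | apply pow_incr]; lra).
    assert (X2 : 0 <= x ^ 2 <= (1 + x) ^ 4).
    { split; [apply pow_le, Hj|]. apply Rle_trans with ((1 + x) ^ 2); [apply pow_incr; lra|].
      apply Rle_pow; [lra | lia]. }
    apply Rabs_le. split; nra. }
  pose proof (w_pow_pos j 4) as Hw4.
  eapply Rle_trans; [apply Rmult_le_compat_r; [lra | apply Rabs_triang]|].
  rewrite !Rabs_mult, Rabs_Ropp, Rabs_Ropp, (Rabs_right (/ 2)) by lra.
  pose proof (Rabs_pos u). pose proof (Rabs_pos v).
  assert (Rabs (4 * om l j ^ 4 - om l j ^ 2) * Rabs u * W <= (4 * w1 ^ 4 + w1 ^ 2) * B).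
  { apply Rle_trans with ((4 * w1 ^ 4 + w1 ^ 2) * (1 + INR j) ^ 4 * Rabs u * W).
    - apply Rmult_le_compat_r; [lra|]. now apply Rmult_le_compat_r.
    - replace ((4 * w1 ^ 4 + w1 ^ 2) * (1 + INR j) ^ 4 * Rabs u * W)
        with ((4 * w1 ^ 4 + w1 ^ 2) * (Rabs u * (W * (1 + INR j) ^ 4))) by ring.
      apply Rmult_le_compat_l; [nra | exact h1]. }
  nra.
Qed.

(** After exponents 7, 10 and 13, the last step also gives 9 for the time derivative; passing from
    Phi to Psi costs one power in each. *)
Lemma ks_regular l m Phi0 Phi Psi T : 0 < l -> 0 < T -> (13 <= m)%nat ->
  Hm_sharp l m Phi0 -> ks_sol l Phi0 Phi -> deta (fun t => 0 <= t) Phi Psi ->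
  exists q q' A,
    (forall t, seg T t -> dec 12 A (q t)) /\ (forall t, seg T t -> dec 8 A (q' t)) /\
    (forall b j t, seg T t -> deriv_within (seg T) (fun s => q s b j) t (q' t b j)) /\
    (forall b j, cont_t (seg T) (fun t => q' t b j)) /\
    (forall t, seg T t -> forall x, Psi t x = FS l (q t) x) /\
    (forall t, q t false O = 0) /\ (forall t, q' t false O = 0).
Proof.
  intros Hl HT Hm H0 Hks HPsi.
  destruct (ks_ode l Phi0 Phi T Hl HT Hks) as (P1 & Pt & c1 & cPt & D1 & Hd & He & A4 & H4).
  destruct Hks as (Hper & Hi & Hc & _).
  assert (I : forall t, seg T t -> 0 <= t) by (unfold seg; intros; lra).
  assert (Hper' : forall t, seg T t -> periodic l (Phi t)) by auto.
  destruct (Hm_sharp_dec l m Phi0 13 Hl Hm H0) as [A0 HA0].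
  assert (HA0' : dec 13 A0 (mom l (Phi 0))).
  { apply dec_ext with (mom l Phi0); [|exact HA0]. intros b j. apply mom_ext. intros x. now rewrite Hi. }
  destruct (ks_step l T 4 A4 A0 Phi P1 Pt) as (A7 & H7 & _); auto; try lia.
  { apply dec_mono with 13%nat; [lia | exact HA0']. }
  destruct (ks_step l T 7 A7 A0 Phi P1 Pt) as (A10 & H10 & _); auto; try lia.
  { apply dec_mono with 13%nat; [lia | exact HA0']. }
  destruct (ks_step l T 10 A10 A0 Phi P1 Pt) as (A13 & H13 & H9); auto; try lia.
  exists (fun t => dz l (mom l (Phi t))), (fun t => dz l (mom l (Pt t))), (om l 1 * A13).
  split; [intros t Ht; apply dec_dz; auto|]. split; [intros t Ht; apply dec_dz; auto|].
  split; [intros b j t Ht; apply deriv_within_scal, Hd, Ht|].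
  split; [intros b j; exact (cont_on_mult (seg T) _ _ (cont_on_const _ (- sg b * om l j))
    (mom_cont l (seg T) Pt (negb b) j Hl cPt))|].
  split.
  - intros t Ht x. rewrite <- (is_derive_unique _ _ _ (deta_derive _ _ _ t HPsi (I t Ht) x)).
    apply is_derive_unique.
    apply (is_derive_ext (FS l (mom l (Phi t)))).
    + intros y. symmetry. apply (fourier_series l (Phi t) A4); auto.
      * apply (cont_on_cts _ _ t Hc). now apply I.
      * apply dec_mono with 4%nat; [lia | auto].
    + apply FS_derive with A4; [exact Hl|]. apply dec_mono with 4%nat; [lia | auto].
  - split; intros t; unfold dz; rewrite om_0; ring.
Qed.

(** * Bounds on the symbols *)

(** Symbols indexed by frequency, since the cosine and the sine of one frequency share them;
    composed with [jidx] they are definitionally those of the statement. *)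
Definition Xj (eps l : R) (j : nat) : R := sqrt (1 + 4 * eps * om l j ^ 2).
Definition bj (eps l : R) (j : nat) : R :=
  let X := Xj eps l j in X ^ 2 + (1 + eps) * X - 1 - eps.
Definition fj (eps l : R) (j : nat) : R :=
  let X := Xj eps l j in / 4 * (X ^ 3 - 3 * X ^ 2 - 4 * (1 + eps) * X + 4 + 4 * eps).
Definition hj (eps l : R) (j : nat) : R :=
  let X := Xj eps l j in / eps * (X ^ 2 + (1 + eps) * X - 2 - eps).
Definition mj (eps l : R) (j : nat) : R :=
  let X := Xj eps l j in / (4 * eps) * (X ^ 3 - 3 * X ^ 2 - 4 * (1 + eps) * X + 6 + 4 * eps).

Lemma bsym_bj eps l k : bsym eps l k = bj eps l (jidx k).
Proof. reflexivity. Qed.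
Lemma fsym_fj eps l k : fsym eps l k = fj eps l (jidx k).
Proof. reflexivity. Qed.
Lemma hsym_hj eps l k : hsym eps l k = hj eps l (jidx k).
Proof. reflexivity. Qed.
Lemma msym_mj eps l k : msym eps l k = mj eps l (jidx k).
Proof. reflexivity. Qed.

Lemma Xj_sqr eps l j : 0 < eps -> Xj eps l j ^ 2 = 1 + 4 * eps * om l j ^ 2.
Proof. intros H. unfold Xj. apply pow2_sqrt. pose proof (pow2_ge_0 (om l j)). nra. Qed.

Lemma Xj_ge_1 eps l j : 0 < eps -> 1 <= Xj eps l j.
Proof.
  intros H. rewrite <- sqrt_1. apply sqrt_le_1_alt. pose proof (pow2_ge_0 (om l j)). nra.
Qed.

Lemma Xj_le eps l j : 0 < l -> 0 < eps <= 1 -> Xj eps l j <= (1 + 2 * om l 1) * (1 + INR j).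
Proof.
  intros Hl H. pose proof (om_le l j Hl). pose proof (om_pos l j Hl). pose proof (om_pos l 1 Hl).
  pose proof (pos_INR j). apply Rle_trans with (1 + 2 * om l j); [|nra].
  apply Rsqr_incr_0_var; [|lra].
  unfold Xj. rewrite Rsqr_sqrt by nra. unfold Rsqr. nra.
Qed.

Lemma Xj_minus_1 eps l j : 0 < eps -> Xj eps l j - 1 <= 2 * eps * om l j ^ 2.
Proof. intros H. pose proof (Xj_ge_1 eps l j H). pose proof (Xj_sqr eps l j H). nra. Qed.

Lemma bj_bounds eps l j : 0 < eps <= 1 -> 1 <= bj eps l j <= 3 * Xj eps l j ^ 2.
Proof. intros H. pose proof (Xj_ge_1 eps l j (proj1 H)). unfold bj. cbv zeta. split; nra. Qed.

Lemma fj_bound eps l j : 0 < eps <= 1 -> Rabs (fj eps l j) <= 3 * Xj eps l j ^ 3.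
Proof.
  intros H. pose proof (Xj_ge_1 eps l j (proj1 H)) as HX. unfold fj. cbv zeta. set (X := Xj eps l j) in *.
  assert (X <= X ^ 2) by nra. assert (X ^ 2 <= X ^ 3) by nra.
  assert (0 <= eps * (X - 1) <= X - 1) by nra.
  apply Rabs_le. split; nra.
Qed.

(** The numerator vanishes at X = 1, and X^2 - 1 and X - 1 are both of size eps y^2, which absorbs
    the factor 1/eps. *)
Lemma hj_bound eps l j : 0 < eps <= 1 -> Rabs (hj eps l j) <= 8 * om l j ^ 2.
Proof.
  intros H. pose proof (Xj_ge_1 eps l j (proj1 H)) as HX. pose proof (Xj_sqr eps l j (proj1 H)) as HS.
  pose proof (Xj_minus_1 eps l j (proj1 H)) as HM. unfold hj. cbv zeta. set (X := Xj eps l j) in *.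
  replace (X ^ 2 + (1 + eps) * X - 2 - eps) with (4 * eps * om l j ^ 2 + (1 + eps) * (X - 1))
    by (rewrite HS; ring).
  rewrite Rabs_right.
  - apply Rmult_le_reg_l with eps; [lra|]. rewrite <- Rmult_assoc, Rinv_r by lra.
    pose proof (pow2_ge_0 (om l j)). nra.
  - apply Rle_ge, Rmult_le_pos; [left; apply Rinv_0_lt_compat; lra|].
    pose proof (pow2_ge_0 (om l j)). nra.
Qed.

(** The root X = 1 of the cubic is factored out; X - 1 is at most 2 eps y^2, which absorbs the
    factor 1/eps. *)
Lemma mj_bound eps l j : 0 < eps <= 1 -> Rabs (mj eps l j) <= 7 * om l j ^ 2 * Xj eps l j ^ 2.
Proof.
  intros H. pose proof (Xj_ge_1 eps l j (proj1 H)) as HX.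
  pose proof (Xj_minus_1 eps l j (proj1 H)) as HM. unfold mj. cbv zeta. set (X := Xj eps l j) in *.
  replace (X ^ 3 - 3 * X ^ 2 - 4 * (1 + eps) * X + 6 + 4 * eps)
    with ((X - 1) * (X ^ 2 - 2 * X - 6 - 4 * eps)) by ring.
  rewrite !Rabs_mult, (Rabs_right (X - 1)), (Rabs_right (/ (4 * eps))) by
    (try (left; apply Rinv_0_lt_compat); lra).
  assert (Q : Rabs (X ^ 2 - 2 * X - 6 - 4 * eps) <= 13 * X ^ 2) by (apply Rabs_le; split; nra).
  pose proof (Rabs_pos (X ^ 2 - 2 * X - 6 - 4 * eps)) as Qp. set (Y := Rabs _) in *.
  apply Rmult_le_reg_l with (4 * eps); [lra|]. rewrite <- Rmult_assoc, Rinv_r, Rmult_1_l by lra.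
  apply Rle_trans with (2 * eps * om l j ^ 2 * (13 * X ^ 2)).
  - apply Rmult_le_compat; lra.
  - assert (0 <= eps * om l j ^ 2 * X ^ 2); [|lra].
    apply Rmult_le_pos; [apply Rmult_le_pos|]; try apply pow2_ge_0; lra.
Qed.

(* The dissipation 4y^4 beats y*f(y) ~ eps^(3/2) y^4 for small eps at high frequency, and the
   exponential weight gamma beats the order-zero part of f at low frequency. *)
Lemma kernel_bound l kap : 0 < l -> 0 < kap -> exists gam eps1, 0 < gam /\ 0 < eps1 <= 1 /\
  forall eps, 0 < eps <= eps1 -> forall j,
    om l j * Rabs (fj eps l j) <= kap * (4 * om l j ^ 4 - om l j ^ 2 + gam * bj eps l j) /\
    1 <= 4 * om l j ^ 4 - om l j ^ 2 + gam * bj eps l j.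
Proof.
  (* [d] splits y into [d * y ^ 4 + / d]: the quartic part, multiplied by 12, is at most
     [kap * y ^ 4]. *)
  intros Hl Hk. set (d := Rmin 1 (kap / 12)).
  assert (Hd : 0 < d <= 1) by (split; [apply Rmin_glb_lt; lra | apply Rmin_l]).
  assert (Hdk : 12 * d <= kap) by (pose proof (Rmin_r 1 (kap / 12)); unfold d; lra).
  assert (Hg : 0 < 12 / (d * kap)) by (apply Rdiv_lt_0_compat; nra).
  (* The first summand, multiplied by [kap], pays for the constant [12 / d]. The 2 offsets the
     negative part of the symbol and keeps the sum at least 1. The 96 makes the term
     [96 * eps * y ^ 4] at most [kap * y ^ 4]. *)
  exists (12 / (d * kap) + 2), (Rmin 1 (kap / 96)).
  split; [lra|]. split; [split; [apply Rmin_glb_lt; lra | apply Rmin_l]|].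
  intros eps He j. pose proof (Rmin_l 1 (kap / 96)). pose proof (Rmin_r 1 (kap / 96)).
  assert (He1 : 0 < eps <= 1) by lra.
  pose proof (bj_bounds eps l j He1) as [Hb _]. pose proof (fj_bound eps l j He1) as Hf.
  pose proof (om_pos l j Hl) as Hy. pose proof (Xj_ge_1 eps l j (proj1 He1)) as HX.
  pose proof (Xj_sqr eps l j (proj1 He1)) as HS.
  set (y := om l j) in *. set (X := Xj eps l j) in *. set (G := 12 / (d * kap)) in *.
  assert (A1 : 3 * y ^ 4 - / 4 + (G + 2) <= 4 * y ^ 4 - y ^ 2 + (G + 2) * bj eps l j).
  { assert (0 <= (y ^ 2 - / 2) ^ 2) by apply pow2_ge_0.
    assert (G + 2 <= (G + 2) * bj eps l j) by nra. nra. }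
  assert (Hy4 : 0 <= y ^ 4) by (apply pow_le, Hy).
  split; [|lra].
  set (s := sqrt eps). assert (Hs : 0 <= s) by apply sqrt_pos.
  assert (Hss : s ^ 2 = eps) by (apply pow2_sqrt; lra).
  assert (Hs1 : s <= 1) by nra.
  assert (HX3 : X ^ 3 <= 4 + 32 * (eps * y ^ 3)).
  { assert (X <= 1 + 2 * (s * y)).
    { apply Rsqr_incr_0_var; [|nra]. unfold Rsqr. rewrite <- Hss in HS. nra. }
    apply Rle_trans with ((1 + 2 * (s * y)) ^ 3); [apply pow_incr; lra|].
    set (w := s * y) in *. assert (0 <= w) by (unfold w; nra).
    assert (w ^ 3 <= eps * y ^ 3).
    { unfold w. rewrite Rpow_mult_distr. apply Rmult_le_compat_r; [apply pow_le, Hy|].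
      rewrite <- Hss. nra. }
    (* Three times this product is [4 + 32 * w ^ 3 - (1 + 2 * w) ^ 3]. *)
    assert (0 <= (1 + 2 * w) * (1 - 2 * w) ^ 2) by (apply Rmult_le_pos; [lra | apply pow2_ge_0]).
    nra. }
  assert (Q : y <= d * y ^ 4 + / d).
  { assert (0 < / d) by (apply Rinv_0_lt_compat; lra).
    destruct (Rle_dec y (/ d)) as [h|h]; [nra|].
    assert (h1 : 1 < d * y).
    { apply Rmult_lt_reg_l with (/ d); [assumption|]. rewrite <- Rmult_assoc, Rinv_l by lra. lra. }
    assert (1 <= y) by nra. assert (1 <= d * y ^ 3) by (simpl; nra). nra. }
  apply Rle_trans with (kap * (3 * y ^ 4 - / 4 + (G + 2))); [|apply Rmult_le_compat_l; lra].
  assert (E : kap * G = 12 / d) by (unfold G; field; lra).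
  apply Rle_trans with (12 * y + 96 * eps * y ^ 4).
  - apply Rle_trans with (y * (3 * X ^ 3)); [now apply Rmult_le_compat_l|].
    apply Rle_trans with (y * (3 * (4 + 32 * (eps * y ^ 3)))); [apply Rmult_le_compat_l; lra|].
    right. ring.
  - assert (96 * eps * y ^ 4 <= kap * y ^ 4) by (apply Rmult_le_compat_r; lra).
    assert (12 * d * y ^ 4 <= kap * y ^ 4) by (apply Rmult_le_compat_r; lra).
    assert (0 <= kap * y ^ 4) by nra. unfold Rdiv in E. nra.
Qed.

(** * Fixed point in the weighted sup norm *)

Lemma exp_ge_1 x : 0 <= x -> 1 <= exp x.
Proof.
  intros H. destruct (Req_dec x 0) as [->|]; [rewrite exp_0; lra|].
  left. rewrite <- exp_0. apply exp_increasing. lra.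
Qed.

Lemma exp_le x y : x <= y -> exp x <= exp y.
Proof.
  intros H. destruct (Req_dec x y) as [->|]; [lra|]. left. apply exp_increasing. lra.
Qed.

Lemma pow2_inv_le n : / 2 ^ n <= / (1 + INR n).
Proof.
  apply Rinv_le_contravar; [pose proof (pos_INR n); lra|].
  induction n as [|n IH]; [simpl; lra|]. rewrite S_INR. simpl. pose proof (pos_INR n). lra.
Qed.

(** [Lim_seq] is total, so the limit of the iterates is defined for all arguments at once. The
    increments telescope to 2 C / 2^n. *)
Lemma geometric_limit (x : nat -> R) C : 
  (forall n, Rabs (x (S n) - x n) <= C / 2 ^ n) ->
  forall n, Rabs (real (Lim_seq x) - x n) <= 2 * C / 2 ^ n.
Proof.
  intros H.
  assert (P2 : forall n, 0 < 2 ^ n) by (intros; apply pow_lt; lra).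
  assert (C0 : 0 <= C).
  { pose proof (H 0%nat) as h. pose proof (Rabs_pos (x 1%nat - x 0%nat)). simpl in h. lra. }
  assert (K : forall n k, Rabs (x (n + k)%nat - x n) <= 2 * C / 2 ^ n - 2 * C / 2 ^ (n + k)).
  { intros n k. induction k as [|k IH].
    - rewrite Nat.add_0_r, !Rminus_diag, Rabs_R0. lra.
    - replace (n + S k)%nat with (S (n + k)) by lia. pose proof (H (n + k)%nat) as h.
      replace (x (S (n + k)) - x n) with ((x (S (n + k)) - x (n + k)%nat) + (x (n + k)%nat - x n)) by ring.
      eapply Rle_trans; [apply Rabs_triang|].
      replace (2 * C / 2 ^ S (n + k)) with (2 * C / 2 ^ (n + k) - C / 2 ^ (n + k))
        by (simpl; field; apply Rgt_not_eq, P2). lra. }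
  assert (K' : forall n k, Rabs (x (n + k)%nat - x n) <= 2 * C / 2 ^ n).
  { intros n k. specialize (K n k). assert (0 <= 2 * C / 2 ^ (n + k)); [|lra].
    apply Rdiv_le_0_compat; [lra | apply P2]. }
  assert (EX : ex_finite_lim_seq x).
  { apply ex_lim_seq_cauchy_corr. intros e.
    destruct (small_tail (4 * C) e (cond_pos e)) as [N HN].
    exists N. intros n m Hn Hm.
    pose proof (K' N (n - N)%nat) as a1. pose proof (K' N (m - N)%nat) as a2.
    replace (N + (n - N))%nat with n in a1 by lia. replace (N + (m - N))%nat with m in a2 by lia.
    assert (2 * C / 2 ^ N <= 2 * C / (1 + INR N)).
    { apply Rmult_le_compat_l; [lra | apply pow2_inv_le]. }
    assert (2 * (2 * C / (1 + INR N)) = 4 * C / (1 + INR N)) by (unfold Rdiv; ring).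
    apply Rabs_le_between in a1. apply Rabs_le_between in a2. apply Rabs_def1; lra. }
  pose proof (Lim_seq_correct' x EX) as HL. intros n.
  assert (HLn : is_lim_seq (fun k => Rabs (x (k + n)%nat - x n)) (Rabs (real (Lim_seq x) - x n))).
  { apply (is_lim_seq_abs (fun k => x (k + n)%nat - x n) (Finite (real (Lim_seq x) - x n))).
    apply is_lim_seq_minus'; [|apply is_lim_seq_const].
    apply (is_lim_seq_incr_n x n). exact HL. }
  apply (is_lim_seq_le (fun k => Rabs (x (k + n)%nat - x n)) (fun _ => 2 * C / 2 ^ n)
    (Rabs (real (Lim_seq x) - x n)) (2 * C / 2 ^ n)); [|exact HLn | apply is_lim_seq_const].
  intros k. rewrite Nat.add_comm. apply K'.
Qed.

Section Mild.

Variables (l T gam : R) (bb : nat -> R).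
Hypothesis Hl : 0 < l.
Hypothesis Hgam : 0 <= gam.
Hypothesis Hb : forall j, 1 <= bb j.

(* [den j = bb j * (arate j + gam)]: what the Duhamel operator gains on the [j]-th coefficient. *)
Definition den (j : nat) : R := 4 * om l j ^ 4 - om l j ^ 2 + gam * bb j.

Hypothesis Hden : forall j, 1 <= den j.

Definition arate (j : nat) : R := (4 * om l j ^ 4 - om l j ^ 2) / bb j.

(** The gain of the weighted linear equation is 1 / ([arate j] + [gam]) = [bb j / den j]; the factor
    [bb j] cancels the division of the source. The end time [S] is free because uniqueness works on
    shorter intervals. *)
Lemma mild_bound S p C (y N : R -> bool -> nat -> R) :
  (forall t b j, seg S t ->
     deriv_within (seg S) (fun s => y s b j) t (- arate j * y t b j + N t b j / bb j)) ->
  (forall b j, y 0 b j = 0) ->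
  (forall t b j, seg S t -> Rabs (N t b j) * (1 + INR j) ^ p <= C * exp (gam * t) * den j) ->
  forall t, seg S t -> dec p (C * exp (gam * t)) (y t).
Proof.
  intros Hy H0 HN t Ht b j.
  pose proof (Hb j) as hb. pose proof (Hden j) as hd. pose proof (w_pow_pos j p) as hw.
  assert (E : arate j + gam = den j / bb j) by (unfold arate, den; field; lra).
  assert (Hp : 0 < den j / bb j) by (apply Rdiv_lt_0_compat; lra).
  assert (Q : Rabs (y t b j) <= (Rabs (y 0 b j) + (C * den j / (1 + INR j) ^ p / bb j) / (arate j + gam))
      * exp (gam * t)).
  { apply (ode_bound S (arate j) gam _ (fun t => y t b j) (fun t => N t b j / bb j)); auto.
    - now rewrite E.
    - intros s Ss. pose proof (HN s b j Ss) as h. rewrite Rabs_div, (Rabs_right (bb j)) by lra.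
      replace (C * den j / (1 + INR j) ^ p / bb j * exp (gam * s))
        with (C * exp (gam * s) * den j / (1 + INR j) ^ p / bb j) by (field; lra).
      apply Rmult_le_compat_r; [left; apply Rinv_0_lt_compat; lra|].
      apply (proj1 (Rle_div_r _ _ ((1 + INR j) ^ p) ltac:(lra))). exact h. }
  rewrite H0, Rabs_R0, E, Rplus_0_l in Q.
  replace (C * den j / (1 + INR j) ^ p / bb j / (den j / bb j)) with (C / (1 + INR j) ^ p) in Q
    by (field; lra).
  apply Rle_trans with (C / (1 + INR j) ^ p * exp (gam * t) * (1 + INR j) ^ p).
  - apply Rmult_le_compat_r; lra.
  - right. field. lra.
Qed.

Variables (kap : R) (ff : nat -> R).
Hypothesis Hker : forall j, om l j * Rabs (ff j) <= kap * den j.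

(** The derivative and the symbol together cost [om l j * Rabs (ff j)], which [Hker] pays out of
    [den j]. The exponent [p] is kept, at the price of the factor [kap]. *)
Lemma mild_gain S p C (y W : R -> bool -> nat -> R) : 
  (forall t b j, seg S t -> deriv_within (seg S) (fun s => y s b j) t
     (- arate j * y t b j + ff j * dz l (W t) b j / bb j)) ->
  (forall b j, y 0 b j = 0) ->
  (forall t, seg S t -> dec p (C * exp (gam * t)) (W t)) ->
  forall t, seg S t -> dec p (kap * C * exp (gam * t)) (y t).
Proof.
  intros Hy H0 HW. apply (mild_bound S p (kap * C) y (fun t b j => ff j * dz l (W t) b j)); auto.
  intros t b j Ht. unfold dz. rewrite !Rabs_mult, abs_sg, Rmult_1_l.
  rewrite (Rabs_right (om l j)) by (apply Rle_ge, om_pos, Hl).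
  pose proof (HW t Ht (negb b) j) as h. pose proof (w_pow_pos j p) as hw.
  pose proof (Rabs_pos (W t (negb b) j)). pose proof (Hker j). pose proof (om_pos l j Hl).
  pose proof (Rabs_pos (ff j)).
  replace (Rabs (ff j) * (om l j * Rabs (W t (negb b) j)) * (1 + INR j) ^ p)
    with (om l j * Rabs (ff j) * (Rabs (W t (negb b) j) * (1 + INR j) ^ p)) by ring.
  replace (kap * C * exp (gam * t) * den j) with (kap * den j * (C * exp (gam * t))) by ring.
  apply Rmult_le_compat; try assumption; apply Rmult_le_pos; lra.
Qed.

Variables (eps P R0 : R) (Psi : R -> R -> R) (g : R -> bool -> nat -> R).
Hypothesis HT : 0 < T.
Hypothesis Heps : 0 < eps.
Hypothesis cPsi : cont_on (seg T) Psi.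
Hypothesis HP : forall t, seg T t -> dec 6 P (mom l (Psi t)).
Hypothesis Hg : forall t, seg T t -> dec 6 R0 (g t).
Hypothesis cg : forall b j, cont_t (seg T) (fun t => g t b j).
Hypothesis Hg0 : forall t, g t false O = 0.
(** The parenthesis bounds the multiplier 2 Psi + eps (y + z) for y and z in the ball of radius 2
    [R0]. Its time weight is replaced by the largest value [exp (gam * T)], so that the weight on
    the difference y - z is preserved. *)
Hypothesis Hsmall : kap * (Cmul l 6 * (2 * P + eps * (4 * R0 * exp (gam * T)))) <= / 2.

Definition quadr (z : R -> bool -> nat -> R) (t : R) : bool -> nat -> R :=
  mom l (fun x => FS l (z t) x * (2 * Psi t x + eps * FS l (z t) x)).

Definition rhs (z : R -> bool -> nat -> R) (t : R) (b : bool) (j : nat) : R :=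
  (ff j * dz l (quadr z t) b j + g t b j) / bb j.

Definition picard (z : R -> bool -> nat -> R) (t : R) (b : bool) (j : nat) : R :=
  duhamel T (arate j) (fun s => rhs z s b j) t.

(** The ball of radius [C] in the time-weighted norm; the last condition keeps the spurious sine
    slot empty, as [FS_mom] asks. *)
Definition admissible (C : R) (z : R -> bool -> nat -> R) : Prop :=
  (forall t, seg T t -> dec 6 (C * exp (gam * t)) (z t)) /\
  (forall b j, cont_t (seg T) (fun t => z t b j)) /\
  (forall t, seg T t -> z t false O = 0).

Lemma admissible_cont C z : 0 <= C -> admissible C z -> cont_on (seg T) (fun t x => FS l (z t) x).
Proof.
  intros HC (H1 & H2 & _). apply (FS_cont_on l (seg T) z (C * exp (gam * T))); auto.
  intros t Ht. apply dec_mono with 6%nat; [lia|]. apply dec_le with (C * exp (gam * t)); [|auto].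
  apply Rmult_le_compat_l; [exact HC|]. apply exp_le. unfold seg in Ht. nra.
Qed.

Lemma rhs_cont C z b j : 0 <= C -> admissible C z -> cont_t (seg T) (fun t => rhs z t b j).
Proof.
  intros HC Hz. pose proof (admissible_cont C z HC Hz) as cz.
  assert (cm : cont_t (seg T) (fun t => quadr z t (negb b) j)).
  { apply (mom_cont l (seg T) (fun t x => FS l (z t) x * (2 * Psi t x + eps * FS l (z t) x))); [exact Hl|].
    auto 10 with cts. }
  unfold cont_t in *.
  apply (cont_on_ext (seg T) (fun t _ => / bb j * (ff j * (- sg b * om l j) * quadr z t (negb b) j + g t b j))).
  - intros t x _. unfold rhs, dz, Rdiv. ring.
  - apply cont_on_mult; [apply cont_on_const|]. apply cont_on_plus; [|apply cg].
    apply cont_on_mult; [apply cont_on_const | exact cm].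
Qed.

Lemma picard_deriv C z b j t : 0 <= C -> admissible C z -> seg T t ->
  deriv_within (seg T) (fun s => picard z s b j) t (- arate j * picard z t b j + rhs z t b j).
Proof.
  intros HC Hz Ht. apply (duhamel_deriv T (arate j) (fun s => rhs z s b j) t); [|exact Ht].
  now apply (rhs_cont C).
Qed.

Lemma picard_cont C z b j : 0 <= C -> admissible C z -> cont_t (seg T) (fun t => picard z t b j).
Proof.
  intros HC Hz. apply limit_cont_t. intros t Ht. eapply deriv_within_cont.
  now apply (picard_deriv C).
Qed.

Lemma picard_false_0 z t : picard z t false O = 0.
Proof.
  unfold picard, duhamel. rewrite (RI_ext _ (fun _ => 0)).
  - rewrite RI_const. ring.
  - intros s. unfold rhs, dz. rewrite om_0, Hg0. unfold Rdiv. ring.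
Qed.

Lemma dec_minus_swap p A y z : dec p A (fun b j => y b j - z b j) -> dec p A (fun b j => z b j - y b j).
Proof. intros H b j. rewrite Rabs_minus_sym. apply H. Qed.

Lemma R0_nonneg : 0 <= R0.
Proof. eapply dec_nonneg. apply (Hg 0). unfold seg. lra. Qed.

(** The difference of the quadratic terms factors as (y - z)(2 Psi + eps (y + z)), so one product
    estimate followed by [mild_gain] suffices. *)
Lemma picard_contraction y z c : admissible (2 * R0) y -> admissible (2 * R0) z ->
  (forall t, seg T t -> dec 6 (c * exp (gam * t)) (fun b j => y t b j - z t b j)) ->
  forall t, seg T t -> dec 6 (c / 2 * exp (gam * t)) (fun b j => picard y t b j - picard z t b j).
Proof.
  intros Hy Hz Hc. pose proof R0_nonneg as r0.
  assert (RR : 0 <= 2 * R0) by lra.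
  set (V := 2 * P + eps * (4 * R0 * exp (gam * T))) in *.
  assert (S0 : seg T 0) by (unfold seg; lra).
  assert (c0 : 0 <= c).
  { pose proof (dec_nonneg _ _ _ (Hc 0 S0)) as h. rewrite Rmult_0_r, exp_0 in h. lra. }
  intros t Ht. apply dec_le with (kap * (Cmul l 6 * c * V) * exp (gam * t)).
  { apply Rmult_le_compat_r; [left; apply exp_pos|].
    replace (kap * (Cmul l 6 * c * V)) with (c * (kap * (Cmul l 6 * V))) by ring.
    unfold Rdiv. now apply Rmult_le_compat_l. }
  revert t Ht.
  apply (mild_gain T 6 _ _ (fun t b j => quadr y t b j - quadr z t b j)).
  - intros t b j Ht.
    pose proof (picard_deriv _ y b j t RR Hy Ht) as d1.
    pose proof (deriv_within_scal _ _ _ _ (-1) (picard_deriv _ z b j t RR Hz Ht)) as d2.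
    pose proof (deriv_within_plus _ _ _ _ _ _ d1 d2) as d3.
    replace (- arate j * (picard y t b j - picard z t b j)
       + ff j * dz l (fun b j => quadr y t b j - quadr z t b j) b j / bb j)
      with (- arate j * picard y t b j + rhs y t b j + -1 * (- arate j * picard z t b j + rhs z t b j))
      by (unfold rhs, dz, Rdiv; ring).
    apply (deriv_within_ext _ _ _ t _ Ht) with (2 := d3). intros s _. ring.
  - intros b j. unfold picard. rewrite !duhamel_0. ring.
  - intros t Ht.
    pose proof (cont_on_cts _ _ t (admissible_cont _ y RR Hy) Ht) as cy.
    pose proof (cont_on_cts _ _ t (admissible_cont _ z RR Hz) Ht) as cz.
    pose proof (cont_on_cts _ _ t cPsi Ht) as cp. cbv beta in cy, cz.
    destruct Hy as (Hy & _ & Hy0). destruct Hz as (Hz & _ & Hz0).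
    specialize (Hy t Ht). specialize (Hz t Ht). specialize (Hc t Ht).
    pose proof (dec_mono 6 2 _ _ ltac:(lia) Hy) as Hy2. pose proof (dec_mono 6 2 _ _ ltac:(lia) Hz) as Hz2.
    pose proof (dec_mono 6 2 _ _ ltac:(lia) Hc) as Hc2.
    set (v := fun x => 2 * Psi t x + eps * (FS l (y t) x + FS l (z t) x)).
    assert (cv : cts v) by (unfold v; auto 10 with cts).
    assert (Hv : dec 6 V (mom l v)).
    { apply dec_ext with (fun b j => 2 * mom l (Psi t) b j + eps * (y t b j + z t b j)).
      - intros b j. unfold v. rewrite mom_plus, !mom_scal, mom_plus by auto with cts.
        now rewrite (FS_mom l (y t) _ b j Hl (Hy0 t Ht) Hy2), (FS_mom l (z t) _ b j Hl (Hz0 t Ht) Hz2).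
      - pose proof (dec_plus _ _ _ _ _ (dec_scal _ _ 2 _ (HP t Ht)) (dec_scal _ _ eps _ (dec_plus _ _ _ _ _ Hy Hz))) as h.
        apply (dec_le _ _ _ _) with (2 := h).
        rewrite !Rabs_right by lra. unfold V.
        assert (exp (gam * t) <= exp (gam * T)) by (apply exp_le; unfold seg in Ht; nra).
        assert (R0 * exp (gam * t) <= R0 * exp (gam * T)) by (apply Rmult_le_compat_l; lra). nra. }
    replace (Cmul l 6 * c * V * exp (gam * t)) with (Cmul l 6 * (c * exp (gam * t)) * V) by ring.
    apply dec_ext with (mom l (fun x => FS l (fun b j => y t b j - z t b j) x * v x)).
    + intros b j. unfold quadr. rewrite <- mom_minus by auto 10 with cts. apply mom_ext. intros x.
      rewrite (FS_ext l _ (fun b j => y t b j + -1 * z t b j)) by (intros; ring).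
      rewrite (FS_plus l (y t) (fun b j => -1 * z t b j) _ _ x Hl Hy2 (dec_scal _ _ (-1) _ Hz2)), FS_scal.
      unfold v. ring.
    + apply mom_FS_mul; auto.
Qed.

Fixpoint iterate (n : nat) : R -> bool -> nat -> R :=
  match n with O => fun _ _ _ => 0 | S n => picard (iterate n) end.

Lemma picard_0_bound t : seg T t -> dec 6 (R0 * exp (gam * t)) (picard (fun _ _ _ => 0) t).
Proof.
  assert (A0 : admissible 0 (fun _ _ _ => 0)).
  { repeat split.
    - intros s _ b j. rewrite Rabs_R0. lra.
    - intros b j. exact (cont_on_const (seg T) 0). }
  intros Ht. pose proof R0_nonneg. revert t Ht. apply (mild_bound T 6 R0 _ g).
  - intros t b j Ht.
    replace (g t b j / bb j) with (rhs (fun _ _ _ => 0) t b j).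
    + now apply (picard_deriv 0); [lra| |].
    + unfold rhs, dz, quadr. rewrite (mom_ext l _ (fun _ => 0 * 0)).
      * rewrite mom_scal by apply cts_const. unfold Rdiv. ring.
      * intros x. rewrite (FS_ext l _ (fun b j => 0 * 0)) by (intros; ring). rewrite FS_scal. ring.
  - intros b j. apply duhamel_0.
  - intros t b j Ht. eapply Rle_trans; [apply (Hg t Ht b j)|].
    assert (1 <= exp (gam * t)) by (apply exp_ge_1; unfold seg in Ht; nra). pose proof (Hden j).
    apply Rle_trans with (R0 * exp (gam * t) * 1); [nra|]. apply Rmult_le_compat_l; nra.
Qed.

(** The radii [2 * R0 * (1 - / 2 ^ n)] are partial sums of the geometric increments. The iterates
    therefore stay in the ball of radius 2 [R0] without a separate proof that the ball is
    invariant. *)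
Lemma iterate_spec n :
  admissible (2 * R0 * (1 - / 2 ^ n)) (iterate n) /\
  admissible (2 * R0 * (1 - / 2 ^ S n)) (iterate (S n)) /\
  forall t, seg T t -> dec 6 (R0 / 2 ^ n * exp (gam * t)) (fun b j => iterate (S n) t b j - iterate n t b j).
Proof.
  pose proof R0_nonneg as r0.
  assert (Hp : forall n, 0 < / 2 ^ n <= 1).
  { intros k. assert (1 <= 2 ^ k) by (apply pow_R1_Rle; lra). split; [apply Rinv_0_lt_compat; lra|].
    rewrite <- Rinv_1. apply Rinv_le_contravar; lra. }
  assert (up : forall n z, admissible (2 * R0 * (1 - / 2 ^ n)) z -> admissible (2 * R0) z).
  { intros k z (H1 & H2 & H3). repeat split; auto. intros t Ht.
    apply (dec_le _ _ _ _) with (2 := H1 t Ht). apply Rmult_le_compat_r; [left; apply exp_pos|].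
    pose proof (Hp k). nra. }
  assert (step : forall n z, admissible (2 * R0 * (1 - / 2 ^ n)) z ->
     (forall t, seg T t -> dec 6 (R0 / 2 ^ n * exp (gam * t)) (fun b j => picard z t b j - z t b j)) ->
     admissible (2 * R0 * (1 - / 2 ^ S n)) (picard z)).
  { intros k z Hz Hd. repeat split.
    - intros t Ht. destruct Hz as (Hz & _). pose proof (dec_plus _ _ _ _ _ (Hz t Ht) (Hd t Ht)) as h.
      apply dec_ext with (fun b j => z t b j + (picard z t b j - z t b j)); [intros; ring|].
      apply (dec_le _ _ _ _) with (2 := h). right. simpl. field. apply pow_nonzero. lra.
    - intros b j. apply (picard_cont (2 * R0)); [lra | now apply (up k)].
    - intros t _. apply picard_false_0. }
  induction n as [|n (I1 & I2 & I3)].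
  - assert (A0 : admissible (2 * R0 * (1 - / 2 ^ 0)) (iterate 0)).
    { repeat split.
      - intros s _ b j. simpl. rewrite Rabs_R0. lra.
      - intros b j. exact (cont_on_const (seg T) 0). }
    assert (D0 : forall t, seg T t -> dec 6 (R0 / 2 ^ 0 * exp (gam * t))
         (fun b j => iterate 1 t b j - iterate 0 t b j)).
    { intros t Ht. apply dec_ext with (picard (fun _ _ _ => 0) t); [intros; simpl; ring|].
      apply dec_le with (R0 * exp (gam * t)); [right; simpl; field | now apply picard_0_bound]. }
    split; [exact A0|]. split; [|exact D0]. apply (step 0%nat (iterate 0) A0 D0).
  - assert (D : forall t, seg T t -> dec 6 (R0 / 2 ^ S n * exp (gam * t))
         (fun b j => iterate (S (S n)) t b j - iterate (S n) t b j)).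
    { intros t Ht. apply dec_le with (R0 / 2 ^ n / 2 * exp (gam * t)).
      - right. simpl. field. apply pow_nonzero. lra.
      - apply (picard_contraction (iterate (S n)) (iterate n)); auto; eapply up; eassumption. }
    split; [exact I2|]. split; [|exact D]. apply (step (S n) (iterate (S n)) I2 D).
Qed.

Lemma mild_solution : exists z : R -> bool -> nat -> R,
  (forall t, seg T t -> dec 6 (2 * R0 * exp (gam * t)) (z t)) /\
  (forall b j, cont_t (seg T) (fun t => z t b j)) /\
  (forall t, seg T t -> z t false O = 0) /\ (forall b j, z 0 b j = 0) /\
  forall t b j, seg T t ->
    deriv_within (seg T) (fun s => z s b j) t (- arate j * z t b j + rhs z t b j).
Proof.
  pose proof R0_nonneg as r0.
  set (z := fun t b j => real (Lim_seq (fun n => iterate n t b j))).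
  assert (Hz : forall n t, seg T t ->
     dec 6 (2 * R0 / 2 ^ n * exp (gam * t)) (fun b j => z t b j - iterate n t b j)).
  { intros n t Ht b j. pose proof (w_pow_pos j 6) as hw.
    assert (G : Rabs (z t b j - iterate n t b j) <= 2 * (R0 * exp (gam * t) / (1 + INR j) ^ 6) / 2 ^ n).
    { apply (geometric_limit (fun n => iterate n t b j)). intros k.
      replace (R0 * exp (gam * t) / (1 + INR j) ^ 6 / 2 ^ k)
        with (R0 / 2 ^ k * exp (gam * t) / (1 + INR j) ^ 6)
        by (pose proof (one_le_w j); field; split; [lra | apply pow_nonzero; lra]).
      apply (proj1 (Rle_div_r _ _ ((1 + INR j) ^ 6) ltac:(lra))).
      apply (proj2 (proj2 (iterate_spec k)) t Ht b j). }
    apply Rle_trans with (2 * (R0 * exp (gam * t) / (1 + INR j) ^ 6) / 2 ^ n * (1 + INR j) ^ 6).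
    - apply Rmult_le_compat_r; lra.
    - pose proof (one_le_w j). right. field. split; [apply pow_nonzero; lra | lra]. }
  assert (Hadm : forall n, admissible (2 * R0) (iterate n)).
  { intros n. destruct (proj1 (iterate_spec n)) as (H1 & H2 & H3). repeat split; auto. intros t Ht.
    apply (dec_le _ _ _ _) with (2 := H1 t Ht). apply Rmult_le_compat_r; [left; apply exp_pos|].
    assert (0 < / 2 ^ n) by (apply Rinv_0_lt_compat, pow_lt; lra). nra. }
  assert (Az : admissible (2 * R0) z).
  { split; [|split].
    - intros t Ht. apply dec_ext with (fun b j => z t b j - iterate 0 t b j); [intros; simpl; ring|].
      apply dec_le with (2 * R0 / 2 ^ 0 * exp (gam * t)); [right; simpl; field | now apply Hz].
    (* A uniform limit of continuous coefficients, by an e/3 argument. *)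
    - intros b j t x Ht e He.
      destruct (small_tail (2 * R0 * exp (gam * T)) (e / 3)) as [N HN]; [lra|].
      destruct (proj1 (proj2 (Hadm N)) b j t x Ht (e / 3)) as (d & Hd & K); [lra|].
      exists d. split; [exact Hd|]. intros s y Ds B1 B2. specialize (K s y Ds B1 B2). cbv beta in *.
      assert (U : forall r, seg T r -> Rabs (z r b j - iterate N r b j) < e / 3).
      { intros r Hr. eapply Rle_lt_trans; [|exact HN].
        pose proof (Hz N r Hr b j) as h. pose proof (w_pow_pos j 6).
        pose proof (Rabs_pos (z r b j - iterate N r b j)).
        apply Rle_trans with (2 * R0 / 2 ^ N * exp (gam * r)); [nra|].
        replace (2 * R0 * exp (gam * T) / (1 + INR N)) with (2 * R0 / (1 + INR N) * exp (gam * T))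
          by (unfold Rdiv; ring).
        pose proof (pow2_inv_le N). apply Rmult_le_compat.
        - apply Rdiv_le_0_compat; [lra | apply pow_lt; lra].
        - left; apply exp_pos.
        - apply Rmult_le_compat_l; lra.
        - apply exp_le. unfold seg in Hr. nra. }
      pose proof (U t Ht) as u1. pose proof (U s Ds) as u2.
      apply Rabs_def2 in u1. apply Rabs_def2 in u2. apply Rabs_def2 in K. apply Rabs_def1; lra.
    - intros t Ht. apply (eq_of_tail _ _ (2 * R0 * exp (gam * t)) 0). intros N _.
      pose proof (Hz N t Ht false O) as h. cbv beta in h.
      rewrite (proj2 (proj2 (Hadm N)) t Ht) in h. pose proof (w_pow_pos 0 6).
      pose proof (Rabs_pos (z t false O - 0)). pose proof (pow2_inv_le N). pose proof (exp_pos (gam * t)).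
      apply Rle_trans with (2 * R0 / 2 ^ N * exp (gam * t)); [nra|].
      unfold Rdiv. rewrite (Rmult_assoc (2 * R0)), (Rmult_assoc (2 * R0)), (Rmult_comm (/ 2 ^ N)).
      apply Rmult_le_compat_l; [lra|]. apply Rmult_le_compat_l; lra. }
  (* In the weighted norm [z] and [picard z] both lie within [R0 / 2 ^ N] of the iterate of index
     [S N]. *)
  assert (FP : forall t b j, seg T t -> z t b j = picard z t b j).
  { intros t b j Ht. apply (eq_of_tail _ _ (4 * R0 * exp (gam * t)) 0). intros N _.
    pose proof (Hz (S N) t Ht b j) as h1.
    pose proof (picard_contraction z (iterate N) (2 * R0 / 2 ^ N) Az (Hadm N) (fun t Ht => Hz N t Ht) t Ht b j) as h2.
    cbv beta in h1, h2. change (iterate (S N)) with (picard (iterate N)) in h1.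
    pose proof (w_pow_pos j 6) as hw. pose proof (pow2_inv_le N) as hN. pose proof (exp_pos (gam * t)) as he.
    set (u := z t b j) in *. set (v := picard z t b j) in *. set (w := picard (iterate N) t b j) in *.
    assert (h3 : Rabs (u - v) <= Rabs (u - w) + Rabs (v - w)).
    { replace (u - v) with ((u - w) + - (v - w)) by ring. rewrite <- (Rabs_Ropp (v - w)). apply Rabs_triang. }
    pose proof (Rabs_pos (u - w)). pose proof (Rabs_pos (v - w)).
    assert (k1 : Rabs (u - w) <= R0 / 2 ^ N * exp (gam * t)).
    { replace (2 * R0 / 2 ^ S N) with (R0 / 2 ^ N) in h1 by (simpl; field; apply pow_nonzero; lra). nra. }
    assert (k2 : Rabs (v - w) <= R0 / 2 ^ N * exp (gam * t)).
    { replace (2 * R0 / 2 ^ N / 2) with (R0 / 2 ^ N) in h2 by (field; apply pow_nonzero; lra). nra. }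
    apply Rle_trans with (2 * R0 * exp (gam * t) * / 2 ^ N); [unfold Rdiv in *; lra|].
    assert (0 <= R0 * exp (gam * t)) by (apply Rmult_le_pos; lra).
    assert (0 < / 2 ^ N) by (apply Rinv_0_lt_compat, pow_lt; lra).
    unfold Rdiv. nra. }
  exists z. destruct Az as (A1 & A2 & A3). repeat split; auto.
  - intros b j. rewrite FP by (unfold seg; lra). apply duhamel_0.
  - intros t b j Ht. rewrite (FP t b j Ht).
    apply (deriv_within_ext _ (fun s => picard z s b j)); [exact Ht | intros s Hs; symmetry; now apply FP |].
    apply (picard_deriv (2 * R0)); [lra | repeat split; auto | exact Ht].
Qed.

End Mild.

(** * Uniqueness of classical solutions *)

(** Positivity of [T] makes every point of the segment, endpoints included, an accumulation
    point. *)
Lemma deriv_within_seg_unique T f t a b : 0 < T -> seg T t ->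
  deriv_within (seg T) f t a -> deriv_within (seg T) f t b -> a = b.
Proof.
  intros HT Ht Ha Hb. apply (single_limit _ _ _ _ t) with (2 := Ha) (3 := Hb).
  intros e He. unfold seg in *. simpl. unfold Rdist.
  destruct (Rlt_dec t T) as [h|h].
  - exists (Rmin T (t + e / 2)). pose proof (Rmin_l T (t + e / 2)). pose proof (Rmin_r T (t + e / 2)).
    assert (t < Rmin T (t + e / 2)) by (apply Rmin_glb_lt; lra).
    repeat split; try lra. apply Rabs_def1; lra.
  - exists (Rmax 0 (t - e / 2)). pose proof (Rmax_l 0 (t - e / 2)). pose proof (Rmax_r 0 (t - e / 2)).
    assert (Rmax 0 (t - e / 2) < t) by (apply Rmax_lub_lt; lra).
    repeat split; try lra. apply Rabs_def1; lra.
Qed.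

(** Coefficients of the terms free of zeta, -H(Psi_tau) + M((Psi^2)_eta). *)
Definition forcing (l eps : R) (Psi : R -> R -> R) (dq : R -> bool -> nat -> R)
    (t : R) (b : bool) (j : nat) : R :=
  - hj eps l j * dq t b j + mj eps l j * dz l (mom l (fun x => Psi t x ^ 2)) b j.

(** The moments of [zeta] are differentiated through [Bz], whose time derivative is the one in the
    equation, and then divided by [bj]. The continuous second derivative is returned because it
    provides the quadratic decay used for uniqueness. *)
Lemma sol_moments l eps T Psi zeta dq : 0 < l -> 0 < T -> 0 < eps <= 1 ->
  cont_on (seg T) Psi -> (forall t, seg T t -> periodic l (Psi t)) ->
  (forall b j t, seg T t -> deriv_within (seg T) (fun s => mom l (Psi s) b j) t (dq t b j)) ->
  zeta_sol l eps T Psi zeta ->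
  cont_on (seg T) zeta /\ (forall t, seg T t -> periodic l (zeta t)) /\ (forall x, zeta 0 x = 0) /\
  (exists z2, cont_on (seg T) z2 /\
     forall t b j, seg T t -> mom l (z2 t) b j = - om l j ^ 2 * mom l (zeta t) b j) /\
  forall t b j, seg T t -> deriv_within (seg T) (fun s => mom l (zeta s) b j) t
    (- arate l (bj eps l) j * mom l (zeta t) b j
     + (fj eps l j * dz l (mom l (fun x => zeta t x * (2 * Psi t x + eps * zeta t x))) b j
        + forcing l eps Psi dq t b j) / bj eps l j).
Proof.
  intros Hl HT He cPsi pPsi Hdq (Hper & H0 & cz & zt & z1 & z2 & z3 & z4 & Bz & Bzt & Psit & HPt & P2d & MP2
    & Z2d & FZ2 & PZd & FPZ & _ & _ & D1 & D2 & D3 & D4 & c1 & c2 & c3 & c4 & rB & cB & dB & cBt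
    & dPsi & cPsit & rH & cH & dP2 & cP2 & rM & cM & dZ2 & cZ2 & rF & cF & dPZ & cPZ & rFP & cFP & Heq).
  change (fun t => 0 <= t <= T) with (seg T) in *.
  assert (M : forall t b j, seg T t ->
     mom l (z2 t) b j = - om l j ^ 2 * mom l (zeta t) b j /\
     mom l (z4 t) b j = om l j ^ 4 * mom l (zeta t) b j).
  { intros t b j Ht.
    pose proof (deta_derive _ _ _ t D1 Ht) as d1. pose proof (deta_derive _ _ _ t D2 Ht) as d2.
    pose proof (deta_derive _ _ _ t D3 Ht) as d3. pose proof (deta_derive _ _ _ t D4 Ht) as d4.
    pose proof (Hper t Ht) as p0. pose proof (deriv_periodic _ _ _ p0 d1) as p1.
    pose proof (deriv_periodic _ _ _ p1 d2) as p2. pose proof (deriv_periodic _ _ _ p2 d3) as p3.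
    assert (E2 : forall b j, mom l (z2 t) b j = - om l j ^ 2 * mom l (zeta t) b j).
    { intros b' j'. rewrite (mom_derive l (z1 t) (z2 t)) by first [assumption | eapply cont_on_cts; eassumption].
      rewrite (mom_derive l (zeta t) (z1 t)) by first [assumption | eapply cont_on_cts; eassumption].
      apply dz_dz. }
    split; [apply E2|].
    rewrite (mom_derive l (z3 t) (z4 t)) by first [assumption | eapply cont_on_cts; eassumption].
    rewrite (mom_derive l (z2 t) (z3 t)) by first [assumption | eapply cont_on_cts; eassumption].
    rewrite E2. destruct b; simpl; ring. }
  split; [exact cz|]. split; [exact Hper|]. split; [exact H0|].
  split; [exists z2; split; [exact c2 | intros t b j Ht; apply (M t b j Ht)]|].
  intros t b j Ht.
  pose proof (bj_bounds eps l j He) as [Hb _].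
  assert (EB : forall s, seg T s -> mom l (Bz s) b j = bj eps l j * mom l (zeta s) b j).
  { intros s Hs. apply (realizes_mom l (seg T) (bsym eps l) (bj eps l) zeta Bz); auto. }
  pose proof (mom_deriv T l Bz Bzt b j t Hl Ht cB cBt dB) as dBm.
  apply (deriv_within_scal _ _ _ _ (/ bj eps l j)) in dBm.
  apply (deriv_within_ext _ _ (fun s => mom l (zeta s) b j) _ _ Ht) in dBm.
  2:{ intros s Hs. rewrite EB by exact Hs. field. lra. }
  replace (- arate l (bj eps l) j * mom l (zeta t) b j + _) with (/ bj eps l j * mom l (Bzt t) b j);
    [exact dBm|].
  pose proof (cont_on_cts _ _ t cz Ht) as kz. pose proof (cont_on_cts _ _ t cPsi Ht) as kp.
  pose proof (cont_on_cts _ _ t c2 Ht) as k2. pose proof (cont_on_cts _ _ t c4 Ht) as k4.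
  pose proof (cont_on_cts _ _ t cH Ht) as kH. pose proof (cont_on_cts _ _ t cM Ht) as kM.
  pose proof (cont_on_cts _ _ t cF Ht) as kF. pose proof (cont_on_cts _ _ t cFP Ht) as kFP.
  destruct (M t b j Ht) as [M2 M4].
  (* [Psit] is only known to be some time derivative of [Psi]; uniqueness of derivatives identifies
     its moments with [dq]. *)
  assert (EH : mom l (HPt t) b j = hj eps l j * dq t b j).
  { rewrite (realizes_mom l (seg T) (hsym eps l) (hj eps l) Psit HPt t b j) by auto. f_equal.
    apply (deriv_within_seg_unique T (fun s => mom l (Psi s) b j) t); auto.
    now apply mom_deriv. }
  assert (pP : periodic l (fun y => Psi t y ^ 2)) by (intros x; now rewrite (pPsi t Ht)).
  assert (pZ : periodic l (fun y => zeta t y ^ 2)) by (intros x; now rewrite (Hper t Ht)).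
  assert (pPZ : periodic l (fun y => Psi t y * zeta t y)) by (intros x; now rewrite (pPsi t Ht), (Hper t Ht)).
  assert (EM : mom l (MP2 t) b j = mj eps l j * dz l (mom l (fun x => Psi t x ^ 2)) b j).
  { rewrite (realizes_mom l (seg T) (msym eps l) (mj eps l) P2d MP2 t b j) by auto. f_equal.
    apply (mom_derive l (fun x => Psi t x ^ 2)); auto.
    - apply (deta_derive _ (fun t y => Psi t y ^ 2) _ t dP2 Ht).
    - apply (cont_on_cts _ _ t cP2 Ht). }
  assert (EF : mom l (FZ2 t) b j = fj eps l j * dz l (mom l (fun x => zeta t x ^ 2)) b j).
  { rewrite (realizes_mom l (seg T) (fsym eps l) (fj eps l) Z2d FZ2 t b j) by auto. f_equal.
    apply (mom_derive l (fun x => zeta t x ^ 2)); auto.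
    - apply (deta_derive _ (fun t y => zeta t y ^ 2) _ t dZ2 Ht).
    - apply (cont_on_cts _ _ t cZ2 Ht). }
  assert (EFP : mom l (FPZ t) b j = fj eps l j * dz l (mom l (fun x => Psi t x * zeta t x)) b j).
  { rewrite (realizes_mom l (seg T) (fsym eps l) (fj eps l) PZd FPZ t b j) by auto. f_equal.
    apply (mom_derive l (fun x => Psi t x * zeta t x)); auto.
    - apply (deta_derive _ (fun t y => Psi t y * zeta t y) _ t dPZ Ht).
    - apply (cont_on_cts _ _ t cPZ Ht). }
  rewrite (mom_ext l (Bzt t) (fun x => -1 * HPt t x + (-4 * z4 t x + (-1 * z2 t x
     + (MP2 t x + (eps * FZ2 t x + 2 * FPZ t x)))))).
  2:{ intros x. specialize (Heq t x Ht). lra. }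
  rewrite !mom_plus, !mom_scal, EH, M4, M2, EM, EF, EFP by auto 10 with cts.
  unfold dz, forcing, dz.
  rewrite (mom_ext l (fun x => zeta t x * (2 * Psi t x + eps * zeta t x))
     (fun x => 2 * (Psi t x * zeta t x) + eps * zeta t x ^ 2)) by (intros; ring).
  rewrite mom_plus, !mom_scal by auto with cts.
  unfold arate. field. lra.
Qed.

(** No bound on zeta' is known beforehand. As long as its norm stays below [R + 1] the contraction
    forces equality with [zeta], whose norm is at most [R]; the gap of 1 and continuity in time
    allow the interval to be prolonged. *)
Lemma sol_unique l eps T gam kap Psi zeta zeta' dq P R : 0 < l -> 0 < T -> 0 < eps <= 1 -> 0 <= gam ->
  (forall j, 1 <= den l gam (bj eps l) j) ->
  (forall j, om l j * Rabs (fj eps l j) <= kap * den l gam (bj eps l) j) ->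
  cont_on (seg T) Psi -> (forall t, seg T t -> periodic l (Psi t)) ->
  (forall b j t, seg T t -> deriv_within (seg T) (fun s => mom l (Psi s) b j) t (dq t b j)) ->
  (forall t, seg T t -> dec 2 P (mom l (Psi t))) ->
  (forall t, seg T t -> dec 2 R (mom l (zeta t))) ->
  kap * (Cmul l 2 * (2 * P + eps * (2 * R + 1))) <= / 2 ->
  zeta_sol l eps T Psi zeta -> zeta_sol l eps T Psi zeta' ->
  forall t x, seg T t -> zeta' t x = zeta t x.
Proof.
  intros Hl HT He Hgam Hden Hker cPsi pPsi Hdq HP HR Hsmall Hz Hz'.
  destruct (sol_moments l eps T Psi zeta dq) as (cz & pz & z0 & _ & ode); auto.
  destruct (sol_moments l eps T Psi zeta' dq) as (cz' & pz' & z0' & (z2 & c2 & E2) & ode'); auto.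
  assert (S0 : seg T 0) by (unfold seg; lra).
  assert (R0 : 0 <= R) by (eapply dec_nonneg; apply (HR 0 S0)).
  assert (P0 : 0 <= P) by (eapply dec_nonneg; apply (HP 0 S0)).
  pose proof (Cmul_pos l 2 Hl) as HC.
  assert (Hb : forall j, 1 <= bj eps l j) by (intros j; apply (bj_bounds eps l j He)).
  assert (M0 : forall b j, mom l (zeta' 0) b j = mom l (zeta 0) b j).
  { intros b j. apply mom_ext. intros x. now rewrite z0, z0'. }
  assert (loc : forall S, seg T S -> (forall t, seg S t -> dec 2 (R + 1) (mom l (zeta' t))) ->
     forall t b j, seg S t -> mom l (zeta' t) b j = mom l (zeta t) b j).
  { intros S HS HR'.
    assert (IS : forall t, seg S t -> seg T t) by (unfold seg in *; intros; lra).
    set (del := fun t b j => mom l (zeta' t) b j - mom l (zeta t) b j).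
    assert (gain : forall c, 0 <= c -> (forall t, seg S t -> dec 2 (c * exp (gam * t)) (del t)) ->
       forall t, seg S t -> dec 2 (c / 2 * exp (gam * t)) (del t)).
    { intros c Hc Hd. set (V := 2 * P + eps * (2 * R + 1)) in *.
      intros t Ht. apply dec_le with (kap * (Cmul l 2 * c * V) * exp (gam * t)).
      { apply Rmult_le_compat_r; [left; apply exp_pos|].
        replace (kap * (Cmul l 2 * c * V)) with (c * (kap * (Cmul l 2 * V))) by ring.
        unfold Rdiv. now apply Rmult_le_compat_l. }
      revert t Ht.
      apply (mild_gain l gam (bj eps l) Hl Hb Hden kap (fj eps l) Hker S 2 _ del
        (fun t b j => mom l (fun x => zeta' t x * (2 * Psi t x + eps * zeta' t x)) b j
                    - mom l (fun x => zeta t x * (2 * Psi t x + eps * zeta t x)) b j)).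
      - intros t b j Ht. specialize (IS t Ht) as Ht'.
        pose proof (deriv_within_plus _ _ _ _ _ _ (ode' t b j Ht')
          (deriv_within_scal _ _ _ _ (-1) (ode t b j Ht'))) as d3.
        apply (deriv_within_mono _ _ _ _ _ IS) in d3.
        apply (deriv_within_ext _ _ (fun s => del s b j) _ _ Ht) in d3; [|intros s _; unfold del; ring].
        eapply eq_ind; [exact d3|]. unfold del, dz, Rdiv. ring.
      - intros b j. unfold del. rewrite M0. ring.
      - intros t Ht. specialize (IS t Ht) as Ht'.
        pose proof (cont_on_cts _ _ t cz Ht') as kz. pose proof (cont_on_cts _ _ t cz' Ht') as kz'.
        pose proof (cont_on_cts _ _ t cPsi Ht') as kp.
        set (v := fun x => 2 * Psi t x + eps * (zeta t x + zeta' t x)).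
        assert (kv : cts v) by (unfold v; auto 10 with cts).
        assert (Hv : dec 2 V (mom l v)).
        { apply dec_ext with (fun b j => 2 * mom l (Psi t) b j + eps * (mom l (zeta t) b j + mom l (zeta' t) b j)).
          - intros b j. unfold v. rewrite mom_plus, !mom_scal, mom_plus by auto with cts. reflexivity.
          - pose proof (dec_plus _ _ _ _ _ (dec_scal _ _ 2 _ (HP t Ht'))
              (dec_scal _ _ eps _ (dec_plus _ _ _ _ _ (HR t Ht') (HR' t Ht)))) as h.
            apply (dec_le _ _ _ _) with (2 := h). rewrite !Rabs_right by lra. unfold V. lra. }
        replace (Cmul l 2 * c * V * exp (gam * t)) with (Cmul l 2 * (c * exp (gam * t)) * V) by ring.
        apply dec_ext with (mom l (fun x => FS l (del t) x * v x)).
        + intros b j. rewrite <- mom_minus by auto 10 with cts. apply mom_ext. intros x.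
          assert (E : FS l (del t) x = zeta' t x - zeta t x).
          { rewrite (fourier_series l (zeta' t) _ Hl kz' (pz' t Ht') (HR' t Ht) x).
            rewrite (fourier_series l (zeta t) _ Hl kz (pz t Ht') (HR t Ht') x).
            rewrite (FS_ext l (del t) (fun b j => mom l (zeta' t) b j + -1 * mom l (zeta t) b j))
              by (intros; unfold del; ring).
            rewrite (FS_plus l _ _ _ _ x Hl (HR' t Ht) (dec_scal _ _ (-1) _ (HR t Ht'))), FS_scal. ring. }
          rewrite E. unfold v. ring.
        + apply mom_FS_mul; auto. }
    (* The crude bound [2 * R + 1] on the difference is halved indefinitely, so the difference
       vanishes. *)
    assert (halve : forall n t, seg S t -> dec 2 ((2 * R + 1) / 2 ^ n * exp (gam * t)) (del t)).
    { induction n as [|n IH]; intros t Ht.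
      - pose proof (dec_plus _ _ _ _ _ (HR' t Ht) (dec_scal _ _ (-1) _ (HR t (IS t Ht)))) as h.
        apply dec_ext with (z := del t) in h; [|intros b j; unfold del; ring].
        apply (dec_le _ _ _ _) with (2 := h).
        replace (Rabs (-1)) with 1 by (rewrite Rabs_left; lra).
        assert (1 <= exp (gam * t)) by (apply exp_ge_1; unfold seg in Ht; nra). simpl. nra.
      - apply dec_le with ((2 * R + 1) / 2 ^ n / 2 * exp (gam * t)).
        + right. simpl. field. apply pow_nonzero. lra.
        + apply gain; auto. apply Rdiv_le_0_compat; [lra | apply pow_lt; lra]. }
    intros t b j Ht. apply (eq_of_tail _ _ ((2 * R + 1) * exp (gam * t)) 0). intros n _.
    pose proof (halve n t Ht b j) as h. unfold del in h. pose proof (w_pow_pos j 2).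
    pose proof (Rabs_pos (mom l (zeta' t) b j - mom l (zeta t) b j)).
    apply Rle_trans with ((2 * R + 1) / 2 ^ n * exp (gam * t)); [nra|].
    pose proof (pow2_inv_le n). pose proof (exp_pos (gam * t)). unfold Rdiv.
    replace ((2 * R + 1) * / 2 ^ n * exp (gam * t)) with ((2 * R + 1) * exp (gam * t) * / 2 ^ n) by ring.
    apply Rmult_le_compat_l; [nra | assumption]. }
  (* The moments of zeta' move continuously in the weighted norm with p = 2, so an interval of
     coincidence can be prolonged while zeta' stays in the ball where [loc] applies. *)
  pose proof (om_S l 0 Hl) as Ho. assert (Ho2 : 0 < om l 1 ^ 2) by (apply pow_lt, Ho).
  assert (equi : forall S, seg T S -> exists d, 0 < d /\ forall t, seg T t -> Rabs (t - S) < d ->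
     dec 2 (/ 2) (fun b j => mom l (zeta' t) b j - mom l (zeta' S) b j)).
  (* Calibrated so that [dec2_of] returns exactly 1/2. *)
  { intros S HS. set (e := / (4 * l * (1 + / om l 1 ^ 2))).
    assert (Hi : 0 < / om l 1 ^ 2) by (apply Rinv_0_lt_compat, Ho2).
    assert (Hep : 0 < e) by (apply Rinv_0_lt_compat; nra).
    destruct (cont_on_unif _ _ S (- (l / 2)) (l / 2) e cz' HS Hep) as (d1 & Hd1 & K1).
    destruct (cont_on_unif _ _ S (- (l / 2)) (l / 2) e c2 HS Hep) as (d2 & Hd2 & K2).
    exists (Rmin d1 d2). split; [now apply Rmin_glb_lt|]. intros t Ht Hd.
    pose proof (Rmin_l d1 d2). pose proof (Rmin_r d1 d2).
    pose proof (cont_on_cts _ _ t cz' Ht) as k1. pose proof (cont_on_cts _ _ S cz' HS) as k2.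
    pose proof (cont_on_cts _ _ t c2 Ht) as k3. pose proof (cont_on_cts _ _ S c2 HS) as k4.
    replace (/ 2) with (2 * (l * e + l * e / om l 1 ^ 2)) by (unfold e; field; repeat split; nra).
    apply dec2_of; [exact Hl | |].
    - intros b j. rewrite <- mom_minus by assumption. apply mom_bound; [exact Hl | auto with cts |].
      intros x Hx. left. apply K1; auto; lra.
    - intros b j. rewrite <- (Rabs_right (om l j ^ 2)) by (apply Rle_ge, pow2_ge_0).
      rewrite <- Rabs_mult, <- Rabs_Ropp.
      replace (- (om l j ^ 2 * (mom l (zeta' t) b j - mom l (zeta' S) b j)))
        with (mom l (z2 t) b j - mom l (z2 S) b j) by (rewrite !E2 by assumption; ring).
      rewrite <- mom_minus by assumption. apply mom_bound; [exact Hl | auto with cts |].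
      intros x Hx. left. apply K2; auto; lra. }
  (* Coincidence is asked on the half-open interval, so the supremum of [E] belongs to [E]. *)
  set (E := fun S => seg T S /\ forall t b j, 0 <= t < S -> mom l (zeta' t) b j = mom l (zeta t) b j).
  assert (extend : forall S, E S -> exists d, 0 < d /\ forall t b j, seg T t -> t < S + d ->
     mom l (zeta' t) b j = mom l (zeta t) b j).
  { intros S [HS HE]. destruct (equi S HS) as (d & Hd & K). exists d. split; [exact Hd|].
    (* For S > 0, zeta' at [S] is within 1/2 of its value at an earlier time, where it equals
       [zeta]. A second 1/2 covers times after [S] and exhausts the radius [R + 1]. *)
    assert (HRS : dec 2 (R + / 2) (mom l (zeta' S))).
    { destruct (Rle_lt_dec S 0) as [h|h].
      - assert (S = 0) by (unfold seg in HS; lra). subst S.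
        apply dec_ext with (mom l (zeta 0)); [intros; now rewrite M0|].
        apply dec_le with R; [lra | auto].
      - set (s := Rmax 0 (S - d / 2)).
        assert (Hs : 0 <= s < S /\ S - d / 2 <= s).
        { pose proof (Rmax_l 0 (S - d / 2)). pose proof (Rmax_r 0 (S - d / 2)).
          assert (s < S) by (apply Rmax_lub_lt; lra). unfold s in *; lra. }
        assert (Hs' : seg T s) by (unfold seg in *; lra).
        pose proof (K s Hs' ltac:(apply Rabs_def1; lra)) as k. apply dec_minus_swap in k.
        pose proof (dec_plus _ _ _ _ _ (HR s Hs') k) as k'.
        apply dec_ext with (2 := k'). intros b j. rewrite (HE s b j) by lra. ring. }
    intros t b j Ht Htd.
    destruct (Rlt_le_dec t S) as [h|h]; [apply HE; unfold seg in Ht; lra|].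
    apply (loc t Ht); [|unfold seg in *; lra].
    intros s Hs. assert (Hs' : seg T s) by (unfold seg in *; lra).
    destruct (Rlt_le_dec s S) as [h'|h'].
    - apply dec_ext with (mom l (zeta s)); [intros; symmetry; apply HE; unfold seg in Hs; lra|].
      apply dec_le with R; [lra | auto].
    - pose proof (K s Hs' ltac:(unfold seg in Hs; apply Rabs_def1; lra)) as k.
      pose proof (dec_plus _ _ _ _ _ HRS k) as k'.
      apply (dec_le _ _ (R + 1)) in k'; [|lra].
      apply dec_ext with (2 := k'). intros; ring. }
  assert (main : forall t b j, seg T t -> mom l (zeta' t) b j = mom l (zeta t) b j).
  { destruct (completeness E) as [S [HSu HSl]].
    - exists T. intros s [Hs _]. unfold seg in Hs. lra.
    - exists 0. split; [exact S0 | intros; lra].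
    - assert (ES : E S).
      { split.
        - split; [apply HSu; split; [exact S0 | intros; lra]|].
          apply HSl. intros s [Hs _]. unfold seg in Hs. lra.
        - intros t b j Ht.
          destruct (Req_dec (mom l (zeta' t) b j) (mom l (zeta t) b j)) as [h|h]; [exact h|exfalso].
          assert (S <= t); [|lra]. apply HSl. intros s [Hs Es].
          apply Rnot_lt_le. intros L. apply h, Es. lra. }
      destruct (extend S ES) as (d & Hd & K).
      assert (HST : S = T).
      { destruct ES as [[_ HS] _]. apply Rle_antisym; [exact HS|]. apply Rnot_lt_le. intros L.
        assert (ES' : E (Rmin T (S + d))).
        { pose proof (Rmin_l T (S + d)). pose proof (Rmin_r T (S + d)). split.
          - unfold seg. split; [|lra]. apply Rmin_glb; [lra|].
            assert (0 <= S) by (apply HSu; split; [exact S0 | intros; lra]). lra.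
          - intros t b j Ht. apply K; unfold seg; lra. }
        apply HSu in ES'. assert (S < Rmin T (S + d)) by (apply Rmin_glb_lt; lra). lra. }
      subst S. intros t b j Ht. apply K; [exact Ht | unfold seg in Ht; lra]. }
  intros t x Ht. apply Rminus_diag_uniq. revert x.
  pose proof (cont_on_cts _ _ t cz Ht). pose proof (cont_on_cts _ _ t cz' Ht).
  apply (fourier_unique l (fun x => zeta' t x - zeta t x)); auto with cts.
  - intros x. now rewrite (pz t Ht), (pz' t Ht).
  - intros b j. rewrite mom_minus by assumption. rewrite main by exact Ht. ring.
Qed.

(** * Existence of classical solutions *)

(** A multiplier of order [n] costs [n] exponents. *)
Lemma dec_mult n p K A c z : (forall j, Rabs (c j) <= K * (1 + INR j) ^ n) -> dec (n + p) A z ->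
  dec p (K * A) (fun b j => c j * z b j).
Proof.
  intros Hc Hz b j. specialize (Hc j). specialize (Hz b j). rewrite pow_add in Hz.
  pose proof (w_pow_pos j n). pose proof (w_pow_pos j p). pose proof (Rabs_pos (c j)).
  assert (HK : 0 <= K) by nra.
  rewrite Rabs_mult.
  apply Rle_trans with (K * (1 + INR j) ^ n * Rabs (z b j) * (1 + INR j) ^ p).
  - apply Rmult_le_compat_r; [lra|]. apply Rmult_le_compat_r; [apply Rabs_pos | exact Hc].
  - replace (K * (1 + INR j) ^ n * Rabs (z b j) * (1 + INR j) ^ p)
      with (K * (Rabs (z b j) * ((1 + INR j) ^ n * (1 + INR j) ^ p))) by ring.
    now apply Rmult_le_compat_l.
Qed.

(** The image under the multiplier is built as a Fourier series; [FS_mom] then recovers its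
    coefficients. *)
Lemma realize_FS l D c c' n K A u : 0 < l -> (forall k, c k = c' (jidx k)) ->
  (forall j, Rabs (c' j) <= K * (1 + INR j) ^ n) -> cont_on D u ->
  (forall t, D t -> dec (n + 2) A (mom l (u t))) ->
  cont_on D (fun t x => FS l (fun b j => c' j * mom l (u t) b j) x) /\
  realizes l D c u (fun t x => FS l (fun b j => c' j * mom l (u t) b j) x).
Proof.
  intros Hl E Hc cu HA.
  assert (HD : forall t, D t -> dec 2 (K * A) (fun b j => c' j * mom l (u t) b j))
    by (intros t Ht; apply dec_mult with n; auto).
  assert (cv : cont_on D (fun t x => FS l (fun b j => c' j * mom l (u t) b j) x)).
  { apply (FS_cont_on l D (fun t b j => c' j * mom l (u t) b j) (K * A)); auto. intros b j.
    apply (cont_on_mult D (fun _ _ => c' j)); [apply cont_on_const|].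
    exact (mom_cont l D u b j Hl cu). }
  split; [exact cv|]. apply (mom_realizes l D c c'); auto.
  - intros t Ht. now apply FS_per.
  - intros t b j Ht. apply (FS_mom l (fun b j => c' j * mom l (u t) b j) (K * A)); auto.
    rewrite mom_false_0. ring.
Qed.

Lemma cont_t_dz l D (z : R -> bool -> nat -> R) : (forall b j, cont_t D (fun t => z t b j)) ->
  forall b j, cont_t D (fun t => dz l (z t) b j).
Proof. intros H b j. exact (cont_on_mult D _ _ (cont_on_const _ (- sg b * om l j)) (H (negb b) j)). Qed.

Lemma deta_of_derive (D : R -> Prop) u u' : (forall t, D t -> forall x, is_derive (u t) x (u' t x)) -> deta D u u'.
Proof. intros H t x Ht. apply is_derive_Reals. now apply H. Qed.

(** For eps at most 1, X is at most 1 + 2 y, hence at most [growth l] times 1 + j. *)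
Definition growth (l : R) : R := 1 + 2 * om l 1.

Lemma fj_growth l eps j : 0 < l -> 0 < eps <= 1 ->
  Rabs (fj eps l j) <= 3 * growth l ^ 3 * (1 + INR j) ^ 3.
Proof.
  intros Hl He. eapply Rle_trans; [apply fj_bound, He|].
  rewrite Rmult_assoc, <- Rpow_mult_distr. apply Rmult_le_compat_l; [lra|]. apply pow_incr.
  split; [pose proof (Xj_ge_1 eps l j (proj1 He)); lra | now apply Xj_le].
Qed.

Lemma bj_growth l eps j : 0 < l -> 0 < eps <= 1 ->
  Rabs (bj eps l j) <= 3 * growth l ^ 2 * (1 + INR j) ^ 2.
Proof.
  intros Hl He. destruct (bj_bounds eps l j He). rewrite Rabs_right by lra.
  apply Rle_trans with (3 * Xj eps l j ^ 2); [lra|].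
  rewrite Rmult_assoc, <- Rpow_mult_distr. apply Rmult_le_compat_l; [lra|]. apply pow_incr.
  split; [pose proof (Xj_ge_1 eps l j (proj1 He)); lra | now apply Xj_le].
Qed.

Lemma om_sqr_le l j : 0 < l -> om l j ^ 2 <= om l 1 ^ 2 * (1 + INR j) ^ 2.
Proof.
  intros Hl. rewrite <- Rpow_mult_distr. apply pow_incr. split; [now apply om_pos | now apply om_le].
Qed.

Lemma hj_growth l eps j : 0 < l -> 0 < eps <= 1 ->
  Rabs (hj eps l j) <= 8 * om l 1 ^ 2 * (1 + INR j) ^ 2.
Proof.
  intros Hl He. eapply Rle_trans; [apply hj_bound, He|]. pose proof (om_sqr_le l j Hl). lra.
Qed.

Lemma mj_growth l eps j : 0 < l -> 0 < eps <= 1 ->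
  Rabs (mj eps l j) <= 7 * om l 1 ^ 2 * growth l ^ 2 * (1 + INR j) ^ 4.
Proof.
  intros Hl He. eapply Rle_trans; [apply mj_bound, He|].
  pose proof (om_sqr_le l j Hl) as h1. pose proof (pow2_ge_0 (om l j)) as h2.
  assert (h3 : Xj eps l j ^ 2 <= growth l ^ 2 * (1 + INR j) ^ 2).
  { rewrite <- Rpow_mult_distr. apply pow_incr.
    split; [pose proof (Xj_ge_1 eps l j (proj1 He)); lra | now apply Xj_le]. }
  pose proof (pow2_ge_0 (Xj eps l j)) as h4.
  replace (7 * om l 1 ^ 2 * growth l ^ 2 * (1 + INR j) ^ 4)
    with (7 * ((om l 1 ^ 2 * (1 + INR j) ^ 2) * (growth l ^ 2 * (1 + INR j) ^ 2))) by ring.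
  rewrite Rmult_assoc. apply Rmult_le_compat_l; [lra|]. now apply Rmult_le_compat.
Qed.

Section Classical.

Variables (l T A : R) (Psi : R -> R -> R) (q dq : R -> bool -> nat -> R).
Hypothesis Hl : 0 < l.
Hypothesis HT : 0 < T.
Hypothesis Hq : forall t, seg T t -> dec 12 A (q t).
Hypothesis Hdq : forall t, seg T t -> dec 8 A (dq t).
Hypothesis Dq : forall b j t, seg T t -> deriv_within (seg T) (fun s => q s b j) t (dq t b j).
Hypothesis cdq : forall b j, cont_t (seg T) (fun t => dq t b j).
Hypothesis EPsi : forall t, seg T t -> forall x, Psi t x = FS l (q t) x.
Hypothesis q0 : forall t, q t false O = 0.
Hypothesis dq0 : forall t, dq t false O = 0.

Lemma q_cont b j : cont_t (seg T) (fun t => q t b j).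
Proof. apply limit_cont_t. intros t Ht. eapply deriv_within_cont. now apply Dq. Qed.

Lemma Psi_cont : cont_on (seg T) Psi.
Proof.
  apply (cont_on_ext (seg T) (fun t x => FS l (q t) x)).
  - intros t x Ht. now rewrite EPsi.
  - apply (FS_cont_on l (seg T) q A); auto.
    + intros t Ht. apply dec_mono with 12%nat; [lia | auto].
    + apply q_cont.
Qed.

Lemma Psi_per t : seg T t -> periodic l (Psi t).
Proof. intros Ht x. rewrite !EPsi by exact Ht. now apply FS_per. Qed.

Lemma Psi_mom t b j : seg T t -> mom l (Psi t) b j = q t b j.
Proof.
  intros Ht. rewrite (mom_ext l _ (FS l (q t))) by (intros; now apply EPsi).
  apply (FS_mom l (q t) A); auto. apply dec_mono with 12%nat; [lia | auto].
Qed.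

Lemma Psi_derive t x : seg T t -> is_derive (Psi t) x (FS l (dz l (q t)) x).
Proof.
  intros Ht. apply (is_derive_ext (FS l (q t))); [intros y; symmetry; now apply EPsi|].
  apply FS_derive with A; [exact Hl|]. apply dec_mono with 12%nat; [lia | auto].
Qed.

Lemma Psi_x_cont : cont_on (seg T) (fun t x => FS l (dz l (q t)) x).
Proof.
  apply (FS_cont_on l (seg T) (fun t => dz l (q t)) (om l 1 * A)); auto.
  - intros t Ht. apply dec_dz; [exact Hl|]. apply dec_mono with 12%nat; [lia | auto].
  - apply cont_t_dz, q_cont.
Qed.

Lemma Psi_sqr_mom t : seg T t -> dec 11 (Cmul l 11 * A * A) (mom l (fun x => Psi t x ^ 2)).
Proof.
  intros Ht. apply dec_ext with (mom l (fun x => FS l (q t) x * Psi t x)).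
  - intros b j. apply mom_ext. intros x. rewrite (EPsi t Ht). ring.
  - apply mom_FS_mul; auto; [lia | apply (cont_on_cts _ _ t Psi_cont Ht) | apply dec_mono with 12%nat; [lia | auto] |].
    apply dec_ext with (q t); [intros; now rewrite Psi_mom|]. apply dec_mono with 12%nat; [lia | auto].
Qed.

(** First summand: H of order 2 on exponent 8. Second: M of order 4 on the derivative of Psi^2,
    which has exponent 10. Both leave 6, and [eps] does not occur. *)
Definition Rdata : R :=
  8 * om l 1 ^ 2 * A + 7 * om l 1 ^ 2 * growth l ^ 2 * (om l 1 * (Cmul l 11 * A * A)).

Lemma forcing_dec eps t : 0 < eps <= 1 -> seg T t -> dec 6 Rdata (forcing l eps Psi dq t).
Proof.
  intros He Ht. unfold forcing, Rdata. apply dec_plus.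
  - apply (dec_mult 2 6 _ A (fun j => - hj eps l j)).
    + intros j. rewrite Rabs_Ropp. now apply hj_growth.
    + now apply Hdq.
  - apply (dec_mult 4 6 _ _ (mj eps l)).
    + intros j. now apply mj_growth.
    + apply dec_dz; [exact Hl | now apply Psi_sqr_mom].
Qed.

Lemma forcing_cont eps b j : cont_t (seg T) (fun t => forcing l eps Psi dq t b j).
Proof.
  unfold forcing. apply (cont_on_plus (seg T) (fun t _ => - hj eps l j * dq t b j)).
  - apply (cont_on_mult (seg T) (fun _ _ => - hj eps l j)); [apply cont_on_const | apply cdq].
  - apply (cont_on_mult (seg T) (fun _ _ => mj eps l j)); [apply cont_on_const|].
    apply (cont_t_dz l (seg T) (fun t => mom l (fun x => Psi t x ^ 2))). intros b' j'.
    apply (mom_cont l (seg T) (fun t x => Psi t x ^ 2)); [exact Hl|]. apply cont_on_pow, Psi_cont.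
Qed.

Variables (eps Rz : R) (z : R -> bool -> nat -> R).
Hypothesis Heps : 0 < eps <= 1.
Hypothesis HR : forall t, seg T t -> dec 6 Rz (z t).
Hypothesis cz : forall b j, cont_t (seg T) (fun t => z t b j).
Hypothesis z0 : forall t, seg T t -> z t false O = 0.
Hypothesis zi : forall b j, z 0 b j = 0.
Hypothesis ode : forall t b j, seg T t ->
  deriv_within (seg T) (fun s => z s b j) t
    (- arate l (bj eps l) j * z t b j
     + rhs l (bj eps l) (fj eps l) eps Psi (forcing l eps Psi dq) z t b j).

Let zeta (t x : R) : R := FS l (z t) x.

Lemma zeta_cont : cont_on (seg T) zeta.
Proof.
  apply (FS_cont_on l (seg T) z Rz); auto. intros t Ht. apply dec_mono with 6%nat; [lia | auto].
Qed.

Lemma zeta_mom t b j : seg T t -> mom l (zeta t) b j = z t b j.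
Proof.
  intros Ht. apply (FS_mom l (z t) Rz); auto. apply dec_mono with 6%nat; [lia | auto].
Qed.

(** One space derivative for one exponent; used four times, from 6 down to 2. *)
Lemma space_chain p C (y : R -> bool -> nat -> R) : (2 <= p)%nat ->
  (forall t, seg T t -> dec (S p) C (y t)) -> (forall b j, cont_t (seg T) (fun t => y t b j)) ->
  deta (seg T) (fun t x => FS l (y t) x) (fun t x => FS l (dz l (y t)) x) /\
  cont_on (seg T) (fun t x => FS l (dz l (y t)) x) /\
  (forall t, seg T t -> dec p (om l 1 * C) (dz l (y t))) /\
  (forall b j, cont_t (seg T) (fun t => dz l (y t) b j)).
Proof.
  intros Hp Hy cy.
  assert (HD : forall t, seg T t -> dec p (om l 1 * C) (dz l (y t))) by (intros; apply dec_dz; auto).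
  assert (cD : forall b j, cont_t (seg T) (fun t => dz l (y t) b j)) by now apply cont_t_dz.
  repeat split; auto.
  - apply deta_of_derive. intros t Ht x. apply FS_derive with C; [exact Hl|].
    apply dec_mono with (S p); [lia | auto].
  - apply (FS_cont_on l (seg T) (fun t => dz l (y t)) (om l 1 * C)); auto.
    intros t Ht. apply dec_mono with p; auto.
Qed.

(** Every function asked for is exhibited either as a Fourier series whose coefficients have
    exponent at least 2 or, for the derivatives of products, by the product rule. *)
Lemma classical_solution : zeta_sol l eps T Psi zeta.
Proof.
  pose proof Psi_cont as cPsi. pose proof zeta_cont as cze.
  destruct (space_chain 5 Rz z) as (D1 & c1 & H1 & k1); auto; try lia.
  destruct (space_chain 4 _ _ ltac:(lia) H1 k1) as (D2 & c2 & H2 & k2).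
  destruct (space_chain 3 _ _ ltac:(lia) H2 k2) as (D3 & c3 & H3 & k3).
  destruct (space_chain 2 _ _ ltac:(lia) H3 k3) as (D4 & c4 & H4 & k4).
  set (z1 := fun t => dz l (z t)) in *. set (z2 := fun t => dz l (z1 t)) in *.
  set (z3 := fun t => dz l (z2 t)) in *. set (z4 := fun t => dz l (z3 t)) in *.
  set (P1 := fun t x => FS l (dz l (q t)) x).
  assert (cP1 : cont_on (seg T) P1) by exact Psi_x_cont.
  set (Psit := fun t x => FS l (dq t) x).
  assert (cPt : cont_on (seg T) Psit).
  { apply (FS_cont_on l (seg T) dq A); auto. intros t Ht. apply dec_mono with 8%nat; [lia | auto]. }
  assert (dPt : dtau (seg T) Psi Psit).
  { intros t x Ht. apply (deriv_within_ext _ (fun s => FS l (q s) x)); [exact Ht | intros s Hs; now rewrite EPsi |].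
    apply (FS_dtau T l q dq A A); auto; intros s Hs.
    - apply dec_mono with 12%nat; [lia | auto].
    - apply dec_mono with 8%nat; [lia | auto]. }
  assert (mPt : forall t b j, seg T t -> mom l (Psit t) b j = dq t b j).
  { intros t b j Ht. apply (FS_mom l (dq t) A); auto. apply dec_mono with 8%nat; [lia | auto]. }
  set (P2d := fun t x => 2 * (Psi t x * P1 t x)).
  set (Z2d := fun t x => 2 * (zeta t x * FS l (z1 t) x)).
  set (PZd := fun t x => P1 t x * zeta t x + Psi t x * FS l (z1 t) x).
  assert (cP2 : cont_on (seg T) P2d) by (unfold P2d; auto 10 with cts).
  assert (cZ2 : cont_on (seg T) Z2d) by (unfold Z2d; auto 10 with cts).
  assert (cPZ : cont_on (seg T) PZd) by (unfold PZd; auto 10 with cts).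
  assert (dze : forall t, seg T t -> forall x, is_derive (zeta t) x (FS l (z1 t) x))
    by (intros t Ht; apply (deta_derive _ _ _ t D1 Ht)).
  assert (dPZ0 : forall t, seg T t -> forall x, is_derive (fun y => Psi t y * zeta t y) x (PZd t x)).
  { intros t Ht x. apply (is_derive_mult (Psi t) (zeta t)); [now apply Psi_derive | now apply dze | apply Rmult_comm]. }
  assert (dP20 : forall t, seg T t -> forall x, is_derive (fun y => Psi t y ^ 2) x (P2d t x)).
  { intros t Ht x. apply (is_derive_ext (fun y => Psi t y * Psi t y)); [intros; simpl; symmetry; now rewrite Rmult_1_r|].
    evar_last; [apply (is_derive_mult (Psi t) (Psi t)); [now apply Psi_derive | now apply Psi_derive | apply Rmult_comm]|].
    unfold P2d, P1, plus, mult; simpl. ring. }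
  assert (dZ20 : forall t, seg T t -> forall x, is_derive (fun y => zeta t y ^ 2) x (Z2d t x)).
  { intros t Ht x. apply (is_derive_ext (fun y => zeta t y * zeta t y)); [intros; simpl; symmetry; now rewrite Rmult_1_r|].
    evar_last; [apply (is_derive_mult (zeta t) (zeta t)); [now apply dze | now apply dze | apply Rmult_comm]|].
    unfold Z2d, plus, mult; simpl. ring. }
  assert (pz : forall t, periodic l (zeta t)) by (intros t; now apply FS_per).
  assert (mP2 : forall t b j, seg T t -> mom l (P2d t) b j = dz l (mom l (fun x => Psi t x ^ 2)) b j).
  { intros t b j Ht. apply mom_derive; auto.
    - intros x. now rewrite (Psi_per t Ht).
    - apply (cont_on_cts _ _ t cP2 Ht). }
  assert (mZ2 : forall t b j, seg T t -> mom l (Z2d t) b j = dz l (mom l (fun x => zeta t x ^ 2)) b j).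
  { intros t b j Ht. apply mom_derive; auto.
    - intros x. now rewrite (pz t).
    - apply (cont_on_cts _ _ t cZ2 Ht). }
  assert (mPZ : forall t b j, seg T t -> mom l (PZd t) b j = dz l (mom l (fun x => Psi t x * zeta t x)) b j).
  { intros t b j Ht. apply mom_derive; auto.
    - intros x. now rewrite (Psi_per t Ht), (pz t).
    - apply (cont_on_cts _ _ t cPZ Ht). }
  set (CZ := Cmul l 6 * Rz * Rz). set (CP := Cmul l 6 * Rz * A).
  assert (hz : forall t, seg T t -> dec 6 Rz (mom l (zeta t))).
  { intros t Ht. apply dec_ext with (z t); [intros; now rewrite zeta_mom | auto]. }
  assert (hZ2 : forall t, seg T t -> dec 5 (om l 1 * CZ) (mom l (Z2d t))).
  { intros t Ht. apply dec_ext with (dz l (mom l (fun x => zeta t x ^ 2))); [intros; now rewrite mZ2|].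
    apply dec_dz; [exact Hl|].
    apply dec_ext with (mom l (fun x => FS l (z t) x * zeta t x)).
    - intros b j. apply mom_ext. intros x. unfold zeta. ring.
    - apply mom_FS_mul; auto. apply (cont_on_cts _ _ t cze Ht). }
  assert (hPZ : forall t, seg T t -> dec 5 (om l 1 * CP) (mom l (PZd t))).
  { intros t Ht. apply dec_ext with (dz l (mom l (fun x => Psi t x * zeta t x))); [intros; now rewrite mPZ|].
    apply dec_dz; [exact Hl|].
    apply dec_ext with (mom l (fun x => FS l (z t) x * Psi t x)).
    - intros b j. apply mom_ext. intros x. unfold zeta. ring.
    - apply mom_FS_mul; auto; [apply (cont_on_cts _ _ t cPsi Ht) |].
      apply dec_ext with (q t); [intros; now rewrite Psi_mom|]. apply dec_mono with 12%nat; [lia | auto]. }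
  destruct (realize_FS l (seg T) (bsym eps l) (bj eps l) 2 _ Rz zeta Hl (bsym_bj eps l)
    (fun j => bj_growth l eps j Hl Heps) cze) as [cB rB].
  { intros t Ht. apply dec_mono with 6%nat; [lia | auto]. }
  destruct (realize_FS l (seg T) (hsym eps l) (hj eps l) 2 _ A Psit Hl (hsym_hj eps l)
    (fun j => hj_growth l eps j Hl Heps) cPt) as [cH rH].
  { intros t Ht. apply dec_ext with (dq t); [intros; now rewrite mPt|]. apply dec_mono with 8%nat; [lia | auto]. }
  destruct (realize_FS l (seg T) (msym eps l) (mj eps l) 4 _ (om l 1 * (Cmul l 11 * A * A)) P2d Hl (msym_mj eps l)
    (fun j => mj_growth l eps j Hl Heps) cP2) as [cM rM].
  { intros t Ht. apply dec_ext with (dz l (mom l (fun x => Psi t x ^ 2))); [intros; now rewrite mP2|].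
    apply dec_dz; [exact Hl|]. apply dec_mono with 11%nat; [lia | now apply Psi_sqr_mom]. }
  destruct (realize_FS l (seg T) (fsym eps l) (fj eps l) 3 _ (om l 1 * CZ) Z2d Hl (fsym_fj eps l)
    (fun j => fj_growth l eps j Hl Heps) cZ2 hZ2) as [cF rF].
  destruct (realize_FS l (seg T) (fsym eps l) (fj eps l) 3 _ (om l 1 * CP) PZd Hl (fsym_fj eps l)
    (fun j => fj_growth l eps j Hl Heps) cPZ hPZ) as [cFP rFP].
  (* Coefficients of the time derivative of B zeta, that is of the right-hand side minus H(Psi_tau).
     Division by [bj] gives those of zeta_tau. *)
  set (Bt := fun t b j => -4 * z4 t b j + (-1 * z2 t b j + (mj eps l j * mom l (P2d t) b j
     + (eps * (fj eps l j * mom l (Z2d t) b j) + (2 * (fj eps l j * mom l (PZd t) b j)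
     + -1 * (hj eps l j * mom l (Psit t) b j)))))).
  assert (Hb : forall j, 1 <= bj eps l j) by (intros j; apply (bj_bounds eps l j Heps)).
  assert (EBt : forall t b j, seg T t -> - arate l (bj eps l) j * z t b j
     + rhs l (bj eps l) (fj eps l) eps Psi (forcing l eps Psi dq) z t b j = / bj eps l j * Bt t b j).
  { intros t b j Ht. unfold Bt, rhs, forcing, quadr. rewrite mP2, mZ2, mPZ, mPt by exact Ht.
    pose proof (cont_on_cts _ _ t cze Ht). pose proof (cont_on_cts _ _ t cPsi Ht).
    assert (EQ : forall b j, mom l (fun x => FS l (z t) x * (2 * Psi t x + eps * FS l (z t) x)) b j
       = 2 * mom l (fun x => Psi t x * zeta t x) b j + eps * mom l (fun x => zeta t x ^ 2) b j).
    { intros b' j'. rewrite (mom_ext l _ (fun x => 2 * (Psi t x * zeta t x) + eps * zeta t x ^ 2))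
        by (intros; unfold zeta; ring).
      now rewrite mom_plus, !mom_scal by auto with cts. }
    unfold z4, z3. rewrite dz_dz. unfold z2, z1. rewrite dz_dz. unfold dz at 1. rewrite EQ.
    unfold arate, dz. specialize (Hb j). field. lra. }
  assert (HM : forall t, seg T t -> dec 2 (7 * om l 1 ^ 2 * growth l ^ 2 * (om l 1 * (Cmul l 11 * A * A)))
      (fun b j => mj eps l j * mom l (P2d t) b j)).
  { intros t Ht. apply (dec_mult 4 2); [intros j; now apply mj_growth|].
    apply dec_ext with (dz l (mom l (fun x => Psi t x ^ 2))); [intros; now rewrite mP2|].
    apply dec_dz; [exact Hl|]. apply dec_mono with 11%nat; [lia | now apply Psi_sqr_mom]. }
  assert (HF : forall t, seg T t -> dec 2 (3 * growth l ^ 3 * (om l 1 * CZ))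
      (fun b j => fj eps l j * mom l (Z2d t) b j)).
  { intros t Ht. apply (dec_mult 3 2); [intros j; now apply fj_growth | now apply hZ2]. }
  assert (HFP : forall t, seg T t -> dec 2 (3 * growth l ^ 3 * (om l 1 * CP))
      (fun b j => fj eps l j * mom l (PZd t) b j)).
  { intros t Ht. apply (dec_mult 3 2); [intros j; now apply fj_growth | now apply hPZ]. }
  assert (HH : forall t, seg T t -> dec 2 (8 * om l 1 ^ 2 * A)
      (fun b j => hj eps l j * mom l (Psit t) b j)).
  { intros t Ht. apply (dec_mult 2 2); [intros j; now apply hj_growth|].
    apply dec_ext with (dq t); [intros; now rewrite mPt|]. apply dec_mono with 8%nat; [lia | auto]. }
  assert (Hz2 : forall t, seg T t -> dec 2 (om l 1 * (om l 1 * Rz)) (z2 t)).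
  { intros t Ht. apply dec_mono with 4%nat; [lia | now apply H2]. }
  assert (Hz4 : forall t, seg T t -> dec 2 (om l 1 * (om l 1 * (om l 1 * (om l 1 * Rz)))) (z4 t))
    by exact H4.
  assert (HBt : exists CB, forall t, seg T t -> dec 2 CB (Bt t)).
  { eexists. intros t Ht. unfold Bt.
    exact (dec_plus _ _ _ _ _ (dec_scal _ _ (-4) _ (Hz4 t Ht)) (dec_plus _ _ _ _ _ (dec_scal _ _ (-1) _ (Hz2 t Ht))
      (dec_plus _ _ _ _ _ (HM t Ht) (dec_plus _ _ _ _ _ (dec_scal _ _ eps _ (HF t Ht))
      (dec_plus _ _ _ _ _ (dec_scal _ _ 2 _ (HFP t Ht)) (dec_scal _ _ (-1) _ (HH t Ht))))))). }
  destruct HBt as [CB HBt].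
  assert (cBt : forall b j, cont_t (seg T) (fun t => Bt t b j)).
  { intros b j. unfold Bt, cont_t.
    pose proof (k4 b j) as a4. pose proof (k2 b j) as a2. unfold cont_t in a4, a2.
    pose proof (mom_cont l (seg T) P2d b j Hl cP2) as a5. pose proof (mom_cont l (seg T) Z2d b j Hl cZ2) as a6.
    pose proof (mom_cont l (seg T) PZd b j Hl cPZ) as a7. pose proof (mom_cont l (seg T) Psit b j Hl cPt) as a8.
    unfold cont_t in *. auto 20 with cts. }
  set (zt := fun t x => FS l (fun b j => / bj eps l j * Bt t b j) x).
  assert (Hzt : forall t, seg T t -> dec 2 (1 * CB) (fun b j => / bj eps l j * Bt t b j)).
  { intros t Ht. apply (dec_mult 0 2); [|now apply HBt]. intros j. specialize (Hb j).
    assert (0 < / bj eps l j) by (apply Rinv_0_lt_compat; lra).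
    assert (/ bj eps l j <= 1) by (rewrite <- Rinv_1; apply Rinv_le_contravar; lra).
    simpl. rewrite Rabs_right; lra. }
  assert (ODE : forall b j t, seg T t -> deriv_within (seg T) (fun s => z s b j) t (/ bj eps l j * Bt t b j)).
  { intros b j t Ht. rewrite <- EBt by exact Ht. now apply ode. }
  split; [exact (fun t _ => pz t)|].
  split.
  { intros x. unfold zeta. rewrite (FS_ext l _ (fun b j => 0 * 0)) by (intros; rewrite zi; ring).
    rewrite FS_scal. ring. }
  split; [exact cze|].
  exists zt, (fun t x => FS l (z1 t) x), (fun t x => FS l (z2 t) x), (fun t x => FS l (z3 t) x), (fun t x => FS l (z4 t) x).
  exists (fun t x => FS l (fun b j => bj eps l j * mom l (zeta t) b j) x), (fun t x => FS l (Bt t) x).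
  exists Psit, (fun t x => FS l (fun b j => hj eps l j * mom l (Psit t) b j) x).
  exists P2d, (fun t x => FS l (fun b j => mj eps l j * mom l (P2d t) b j) x).
  exists Z2d, (fun t x => FS l (fun b j => fj eps l j * mom l (Z2d t) b j) x).
  exists PZd, (fun t x => FS l (fun b j => fj eps l j * mom l (PZd t) b j) x).
  split.
  { apply (FS_dtau T l z (fun t b j => / bj eps l j * Bt t b j) Rz (1 * CB)); auto.
    intros t Ht. apply dec_mono with 6%nat; [lia | auto]. }
  split.
  { apply (FS_cont_on l (seg T) (fun t b j => / bj eps l j * Bt t b j) (1 * CB)); auto.
    intros b j. exact (cont_on_mult (seg T) _ _ (cont_on_const _ (/ bj eps l j)) (cBt b j)). }
  split; [exact D1|]. split; [exact D2|]. split; [exact D3|]. split; [exact D4|].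
  split; [exact c1|]. split; [exact c2|]. split; [exact c3|]. split; [exact c4|].
  split; [exact rB|]. split; [exact cB|].
  split.
  { apply (FS_dtau T l (fun t b j => bj eps l j * mom l (zeta t) b j) Bt (3 * growth l ^ 2 * Rz) CB); auto.
    - intros t Ht. apply (dec_mult 2 2); [intros j; now apply bj_growth|].
      apply dec_mono with 6%nat; [lia | now apply hz].
    - intros b j t Ht. apply (deriv_within_ext _ (fun s => bj eps l j * z s b j)); [exact Ht | |].
      + intros s Hs. now rewrite zeta_mom.
      + replace (Bt t b j) with (bj eps l j * (/ bj eps l j * Bt t b j))
          by (specialize (Hb j); field; lra).
        now apply deriv_within_scal, ODE. }
  split; [exact (FS_cont_on l (seg T) Bt CB Hl HBt cBt)|].
  split; [exact dPt|]. split; [exact cPt|]. split; [exact rH|]. split; [exact cH|].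
  split; [exact (deta_of_derive (seg T) (fun t y => Psi t y ^ 2) P2d dP20)|]. split; [exact cP2|].
  split; [exact rM|]. split; [exact cM|].
  split; [exact (deta_of_derive (seg T) (fun t y => zeta t y ^ 2) Z2d dZ20)|]. split; [exact cZ2|].
  split; [exact rF|]. split; [exact cF|].
  split; [exact (deta_of_derive (seg T) (fun t y => Psi t y * zeta t y) PZd dPZ0)|]. split; [exact cPZ|].
  split; [exact rFP|]. split; [exact cFP|].
  intros t x Ht.
  pose proof (dec_scal _ _ 2 _ (HFP t Ht)) as e1. pose proof (dec_scal _ _ (-1) _ (HH t Ht)) as e2.
  pose proof (dec_scal _ _ eps _ (HF t Ht)) as e3. pose proof (dec_scal _ _ (-1) _ (Hz2 t Ht)) as e4.
  pose proof (dec_scal _ _ (-4) _ (Hz4 t Ht)) as e5. pose proof (dec_plus _ _ _ _ _ e1 e2) as e6.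
  pose proof (dec_plus _ _ _ _ _ e3 e6) as e7. pose proof (dec_plus _ _ _ _ _ (HM t Ht) e7) as e8.
  pose proof (dec_plus _ _ _ _ _ e4 e8) as e9.
  unfold Bt.
  rewrite (FS_plus l _ _ _ _ x Hl e5 e9), (FS_plus l _ _ _ _ x Hl e4 e8), (FS_plus l _ _ _ _ x Hl (HM t Ht) e7),
    (FS_plus l _ _ _ _ x Hl e3 e6), (FS_plus l _ _ _ _ x Hl e1 e2), !FS_scal. ring.
Qed.

End Classical.

(** * Choice of the constants *)

Theorem theorem5p7 :
  forall l0 : R, l0 > 4 * PI ->
  exists m0 : nat, forall m : nat, (m0 <= m)%nat ->
  forall (Phi0 : R -> R) (Phi Psi : R -> R -> R),
    Hm_sharp l0 m Phi0 ->
    ks_sol l0 Phi0 Phi ->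
    deta (fun t => 0 <= t) Phi Psi ->
    forall T : R, T > 0 ->
    exists eps0 : R, eps0 > 0 /\
      forall eps : R, 0 < eps <= eps0 ->
        exists zeta : R -> R -> R,
          zeta_sol l0 eps T Psi zeta /\
          forall zeta' : R -> R -> R, zeta_sol l0 eps T Psi zeta' ->
            forall t x, 0 <= t <= T -> zeta' t x = zeta t x.
Proof.
  intros l Hl4. assert (Hl : 0 < l) by (pose proof PI_RGT_0; lra).
  exists 13%nat. intros m Hm Phi0 Phi Psi H0 Hks HPsi T HT.
  destruct (ks_regular l m Phi0 Phi Psi T) as (q & dq & A & Hq & Hdq & Dq & cdq & EPsi & q0 & dq0); auto.
  assert (S0 : seg T 0) by (unfold seg; lra).
  assert (A0 : 0 <= A) by (eapply dec_nonneg; apply (Hq 0 S0)).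
  pose proof (Cmul_pos l 6 Hl) as C6. pose proof (Cmul_pos l 2 Hl) as C2.
  assert (C26 : Cmul l 2 <= Cmul l 6).
  { unfold Cmul. apply Rmult_le_compat_l; [left; apply Rdiv_lt_0_compat; lra|]. apply Rle_pow; [lra | lia]. }
  (* The Lipschitz constant is then at most 1/2 once the multiplier has norm at most [2 * A + 1];
     the 1 is room for the terms with [eps]. *)
  set (kap := / (2 * Cmul l 6 * (2 * A + 1))).
  assert (Hkap : 0 < kap) by (apply Rinv_0_lt_compat; nra).
  destruct (kernel_bound l kap Hl Hkap) as (gam & eps1 & Hgam & He1 & Hker).
  (* Uniform in [eps], so the radius [R2] is fixed before [eps0]. *)
  set (R0 := Rdata l A). assert (Hexp := exp_pos (gam * T)).
  assert (HR0 : 0 <= R0).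
  { eapply dec_nonneg. apply (forcing_dec l T A Psi q dq) with (eps := 1) (t := 0); auto; lra. }
  set (R2 := 2 * R0 * exp (gam * T)). assert (HR2 : 0 <= R2) by (unfold R2; nra).
  (* The resulting bound [eps * (2 * R2 + 1) <= 1] serves twice: existence involves
     [4 * R0 * exp (gam * T)], which is [2 * R2], and uniqueness involves [2 * R2 + 1]. *)
  exists (Rmin eps1 (/ (2 * R2 + 1))).
  assert (Hi : 0 < / (2 * R2 + 1)) by (apply Rinv_0_lt_compat; lra).
  split; [apply Rmin_glb_lt; lra|]. intros eps Heps.
  pose proof (Rmin_l eps1 (/ (2 * R2 + 1))). pose proof (Rmin_r eps1 (/ (2 * R2 + 1))).
  assert (He : 0 < eps <= 1) by lra.
  assert (HeR : eps * (2 * R2 + 1) <= 1).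
  { apply Rmult_le_reg_r with (/ (2 * R2 + 1)); [exact Hi|]. rewrite Rmult_assoc, Rinv_r by lra. lra. }
  assert (small : forall V, 0 <= V <= 2 * A + 1 -> forall C, 0 <= C <= Cmul l 6 -> kap * (C * V) <= / 2).
  { intros V HV C HC. apply Rle_trans with (kap * (Cmul l 6 * (2 * A + 1))).
    - apply Rmult_le_compat_l; [lra|]. apply Rmult_le_compat; lra.
    - right. unfold kap. field. split; lra. }
  assert (Hb : forall j, 1 <= bj eps l j) by (intros j; apply (bj_bounds eps l j He)).
  assert (Hk : forall j, om l j * Rabs (fj eps l j) <= kap * den l gam (bj eps l) j)
    by (intros j; apply Hker; lra).
  assert (Hd : forall j, 1 <= den l gam (bj eps l) j) by (intros j; apply (Hker eps); lra).
  pose proof (Psi_cont l T A Psi q dq Hl Hq Dq EPsi) as cPsi.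
  pose proof (Psi_mom l T A Psi q Hl Hq EPsi q0) as mPsi.
  pose proof (Psi_per l T Psi q Hl EPsi) as pPsi.
  assert (HP : forall t, seg T t -> dec 12 A (mom l (Psi t))).
  { intros t Ht. apply dec_ext with (q t); [intros; now rewrite mPsi | auto]. }
  destruct (mild_solution l T gam (bj eps l) Hl ltac:(lra) Hb Hd kap (fj eps l) Hk eps A R0 Psi
    (forcing l eps Psi dq)) as (z & Hz & cz & z0 & zi & ode); auto; try lra.
  { intros t Ht. apply dec_mono with 12%nat; [lia | auto]. }
  { intros t Ht. apply (forcing_dec l T A Psi q dq); auto. }
  { apply (forcing_cont l T A Psi q dq); auto. }
  { intros t. unfold forcing, dz. rewrite dq0, om_0. ring. }
  { apply small; [|lra]. unfold R2 in *. nra. }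
  assert (Hz' : forall t, seg T t -> dec 6 R2 (z t)).
  { intros t Ht. apply dec_le with (2 * R0 * exp (gam * t)); [|auto].
    apply Rmult_le_compat_l; [lra|]. apply exp_le. unfold seg in Ht. nra. }
  exists (fun t x => FS l (z t) x).
  assert (Hsol : zeta_sol l eps T Psi (fun t x => FS l (z t) x)).
  { apply (classical_solution l T A Psi q dq) with (Rz := R2); auto. }
  split; [exact Hsol|]. intros zeta' Hzeta'.
  apply (sol_unique l eps T gam kap Psi (fun t x => FS l (z t) x) zeta' dq A R2); auto; try lra.
  - intros b j t Ht. apply (deriv_within_ext _ (fun s => q s b j)); [exact Ht | | now apply Dq].
    intros s Hs. now rewrite mPsi.
  - intros t Ht. apply dec_mono with 12%nat; [lia | auto].
  - intros t Ht. apply dec_ext with (z t).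
    + intros b j. symmetry. apply (FS_mom l (z t) R2); auto. apply dec_mono with 6%nat; [lia | auto].
    + apply dec_mono with 6%nat; [lia | auto].
  - apply small; [|lra]. nra.
Qed.
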